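(* Let $d\ge 2$ be an integer and $D=d^2-1$. Let $E$ be a $D$-dimensional real Euclidean space written as an orthogonal direct sum $E=W_1\oplus\cdots\oplus W_{d+1}$ of subspaces each of dimension $d-1$. In each $W_r$ take the $d$ vertices of a regular simplex centered at the origin with circumradius $\sqrt{(d-1)/d}$ (equivalently, $d$ vectors $v_{r,1},\dots,v_{r,d}\in W_r$ with $\langle v_{r,j},v_{r,k}\rangle=-1/d$ for $j\ne k$ and $\|v_{r,j}\|^2=1-1/d$). Let $\mathcal{P}_d$ be the convex hull of all $d(d+1)$ points $v_{r,j}$ (the complementarity polytope). For $\varepsilon\ge0$ let $\mathcal{P}_{d,\varepsilon}$ be the set of points of $E$ at distance at most $\varepsilon$ from $\mathcal{P}_d$, and write $\mathrm{vol}_D(\mathcal{P}_{d,\varepsilon})=\sum_{k=0}^{D}a_k\varepsilon^k$; define the unnormalized intrinsic volumes $\widetilde{V}_{D-k}(\mathcal{P}_d)=a_k$. Set $\alpha=\arccos\big(1-\frac{d}{d^2-1}\big)$ and $\beta=\arccos\big(1-\frac{2d}{d^2-1}\big)$. Then $$\widetilde{V}_{D-2}(\mathcal{P}_d)=\frac{\sqrt{2d^2-d-2}\,(d^2-1)\,d^{d/2+1}}{4\,(d^2-3)!}\,\alpha,$$ and $$\widetilde{V}_{D-3}(\mathcal{P}_d)=\frac{2\sqrt{3d^2-2d-3}\,(d^2-1)(d-2)\,d^{d/2+1}}{9\,(d^2-4)!}\arctan\sqrt{\tan\tfrac{3\alpha}{4}\,\tan^3\tfrac{\alpha}{4}}\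;+\;\frac{2\sqrt{d^2-d-1}\,(d^2-1)(d-1)\,d^{d/2+2}}{3\,(d^2-4)!}\arctan\sqrt{\tan\!\big(\tfrac{\alpha}{2}+\tfrac{\beta}{4}\big)\tan\!\big(\tfrac{\alpha}{2}-\tfrac{\beta}{4}\big)\tan^2\!\big(\tfrac{\beta}{4}\big)}.$$
   Context: $\mathrm{vol}_D$ denotes $D$-dimensional Lebesgue measure in $E$. The polytope $\mathcal{P}_d$ is determined up to isometry by the stated configuration; it is the polytope whose vertices have the pairwise distances of the rank-one projectors of a complete system of $d+1$ mutually unbiased bases in $\mathbb{C}^d$ (distance $\sqrt2$ within a basis, $\sqrt{2-2/d}$ between different bases) under the Hilbert–Schmidt metric. *)

(* Defs.v *)
From HB Require Import structures.
From mathcomp Require Import all_boot all_order all_algebra.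
From mathcomp Require Import all_classical all_reals all_analysis.
Set Implicit Arguments. Unset Strict Implicit. Unset Printing Implicit Defensive.
Import Order.TTheory GRing.Theory Num.Theory.
Local Open Scope classical_set_scope.
Local Open Scope ring_scope.

Section Defs.
Variable R : realType.

Definition dotv (n : nat) (u v : 'rV[R]_n) : R := (u *m v^T) 0 0.
Definition enorm (n : nat) (u : 'rV[R]_n) : R := Num.sqrt (dotv u u).

Definition edist (n : nat) (x : 'rV[R]_n) (P : set 'rV[R]_n) : R :=
  inf [set enorm (x - p) | p in P].

Definition parallel_body (n : nat) (P : set 'rV[R]_n) (eps : R) : set 'rV[R]_n :=
  [set x | edist x P <= eps].

Definition conv_hull (I : finType) (n : nat) (v : I -> 'rV[R]_n) : set 'rV[R]_n :=
  [set x | exists w : I -> R, (forall i, 0 <= w i) /\ \sum_i w i = 1 /\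
                              x = \sum_i w i *: v i].

(* n-dimensional Lebesgue measure, as the iterated Lebesgue integral of the
   indicator function (coordinates listed as a sequence x_1 :: ... :: x_n). *)
Fixpoint iter_vol (n : nat) (A : set (seq R)) : \bar R :=
  match n with
  | 0 => ((\1_A [::] : R)%:E)
  | m.+1 => (\int[@lebesgue_measure R]_x iter_vol m (fun s => A (x :: s)))%E
  end.

Definition vol (n : nat) (S : set 'rV[R]_n) : \bar R :=
  iter_vol n (fun s => S (\row_(i < n) nth 0 s i)).

End Defs.

(* Main.v *)
Require Import Defs.
From HB Require Import structures.
From mathcomp Require Import all_boot all_order all_fingroup all_algebra.
From mathcomp Require Import all_classical all_reals all_analysis.
From mathcomp Require Import measurable_realfun zify ring lra.
Import Order.TTheory GRing.Theory Num.Theory numFieldNormedType.Exports.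
Set Implicit Arguments. Unset Strict Implicit. Unset Printing Implicit Defensive.
Local Open Scope classical_set_scope.
Local Open Scope ring_scope.

(** The polytope is simplicial: a set S of vertices spans a proper face iff S is nonempty and leaves
    out at least one vertex of every simplex, and the facets are the sets leaving out exactly
    one. Sort the points of the parallel body by the face that the outer normal at their nearest
    point exposes: the parallel body is the disjoint union of the polytope and of one cell for
    each proper face, and the cell of a face of dimension m is congruent to the product of the
    face and of its normal cone cut by the ball of radius eps, so it contributes a multiple of
    eps^(D-m). The volume of a face comes from the Gram determinant of its edges, which
    Sylvester's identity reduces to a diagonal determinant. In codimension 2 the normal cone is
    a sector of angle alpha. In codimension 3 a face leaves out either three vertices of one
    simplex, and the normal cone is an equilateral spherical triangle of sides alpha, or two
    vertices of two simplices, and it is a spherical quadrangle, cut by a diagonal beta into two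
    isosceles triangles of sides alpha, alpha, beta. Girard's formula gives the areas,
    L'Huilier's formula puts them in the form of the statement, and counting the faces of each
    type gives the coefficients. *)

(** * Lebesgue measure on row vectors *)

(** All geometry is read off inner products. A facet omits one vertex of each simplex, and minus the
    sum of the omitted vertices is an outer normal of it. Two such normals that disagree in k
    simplices have inner product rho - k, where rho = (d+1)(1 - 1/d) = (d^2-1)/d; the cosines are
    therefore 1 - k/rho, and k = 1, 2 give [alpha] and [beta]. Solid angles are measured as volumes:
    in coordinates along facet normals, the part of a normal cone inside the unit ball is cut out by
    positivity conditions and one quadratic form, and the square root of the Gram determinant is the
    Jacobian. Girard's formula thus becomes a statement about volumes of such sets in dimension 3.
    The first obstacle is that [vol] is an iterated integral defined on arbitrary sets, which offers
    neither additivity nor a change of variables; a sigma-finite measure [leb] with the same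
    recursion supplies both. The polytope itself enters as the cell of the full vertex set, whose
    only normal is 0; its volume is the constant coefficient and stays unevaluated. *)

Definition rvec_display : measure_display. Proof. exact. Qed.

Section rvec_measurable.
Variables (R : realType) (n : nat).

Let coor (i : 'I_n) (x : 'rV[R]_n) : measurableTypeR R := x 0 i.

Let rvec_set0 : g_sigma_preimage coor set0.
Proof. exact (@sigma_algebra0 _ setT _). Qed.

Let rvec_setC A : g_sigma_preimage coor A -> g_sigma_preimage coor (~` A).
Proof. exact (@sigma_algebraC _ _ _). Qed.

Let rvec_bigcup (F : (set _)^nat) : (forall i, g_sigma_preimage coor (F i)) ->
  g_sigma_preimage coor (\bigcup_i (F i)).
Proof. exact (@sigma_algebra_bigcup _ _ _ F). Qed.

HB.instance Definition _ := @isMeasurable.Build rvec_display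
  'rV[R]_n (g_sigma_preimage coor) rvec_set0 rvec_setC rvec_bigcup.

Lemma measurable_coord (i : 'I_n) :
  measurable_fun [set: 'rV[R]_n] (fun x => x 0 i).
Proof.
move=> _ Y mY; rewrite setTI; apply: sub_sigma_algebra => /=.
rewrite -bigcup_seq; exists i; first by rewrite /= mem_index_enum.
by exists Y => //; rewrite setTI.
Qed.

(** The sets with measurable preimage form a sigma-algebra, and it contains the generators, which
    are preimages under single coordinates. *)
Lemma measurable_rvec d (T : measurableType d) (f : T -> 'rV[R]_n) :
  (forall i, measurable_fun setT (fun t => f t 0 i)) -> measurable_fun setT f.
Proof.
move=> mf _ A mA; rewrite setTI.
pose G := [set B : set 'rV[R]_n | measurable (f @^-1` B)].
suff: g_sigma_preimage coor `<=` G by move=> /(_ A mA).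
apply: smallest_sub.
  split.
  - by rewrite /G /= preimage_set0.
  - by move=> B; rewrite /G /= setTD preimage_setC => /measurableC.
  - by move=> F mF; rewrite /G /= preimage_bigcup; apply: bigcup_measurable => k _; exact: mF.
move=> B; rewrite -bigcup_seq => -[i _ [Y mY <-]].
by rewrite /G /= setTI -[X in measurable X]setTI; apply: (mf i).
Qed.

End rvec_measurable.

Section rvec_measure.
Variable R : realType.

(** The scalar becomes coordinate 0, the variable that [iter_vol] integrates outermost. With
    [pair_of_rv] this identifies vectors of length n+1 with pairs, along which product measures are
    transported. *)
Definition rcons_rv n (p : measurableTypeR R * 'rV[R]_n) : 'rV[R]_n.+1 :=
  \row_i if unlift ord0 i is Some j then p.2 0 j else p.1.

Lemma rcons_rv0 n p : @rcons_rv n p 0 ord0 = p.1.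
Proof. by rewrite mxE unlift_none. Qed.

Lemma rcons_rvS n p i : @rcons_rv n p 0 (lift ord0 i) = p.2 0 i.
Proof. by rewrite mxE liftK. Qed.

Definition pair_of_rv n (x : 'rV[R]_n.+1) : measurableTypeR R * 'rV[R]_n :=
  (x 0 ord0, \row_i x 0 (lift ord0 i)).

Lemma rcons_rvK n : cancel (@rcons_rv n) (@pair_of_rv n).
Proof.
move=> p; rewrite /pair_of_rv rcons_rv0 [RHS]surjective_pairing; congr pair.
by apply/rowP => i; rewrite mxE rcons_rvS.
Qed.

Lemma pair_of_rvK n : cancel (@pair_of_rv n) (@rcons_rv n).
Proof.
move=> x; apply/rowP => i; have [j ->|->] := unliftP ord0 i.
  by rewrite rcons_rvS mxE.
by rewrite rcons_rv0.
Qed.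

Lemma measurable_rcons_rv n : measurable_fun setT (@rcons_rv n).
Proof.
apply: measurable_rvec => i; have [j ->|->] := unliftP ord0 i.
  under eq_fun do rewrite rcons_rvS.
  by apply: (measurableT_comp (measurable_coord j)); exact: measurable_snd.
by under eq_fun do rewrite rcons_rv0; exact: measurable_fst.
Qed.

Lemma measurable_rtail n :
  measurable_fun setT (fun x : 'rV[R]_n.+1 => \row_i x 0 (lift ord0 i)).
Proof.
apply: measurable_rvec => i; under eq_fun do rewrite mxE.
exact: measurable_coord.
Qed.

Lemma measurable_pair_of_rv n : measurable_fun setT (@pair_of_rv n).
Proof.
apply/measurable_fun_pairP; split; first exact: measurable_coord.
exact: measurable_rtail.
Qed.

Section step.
Variables (m1 : {sigma_finite_measure set (measurableTypeR R) -> \bar R}).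
Variables (n : nat) (mu : {sigma_finite_measure set 'rV[R]_n -> \bar R}).

Definition rvS : set 'rV[R]_n.+1 -> \bar R :=
  pushforward (m1 \x mu)%E (@rcons_rv n).

Let rvS0 : rvS set0 = 0%E.
Proof. by rewrite /rvS /pushforward preimage_set0 measure0. Qed.

Let rvS_ge0 A : (0 <= rvS A)%E.
Proof. by apply: integral_ge0 => x _; exact: measure_ge0. Qed.

Let rvS_sigma_additive : semi_sigma_additive rvS.
Proof.
move=> F mF tF mUF; rewrite /rvS /pushforward preimage_bigcup.
apply: measure_semi_sigma_additive.
- by move=> i; rewrite -[X in measurable X]setTI; exact: measurable_rcons_rv.
- apply/trivIsetP => /= i j _ _ ij; rewrite -preimage_setI.
  by move/trivIsetP : tF => /(_ _ _ _ _ ij) ->//; rewrite preimage_set0.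
- rewrite -preimage_bigcup -[X in measurable X]setTI.
  exact: measurable_rcons_rv.
Qed.

HB.instance Definition _ := isMeasure.Build _ _ _ rvS
  rvS0 rvS_ge0 rvS_sigma_additive.

Let rvS_sigma_finite : sigma_finite setT rvS.
Proof.
have /sigma_finiteP[F [FT ndF mF]] := sigma_finiteT m1.
have /sigma_finiteP[G [GT ndG mG]] := sigma_finiteT mu.
exists (fun k => @pair_of_rv n @^-1` (F k `*` G k)).
  rewrite -preimage_bigcup [X in _ @^-1` X](_ : _ = setT) ?preimage_setT//.
  rewrite -subTset => -[x y] _.
  have [i _ Fx] : (\bigcup_i F i) x by rewrite -FT.
  have [j _ Gy] : (\bigcup_i G i) y by rewrite -GT.
  (* Both exhaustions are nondecreasing, so the later of the two stages serves both factors. *)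
  exists (maxn i j) => //; split => /=.
    by move: x Fx; exact/subsetPset/ndF/leq_maxl.
  by move: y Gy; exact/subsetPset/ndG/leq_maxr.
move=> k; have [mFk Fk] := mF k; have [mGk Gk] := mG k; split.
  rewrite -[X in measurable X]setTI; apply: measurable_pair_of_rv => //.
  exact: measurableX.
rewrite /rvS /pushforward -comp_preimage (_ : _ \o _ = id); last first.
  by apply/funext => p /=; exact: rcons_rvK.
by rewrite preimage_id product_measure1E// lte_mul_pinfty// ge0_fin_numE.
Qed.

HB.instance Definition _ := Measure_isSigmaFinite.Build _ _ _ rvS
  rvS_sigma_finite.

End step.

(** Lebesgue measure, built by the recursion of [iter_vol] but as a sigma-finite measure at each
    stage, so that additivity and Tonelli's theorem are available. Dimension 0 has one point, of
    mass 1. *)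
Fixpoint leb (n : nat) : {sigma_finite_measure set 'rV[R]_n -> \bar R} :=
  match n with
  | 0 => \d_(0 : 'rV[R]_0)
  | m.+1 => rvS lebesgue_measure (leb m)
  end.
End rvec_measure.

(** * Affine changes of variables for Lebesgue measure *)

Section lebesgue_affine.
Variable R : realType.
Local Notation mu1 := (@lebesgue_measure R).

(** By uniqueness of Lebesgue measure it suffices to compare on half-open intervals. For a < 0 the
    preimage is half-open on the other side, with the same length. *)
Lemma lebesgue_measure_affine (a c : R) (B : set (measurableTypeR R)) :
  a != 0 -> measurable B ->
  mu1 B = (`|a|%:E * mu1 [set x : measurableTypeR R | B (x * a + c)%R])%E.
Proof.
move=> a0 mB.
have aN0 : 0 < `|a| by rewrite normr_gt0.
pose f := fun x : measurableTypeR R => x * a + c : measurableTypeR R.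
have mf : measurable_fun setT f.
  by apply: measurable_funD => //; apply: measurable_funM.
pose fmu := measure_function_pushforward__canonical__measure_function_Measure mu1 mf.
transitivity (mscale (NngNum (ltW aN0)) fmu B) => //.
apply: lebesgue_measure_unique => // _ [[x y] /= _ <-].
rewrite /mscale /= /pushforward lebesgue_measure_itv /= lte_fin.
have [a_gt0|a_lt0] : 0 < a \/ a < 0 by move: a0; rewrite neq_lt => /orP[]; tauto.
  rewrite (_ : f @^-1` _ = `](x - c) / a, (y - c) / a]%classic); last first.
    apply/seteqP; split => z /=; rewrite !in_itv /= => /andP[].
      by move=> h1 h2; rewrite ltr_pdivrMr// ler_pdivlMr// ltrBlDr lerBrDr h1 h2.
    by rewrite ltr_pdivrMr// ler_pdivlMr// ltrBlDr lerBrDr => -> ->.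
  rewrite lebesgue_measure_itv /= lte_fin ltr_pM2r ?invr_gt0// ltrD2r.
  case: ifP => _; last by rewrite mule0.
  rewrite gtr0_norm// -!EFinB -EFinM; congr EFin.
  by field; rewrite gt_eqF.
rewrite (_ : f @^-1` _ = `[(y - c) / a, (x - c) / a[%classic); last first.
  apply/seteqP; split => z /=; rewrite !in_itv /= => /andP[].
    by move=> h1 h2; rewrite ltr_ndivlMr// ler_ndivrMr// ltrBlDr lerBrDr h1 h2.
  by rewrite ltr_ndivlMr// ler_ndivrMr// ltrBlDr lerBrDr => -> ->.
rewrite lebesgue_measure_itv /= lte_fin ltr_nM2r ?invr_lt0// ltrD2r.
case: ifP => _; last by rewrite mule0.
rewrite ltr0_norm// -!EFinB -EFinM; congr EFin.
by field; rewrite lt_eqF.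
Qed.

Lemma lebesgue_measure_shift (c : R) (B : set (measurableTypeR R)) :
  measurable B -> mu1 [set x : measurableTypeR R | B (x + c)] = mu1 B.
Proof.
move=> mB; rewrite [RHS](lebesgue_measure_affine c (oner_neq0 R))// normr1 mul1e.
by under [in RHS]eq_set do rewrite mulr1.
Qed.

End lebesgue_affine.

Section leb_sections.
Variable R : realType.
Local Notation mu1 := (@lebesgue_measure R).

Lemma measurable_rcons_rv1 n (y : 'rV[R]_n) :
  measurable_fun setT (fun x : measurableTypeR R => rcons_rv (x, y)).
Proof.
by apply: (measurableT_comp (@measurable_rcons_rv R n)); exact: pair2_measurable.
Qed.

Lemma measurable_rcons_rv2 n (x : R) :
  measurable_fun setT (fun y : 'rV[R]_n => rcons_rv (x : measurableTypeR R, y)).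
Proof.
by apply: (measurableT_comp (@measurable_rcons_rv R n)); exact: pair1_measurable.
Qed.

Lemma measurable_section1 n (S : set 'rV[R]_n.+1) (y : 'rV[R]_n) :
  measurable S -> measurable [set x : measurableTypeR R | S (rcons_rv (x, y))].
Proof.
by move=> mS; rewrite -[X in measurable X]setTI; exact: measurable_rcons_rv1.
Qed.

Lemma measurable_section2 n (S : set 'rV[R]_n.+1) (x : R) :
  measurable S -> measurable [set y | S (rcons_rv (x : measurableTypeR R, y))].
Proof.
by move=> mS; rewrite -[X in measurable X]setTI; exact: measurable_rcons_rv2.
Qed.

Lemma lebS n (S : set 'rV[R]_n.+1) :
  leb R n.+1 S = (\int[mu1]_x leb R n [set y | S (rcons_rv (x, y))])%E.
Proof.
rewrite /= /rvS /pushforward /product_measure1; apply: eq_integral => x _ /=.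
by congr (leb R n _); apply/seteqP; split => y; rewrite /xsection /= inE.
Qed.

(** Tonelli: integrating the first coordinate innermost gives a measure with the same values on
    rectangles. This order is the one that shears and rescalings of the first coordinate call
    for. *)
Lemma lebS' n (S : set 'rV[R]_n.+1) : measurable S ->
  leb R n.+1 S =
  (\int[leb R n]_y mu1 [set x : measurableTypeR R | S (rcons_rv (x, y))])%E.
Proof.
move=> mS; rewrite /= /rvS /pushforward.
rewrite (@product_measure_unique _ _ _ _ _ _ _
  [the measure _ _ of (mu1 \x^ leb R n)%E])//.
- rewrite /= /product_measure2; apply: eq_integral => y _ /=.
  by congr (mu1 _); apply/seteqP; split => x; rewrite /ysection /= inE.
- by move=> A B mA mB; rewrite /= product_measure2E.
- by rewrite -[X in measurable X]setTI; exact: measurable_rcons_rv.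
Qed.

Lemma measurable_leb_section2 n (S : set 'rV[R]_n.+1) : measurable S ->
  measurable_fun [set: measurableTypeR R]
    (fun x => leb R n [set y | S (rcons_rv (x, y))]).
Proof.
move=> mS; have mS' : measurable (@rcons_rv R n @^-1` S).
  by rewrite -[X in measurable X]setTI; exact: measurable_rcons_rv.
have := measurable_fun_xsection (leb R n) mS'; apply: eq_measurable_fun => x _ /=.
by congr (leb R n _); apply/seteqP; split => y; rewrite /xsection /= inE.
Qed.

Lemma measurable_leb_section1 n (S : set 'rV[R]_n.+1) : measurable S ->
  measurable_fun [set: 'rV[R]_n]
    (fun y => mu1 [set x : measurableTypeR R | S (rcons_rv (x, y))]).
Proof.
move=> mS; have mS' : measurable (@rcons_rv R n @^-1` S).
  by rewrite -[X in measurable X]setTI; exact: measurable_rcons_rv.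
have := measurable_fun_ysection mu1 mS'; apply: eq_measurable_fun => y _ /=.
by congr (mu1 _); apply/seteqP; split => x; rewrite /ysection /= inE.
Qed.

(** No measurability is assumed: for every set, [leb] at n+1 unfolds to the integral of the measures
    of the sections, which is the recursion of [iter_vol]. *)
Lemma volE n (S : set 'rV[R]_n) : vol S = leb R n S.
Proof.
rewrite /vol; elim: n S => [|n IH] S.
  rewrite /= diracE indicE; congr ((nat_of_bool _)%:R%:E).
  have e : \row_(i < 0) nth (0 : R) [::] i = 0 by apply/rowP => -[].
  by apply/idP/idP => /set_mem h; apply/mem_set; move: h; rewrite /= e.
rewrite lebS /=; apply: eq_integral => x _; rewrite -IH; congr iter_vol.
apply/funext => s; congr (S _); apply/rowP => i; rewrite mxE.
by have [j ->|->] := unliftP ord0 i; rewrite ?rcons_rv0// rcons_rvS mxE.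
Qed.

End leb_sections.

Section leb_linear.
Variable R : realType.
Local Notation mu1 := (@lebesgue_measure R).

Lemma measurable_affine n m (A : 'M[R]_(n, m)) (b : 'rV[R]_m) :
  measurable_fun setT (fun x : 'rV[R]_n => x *m A + b).
Proof.
apply: measurable_rvec => i.
under eq_fun do rewrite !mxE.
apply: measurable_funD => //; apply: measurable_sum => k.
by apply: measurable_funM => //; exact: measurable_coord.
Qed.

Lemma measurable_preimage_affine n m (A : 'M[R]_(n, m)) (b : 'rV[R]_m)
    (S : set 'rV[R]_m) :
  measurable S -> measurable [set x | S (x *m A + b)].
Proof.
by move=> mS; rewrite -[X in measurable X]setTI; exact: measurable_affine.
Qed.

Lemma measurable_preimage_mulmx n m (A : 'M[R]_(n, m)) (S : set 'rV[R]_m) :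
  measurable S -> measurable [set x | S (x *m A)].
Proof.
move=> /(measurable_preimage_affine A 0); congr measurable.
by apply/seteqP; split=> x /=; rewrite addr0.
Qed.

Lemma measurable_preimage_shift n (b : 'rV[R]_n) (S : set 'rV[R]_n) :
  measurable S -> measurable [set x | S (x + b)].
Proof.
move=> /(measurable_preimage_affine 1%:M b); congr measurable.
by apply/seteqP; split=> x /=; rewrite mulmx1.
Qed.

Lemma rcons_rvD n (p q : measurableTypeR R * 'rV[R]_n) :
  rcons_rv p + rcons_rv q = rcons_rv ((p.1 : R) + (q.1 : R) : measurableTypeR R, p.2 + q.2).
Proof.
apply/rowP => i; rewrite mxE.
by have [j ->|->] := unliftP ord0 i; rewrite ?rcons_rv0// !rcons_rvS mxE.
Qed.

(** The tail is shifted slice by slice, by induction; the first coordinate is shifted in the other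
    order of integration. *)
Lemma leb_shift n (a : 'rV[R]_n) (S : set 'rV[R]_n) : measurable S ->
  leb R n [set x | S (x + a)] = leb R n S.
Proof.
elim: n a S => [|n IH] a S mS.
  by congr (leb R 0 _); apply/seteqP; split=> x /=; rewrite !(thinmx0 (x + a)) (thinmx0 x).
rewrite -(pair_of_rvK a); move: (pair_of_rv a) => [a0 a1].
have mSx x : measurable [set y | S (rcons_rv (x : measurableTypeR R, y))].
  exact: measurable_section2.
transitivity (leb R n.+1 [set x | S (x + rcons_rv (a0, 0))]).
  rewrite !lebS; apply: eq_integral => x _.
  rewrite -[RHS](IH a1); last first.
    exact: (measurable_section2 _ (measurable_preimage_shift _ mS)).
  by congr (leb R n _); apply/seteqP; split=> y; rewrite /= !rcons_rvD /= addr0.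
rewrite !lebS'//; last exact: measurable_preimage_shift.
apply: eq_integral => y _.
rewrite -[RHS](lebesgue_measure_shift a0); last exact: measurable_section1.
by congr (mu1 _); apply/seteqP; split=> x; rewrite /= !rcons_rvD /= addr0.
Qed.

(* The change of variables formula for [A], proved below from block decompositions. *)
Definition lebJ n (A : 'M[R]_n) := forall S, measurable S ->
  leb R n S = (`|\det A|%:E * leb R n [set x | S (x *m A)%R])%E.

Lemma lebJM n (A B : 'M[R]_n) : lebJ A -> lebJ B -> lebJ (A *m B).
Proof.
move=> jA jB S mS; rewrite (jB S)// (jA [set x | S (x *m B)]); last first.
  exact: measurable_preimage_mulmx.
rewrite muleA -EFinM -normrM mulrC -det_mulmx; congr (_ * leb R n _)%E.
by apply/seteqP; split=> x; rewrite /= mulmxA.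
Qed.

Lemma rcons_rv_row_mx n (x : R) (y : 'rV[R]_n) :
  rcons_rv (x : measurableTypeR R, y) = row_mx x%:M y :> 'rV_(1 + n).
Proof.
apply/rowP => i; rewrite /rcons_rv mxE; case: (split_ordP i) => j ->.
  rewrite (_ : lshift n j = ord0); last by rewrite ord1; exact/val_inj.
  rewrite unlift_none (_ : ord0 = lshift n (0 : 'I_1)) ?row_mxEl ?mxE//.
  exact/val_inj.
rewrite (_ : rshift 1 j = lift ord0 j) ?liftK; last exact/val_inj.
by rewrite (_ : lift ord0 j = rshift 1 j) ?row_mxEr//; exact/val_inj.
Qed.

Lemma rcons_rv_mulmx n (x : R) (y : 'rV[R]_n) (a : R)
    (b : 'rV[R]_n) (c : 'cV[R]_n) (D : 'M[R]_n) :
  (rcons_rv (x : measurableTypeR R, y) : 'rV_(1 + n)) *m block_mx a%:M b c D =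
  rcons_rv (x * a + (y *m c) 0 0 : measurableTypeR R, x *: b + y *m D).
Proof.
rewrite !rcons_rv_row_mx mul_row_block; congr row_mx.
  by rewrite -scalar_mxM raddfD /= -[in RHS](mx11_scalar (y *m c)).
by rewrite mul_scalar_mx.
Qed.

Lemma lebJ_ushear n (b : 'rV[R]_n) : lebJ (block_mx 1%:M b 0 1%:M : 'M[R]_(1 + n)).
Proof.
move=> S mS; rewrite det_ublock !det1 mulr1 normr1 mul1e.
rewrite [LHS]lebS [RHS]lebS; apply: eq_integral => x _.
rewrite -(leb_shift (x *: b)); last exact: measurable_section2.
congr (leb R n _); apply/seteqP; split=> y; rewrite /= rcons_rv_mulmx;
  by rewrite mulr1 mulmx0 mxE addr0 mulmx1 addrC.
Qed.

Lemma lebJ_lshear n (c : 'cV[R]_n) : lebJ (block_mx 1%:M 0 c 1%:M : 'M[R]_(1 + n)).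
Proof.
move=> S mS; rewrite det_lblock !det1 mulr1 normr1 mul1e.
rewrite [LHS]lebS'// [RHS]lebS'; last exact: measurable_preimage_mulmx.
apply: eq_integral => y _.
rewrite -(lebesgue_measure_shift ((y *m c) 0 0)); last exact: measurable_section1.
congr (mu1 _); apply/seteqP; split=> x; rewrite /= rcons_rv_mulmx;
  by rewrite mulr1 scaler0 add0r mulmx1.
Qed.

Lemma lebJ_diag n (a : R) (D : 'M[R]_n) : a != 0 -> lebJ D ->
  lebJ (block_mx a%:M 0 0 D : 'M[R]_(1 + n)).
Proof.
move=> a0 jD.
suff j1 : lebJ (block_mx 1%:M 0 0 D : 'M[R]_(1 + n)).
  have j2 : lebJ (block_mx a%:M 0 0 1%:M : 'M[R]_(1 + n)).
    move=> S mS; rewrite det_ublock det1 mulr1 det_scalar1.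
    rewrite [LHS]lebS'// [in RHS]lebS'; last exact: measurable_preimage_mulmx.
    rewrite -ge0_integralZl//; last first.
      exact: (measurable_leb_section1 (measurable_preimage_mulmx _ mS)).
    apply: eq_integral => y _.
    rewrite (lebesgue_measure_affine 0 a0); last exact: measurable_section1.
    congr (_ * mu1 _)%E; apply/seteqP; split=> x; rewrite /= rcons_rv_mulmx;
      by rewrite mulmx0 mxE scaler0 add0r mulmx1.
  have := lebJM j1 j2; congr lebJ.
  by rewrite mulmx_block !mulmx0 !mul0mx !mul1mx mulmx1 !addr0 !add0r.
move=> S mS; rewrite det_ublock det1 mul1r.
rewrite [LHS]lebS [in RHS]lebS -ge0_integralZl//; last first.
  exact: (measurable_leb_section2 (measurable_preimage_mulmx _ mS)).
apply: eq_integral => x _.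
rewrite (jD _ (measurable_section2 x mS)).
congr (_ * leb R n _)%E; apply/seteqP; split=> y; rewrite /= rcons_rv_mulmx;
  by rewrite mulmx0 mxE scaler0 add0r addr0 mulr1.
Qed.

(** Gaussian elimination: with a nonzero corner entry, the matrix is a lower shear times a block
    diagonal matrix times an upper shear, and the induction hypothesis applies to the Schur
    complement [D']. *)
Lemma leb_mulmx n (A : 'M[R]_n) : \det A != 0 -> lebJ A.
Proof.
elim: n A => [|n IH] A.
  move=> _ S mS; rewrite det_mx00 normr1 mul1e; congr (leb R 0 _).
  by apply/seteqP; split=> x /=; rewrite !(thinmx0 (x *m A)) (thinmx0 x).
have H a (b : 'rV_n) c D : a != 0 ->
    \det (block_mx a%:M b c D : 'M[R]_(1 + n)) != 0 ->
    lebJ (block_mx a%:M b c D : 'M[R]_(1 + n)).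
  move=> a0 dA.
  pose D' := D - a^-1 *: (c *m b).
  have E : block_mx a%:M b c D = block_mx 1%:M 0 (a^-1 *: c) 1%:M *m
      block_mx a%:M 0 0 D' *m block_mx 1%:M (a^-1 *: b) 0 1%:M.
    rewrite !mulmx_block !mulmx0 !mul0mx !mul1mx !mulmx1 !addr0 !add0r.
    rewrite !mul_mx_scalar !mul_scalar_mx !scalerA !mulfV// !scale1r.
    by rewrite -scalemxAr /D' addrC subrK.
  move: dA; rewrite E => dA.
  apply: lebJM; last exact: lebJ_ushear.
  apply: lebJM; first exact: lebJ_lshear.
  apply: lebJ_diag => //; apply: IH.
  move: dA; rewrite !det_mulmx !det_lblock det_ublock !det1 !mul1r !mulr1.
  by rewrite det_scalar1 mulf_eq0 (negPf a0).
change (\det (A : 'M[R]_(1 + n)) != 0 -> lebJ (A : 'M[R]_(1 + n))).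
move: (A : 'M[R]_(1 + n)) => {}A; rewrite -(submxK A) (mx11_scalar (ulsubmx _)).
move: (ulsubmx A 0 0) (ursubmx A) (dlsubmx A) (drsubmx A) => a b c D dA.
(* When the corner vanishes, invertibility makes the rest [c] of the first column nonzero; adding
   [c^T] times the lower rows to the first row puts the squared norm of [c] into the corner. *)
have [a0|] := eqVneq a 0; last by move=> a0; exact: H.
have c0 : c != 0.
  apply: contraNneq dA => c0.
  by rewrite c0 a0 det_ublock det_scalar1 mul0r.
have cc : (c^T *m c) 0 0 != 0.
  apply: contraNneq c0 => cc; apply/eqP/colP => i.
  have : \sum_k c k 0 ^+ 2 = 0.
    by rewrite -[RHS]cc mxE; apply: eq_bigr => k _; rewrite mxE expr2.
  move=> /psumr_eq0P => /(_ (fun i _ => sqr_ge0 _)) /(_ i isT) /eqP.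
  by rewrite sqrf_eq0 mxE => /eqP.
have E : block_mx a%:M b c D = block_mx 1%:M (- c^T) 0 1%:M *m
   block_mx ((c^T *m c) 0 0)%:M (b + c^T *m D) c D.
  rewrite mulmx_block !mul0mx !mul1mx !add0r -mx11_scalar a0 raddf0.
  by rewrite !mulNmx addrN addrK.
rewrite E; apply: lebJM; first exact: lebJ_ushear.
apply: H => //; move: dA; rewrite E det_mulmx det_ublock !det1.
by rewrite !mul1r.
Qed.

End leb_linear.

(** * Volumes of simplices, boxes and sectors *)

Section measurable_comparison.
Context d (T : measurableType d) (R : realType).
Variables (f g : T -> R).
Hypotheses (mf : measurable_fun setT f) (mg : measurable_fun setT g).

Lemma measurable_set_le : measurable [set x | f x <= g x].
Proof.
have := measurable_fun_ler mf mg measurableT (I : measurable [set true]).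
by rewrite setTI.
Qed.

Lemma measurable_set_lt : measurable [set x | f x < g x].
Proof.
have := measurable_fun_ltr mf mg measurableT (I : measurable [set true]).
by rewrite setTI.
Qed.

Lemma measurable_set_eq : measurable [set x | f x = g x].
Proof.
have := measurable_fun_eqr mf mg measurableT (I : measurable [set true]).
by rewrite setTI; congr measurable; apply/seteqP; split=> x /= /eqP.
Qed.

End measurable_comparison.

Section ftc_closed.
Variable R : realType.
Local Notation mu1 := (@lebesgue_measure R).

Lemma FTC_itv (f F : R -> R) (a b : R) : a <= b ->
  (forall x : R, x \in `[a, b] -> is_derive x 1 F (f x)) ->
  (forall x : R, x \in `[a, b] -> derivable f x 1) ->
  (\int[mu1]_(x in `[a, b]) (f x)%:E = (F b - F a)%:E)%E.
Proof.
rewrite le_eqVlt => /orP[/eqP <- _ _|ab dF df].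
  by rewrite set_itv1 integral_set1 subrr.
have sub x : x \in `]a, b[ -> x \in `[a, b].
  by rewrite !in_itv /= => /andP[/ltW-> /ltW->].
have cF x : x \in `[a, b] -> {for x, continuous F}.
  move=> /dF dFx; apply: differentiable_continuous.
  by apply/derivable1_diffP; exact: ex_derive.
rewrite (@continuous_FTC2 _ f F)//.
- apply: continuous_in_subspaceT => x; rewrite inE => /df dfx.
  by apply: differentiable_continuous; exact/derivable1_diffP.
- split.
  + by move=> x /sub /dF dFx; exact: ex_derive.
  + apply: cvg_at_right_filter; apply: cF.
    by rewrite in_itv /= lexx ltW.
  + apply: cvg_at_left_filter; apply: cF.
    by rewrite in_itv /= lexx ltW.
- by move=> x /sub /dF dFx; rewrite derive1E; exact: derive_val.
Qed.

End ftc_closed.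

Section leb_sets.
Variable R : realType.

Lemma lsubmx_rcons_rv m k (x : R) (y : 'rV[R]_(m + k)) :
  lsubmx (rcons_rv (x : measurableTypeR R, y) : 'rV_(m.+1 + k)) =
  rcons_rv (x : measurableTypeR R, lsubmx y).
Proof.
apply/rowP => i; rewrite mxE.
have [j ->|->] := unliftP ord0 i.
  rewrite [RHS]rcons_rvS !mxE.
  by rewrite (_ : lshift k (lift ord0 j) = lift ord0 (lshift k j)) ?liftK//; exact/val_inj.
by rewrite [RHS]rcons_rv0 mxE (_ : lshift k ord0 = ord0) ?unlift_none//; exact/val_inj.
Qed.

Lemma rsubmx_rcons_rv m k (x : R) (y : 'rV[R]_(m + k)) :
  rsubmx (rcons_rv (x : measurableTypeR R, y) : 'rV_(m.+1 + k)) = rsubmx y.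
Proof.
apply/rowP => i; rewrite !mxE.
by rewrite (_ : rshift m.+1 i = lift ord0 (rshift m i)) ?liftK//; exact/val_inj.
Qed.

Lemma leb_prod m k (X : set 'rV[R]_m) (Y : set 'rV[R]_k) :
  measurable X -> measurable Y ->
  leb R (m + k) [set x | X (lsubmx x) /\ Y (rsubmx x)] =
  (leb R m X * leb R k Y)%E.
Proof.
move=> mX mY; elim: m X mX => [|m IH] X mX.
  have rs (x : 'rV[R]_(0 + k)) : rsubmx x = x.
    by apply/rowP => i; rewrite mxE; congr (x _ _); exact/val_inj.
  rewrite /= diracE; case: (boolP (0 \in X)) => [/set_mem|] X0.
    rewrite mul1e; congr (leb R k _); apply/seteqP; split=> x /=; rewrite rs.
      by case.
    by split=> //; rewrite (thinmx0 (lsubmx _)).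
  rewrite mul0e; rewrite (_ : [set _ | _] = set0) ?measure0//.
  apply/seteqP; split=> x //= -[]; rewrite (thinmx0 (lsubmx _)) => X0' _.
  by move/negP: X0; apply; exact/mem_set.
rewrite [LHS]lebS [in RHS]lebS -ge0_integralZr//; last first.
  exact: measurable_leb_section2.
apply: eq_integral => x _; rewrite -IH; last exact: measurable_section2.
congr (leb R _ _); apply/seteqP; split=> y /=;
  by rewrite lsubmx_rcons_rv rsubmx_rcons_rv.
Qed.

Lemma measurable_ge0_sum_le m (s : R) :
  measurable [set w : 'rV[R]_m | (forall i, 0 <= w 0 i) /\ \sum_i w 0 i <= s].
Proof.
rewrite (_ : [set _ | _] = (\bigcap_(i in [set: 'I_m]) [set w : 'rV[R]_m | 0 <= w 0 i])
    `&` [set w | \sum_i w 0 i <= s]); last first.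
  apply/seteqP; split=> w /= [H1 H2]; split=> // i; last exact: H1.
  by move=> _; exact: H1.
apply: measurableI.
  apply: fin_bigcap_measurable => // i _.
  by apply: measurable_set_le => //; exact: measurable_coord.
by apply: measurable_set_le => //; apply: measurable_sum => // i; exact: measurable_coord.
Qed.

(** The size s is kept general for the induction: the slice at first coordinate x is the simplex of
    size s - x. *)
Lemma leb_simplex m (s : R) : 0 <= s ->
  leb R m [set w | (forall i, 0 <= w 0 i) /\ \sum_i w 0 i <= s] =
  (s ^+ m / m`!%:R)%:E.
Proof.
elim: m s => [|m IH] s s0.
  rewrite /= diracE mem_set ?fact0 ?divr1//=; split; first by case.
  by rewrite big_ord0.
rewrite lebS (_ : (fun _ => _) =
  (fun x => ((s - x) ^+ m / m`!%:R)%:E) \_ `[0, s]); last first.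
  apply/funext => x; rewrite patchE mem_setE in_itv /=; case: ifPn => [/andP[x0 xs]|].
    rewrite -IH ?subr_ge0//; congr (leb R m _); apply/seteqP; split=> y /= [].
      move=> H1 H2; split.
        by move=> i; have := H1 (lift ord0 i); rewrite rcons_rvS.
      move: H2; rewrite big_ord_recl rcons_rv0 lerBrDl; congr (_ <= _).
      by congr (_ + _); apply: eq_bigr => i _; rewrite rcons_rvS.
    move=> H1 H2; split.
      move=> i; have [j ->|->] := unliftP ord0 i; rewrite ?rcons_rv0// rcons_rvS.
      exact: H1.
    rewrite big_ord_recl rcons_rv0 -lerBrDl; move: H2; congr (_ <= _).
    by apply: eq_bigr => i _; rewrite rcons_rvS.
  move=> xs; rewrite (_ : [set _ | _] = set0) ?measure0//.
  apply/seteqP; split=> y //= [] H1 H2; move/negP: xs; apply.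
  have := H1 ord0; rewrite rcons_rv0 /= => -> /=; apply: le_trans H2.
  rewrite big_ord_recl rcons_rv0 lerDl; apply: sumr_ge0 => i _.
  exact: H1.
rewrite -integral_mkcond.
pose p : {poly R} := m`!%:R^-1 *: (s%:P - 'X) ^+ m.
pose q : {poly R} := - m.+1`!%:R^-1 *: (s%:P - 'X) ^+ m.+1.
have dq : q^`() = p.
  rewrite derivZ deriv_exp derivB derivC derivX sub0r mulN1r /= mulNrn scalerN scaleNr opprK.
  rewrite -(scaler_nat m.+1 (_ ^+ m)) scalerA factS natrM; congr (_ *: _).
  by field; rewrite nat1r !pnatr_eq0 -lt0n fact_gt0.
have px x : p.[x] = (s - x) ^+ m / m`!%:R by rewrite !hornerE mulrC.
have qx x : q.[x] = - (s - x) ^+ m.+1 / m.+1`!%:R.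
  by rewrite hornerE horner_exp !hornerE mulNr mulrC mulNr.
under eq_integral do rewrite -px.
have dF (x : R) : x \in `[0, s] -> is_derive x 1 (horner q) p.[x].
  by rewrite -dq => _; exact: is_derive_poly.
rewrite (FTC_itv s0 dF); first by rewrite !qx subrr subr0 expr0n /= oppr0 mul0r sub0r mulNr opprK.
by move=> x _; exact: derivable_horner.
Qed.

Lemma leb_box m (K : R) : 0 <= K ->
  (leb R m [set w : 'rV[R]_m | (forall i, `|w 0 i| <= K)%R] < +oo)%E.
Proof.
move=> K0; suff -> : leb R m [set w | forall i, `|w 0 i| <= K] = ((K *+ 2) ^+ m)%:E.
  by rewrite ltry.
elim: m => [|m IH].
  by rewrite /= diracE mem_set// => -[].
rewrite lebS (_ : (fun _ => _) = (cst ((K *+ 2) ^+ m)%:E) \_ `[- K, K]); last first.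
  apply/funext => x; rewrite patchE mem_setE in_itv /= -ler_norml; case: ifPn => xK.
    rewrite /= -IH; congr (leb R m _); apply/seteqP; split=> y /= H i.
      by have := H (lift ord0 i); rewrite rcons_rvS.
    by have [j ->|->] := unliftP ord0 i; rewrite ?rcons_rv0// rcons_rvS.
  rewrite (_ : [set _ | _] = set0) ?measure0//.
  apply/seteqP; split=> y //= /(_ ord0); rewrite rcons_rv0 /= => xK'.
  by rewrite xK' in xK.
rewrite -integral_mkcond integral_cst//= lebesgue_measure_itv /= lte_fin.
rewrite opprK -mulr2n; case: ifPn => [_|]; first by rewrite -EFinM exprSr.
rewrite -leNgt => KN; have -> : K = 0 by lra.
by rewrite mule0 mul0rn exprS mul0r.
Qed.

End leb_sets.

Section leb_sign.
Variable R : realType.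
Local Notation mu1 := (@lebesgue_measure R).

Lemma leb1E (S : set 'rV[R]_1) : measurable S ->
  leb R 1 S = mu1 [set x : measurableTypeR R | S (const_mx x)].
Proof.
move=> mS; rewrite lebS'//= integral_dirac//=; last exact: measurable_leb_section1.
rewrite diracT mul1e; congr (mu1 _); apply/seteqP; split=> x /=; congr (S _);
  by apply/rowP => i; rewrite ord1 rcons_rv0 mxE.
Qed.

Lemma leb_perm n (s : 'S_n) (S : set 'rV[R]_n) : measurable S ->
  leb R n S = leb R n [set t | S (\row_i t 0 (s i))].
Proof.
move=> mS; have dP : \det (perm_mx (s^-1)%g) = (-1) ^+ s :> R by rewrite det_perm odd_permV.
rewrite (@leb_mulmx _ _ (perm_mx (s^-1)%g))//; last by rewrite dP signr_eq0.
rewrite dP normr_sign mul1e; congr (leb R n _).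
by apply/seteqP; split=> t /=; rewrite -col_permE; congr (S _); apply/rowP => i; rewrite !mxE.
Qed.

Lemma leb_scale_coord n (a : 'rV[R]_n) (S : set 'rV[R]_n) :
  (forall i, 0 < a 0 i) -> measurable S ->
  leb R n S = ((\prod_i a 0 i)%:E * leb R n [set t | S (\row_i (t 0 i * a 0 i))%R])%E.
Proof.
move=> a0 mS; have dP : \det (diag_mx a) = \prod_i a 0 i by rewrite det_diag.
have P0 : 0 < \prod_i a 0 i by apply: prodr_gt0.
rewrite (@leb_mulmx _ _ (diag_mx a))//; last by rewrite dP gt_eqF.
rewrite dP gtr0_norm//; congr (_ * leb R n _)%E.
by apply/seteqP; split=> t /=; rewrite mul_mx_diag; congr (S _); apply/rowP => i; rewrite !mxE.
Qed.

Definition flip n (k : 'I_n) (t : 'rV[R]_n) : 'rV[R]_n :=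
  \row_i (if i == k then - t 0 i else t 0 i).

Lemma leb_flip n (k : 'I_n) (S : set 'rV[R]_n) : measurable S ->
  leb R n S = leb R n [set t | S (flip k t)].
Proof.
move=> mS; pose a : 'rV[R]_n := \row_i (if i == k then -1 else 1).
have dP : `|\det (diag_mx a)| = 1.
  rewrite det_diag normr_prod big1// => i _; rewrite mxE.
  by case: ifP => _; rewrite ?normrN normr1.
rewrite (@leb_mulmx _ _ (diag_mx a))//; last by rewrite -normr_eq0 dP oner_eq0.
rewrite dP mul1e; congr (leb R n _).
apply/seteqP; split=> t /=; rewrite mul_mx_diag; congr (S _); apply/rowP => i;
  by rewrite !mxE; case: ifP => _; rewrite ?mulr1 ?mulrN1.
Qed.

Lemma leb_hyperplane n (k : 'I_n) : leb R n [set t : 'rV[R]_n | t 0 k = 0] = 0%E.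
Proof.
case: n k => [|n] k; first by case: k.
have m0 i : measurable [set t : 'rV[R]_n.+1 | t 0 i = 0].
  by apply: measurable_set_eq => //; exact: measurable_coord.
rewrite (leb_perm (tperm ord0 k))//.
transitivity (leb R n.+1 [set t : 'rV[R]_n.+1 | t 0 ord0 = 0]).
  by congr (leb R n.+1 _); apply/seteqP; split=> t /=; rewrite mxE tpermR.
rewrite lebS'//; apply: integral0_eq => y _.
rewrite (_ : [set _ | _] = [set 0]) ?lebesgue_measure_set1//.
by apply/seteqP; split=> x /=; rewrite rcons_rv0.
Qed.

Lemma leb_split n (k : 'I_n) (S : set 'rV[R]_n) : measurable S ->
  leb R n S = (leb R n (S `&` [set t : 'rV[R]_n | (0 < t 0 k)%R]) +
               leb R n (S `&` [set t : 'rV[R]_n | (t 0 k < 0)%R]))%E.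
Proof.
move=> mS.
have mp : measurable [set t : 'rV[R]_n | 0 < t 0 k].
  by apply: measurable_set_lt => //; exact: measurable_coord.
have mn : measurable [set t : 'rV[R]_n | t 0 k < 0].
  by apply: measurable_set_lt => //; exact: measurable_coord.
have mz : measurable [set t : 'rV[R]_n | t 0 k = 0].
  by apply: measurable_set_eq => //; exact: measurable_coord.
rewrite -measureU//; last 3 first.
- exact: measurableI.
- exact: measurableI.
- apply/seteqP; split=> t //= [[_ h1] [_ h2]].
  by have := lt_trans h1 h2; rewrite ltxx.
rewrite -setIUr.
rewrite [LHS](_ : _ = leb R n (S `&` ([set t : 'rV[R]_n | 0 < t 0 k] `|` [set t : 'rV[R]_n | t 0 k < 0])
   `|` (S `&` [set t : 'rV[R]_n | t 0 k = 0]))); last first.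
  congr (leb R n _); apply/seteqP; split=> t /=; last by case=> -[].
  by move=> St; case: (ltrgtP (t 0 k) 0) => h; [left|left|right]; split => //; [right|left].
rewrite measureU0//.
- by apply: measurableI => //; exact: measurableU.
- exact: measurableI.
- apply: subset_measure0 (leb_hyperplane k) => //; exact: measurableI.
Qed.

End leb_sign.

Section sector.
Variable R : realType.
Local Notation mu1 := (@lebesgue_measure R).

Lemma det_mx22 (K : comNzRingType) (A : 'M[K]_2) :
  \det A = A 0 0 * A 1 1 - A 0 1 * A 1 0.
Proof.
rewrite (expand_det_row _ 0) !big_ord_recl big_ord0 addr0 /cofactor.
rewrite !det_mx11 !mxE /= expr0 mul1r expr1 mulN1r mulrN.
by congr (A _ _ * A _ _ - A _ _ * A _ _); exact/val_inj.
Qed.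

Lemma is_derive_circle (x : R) : -1 < x < 1 ->
  is_derive x 1 (fun y => Num.sqrt (1 - y ^+ 2))
    ((2 * Num.sqrt (1 - x ^+ 2))^-1 * - (2 * x)).
Proof.
move=> x1; have x2 : 0 < 1 - x ^+ 2 by move: x1 => /andP[]; nra.
have d1 : is_derive x (1 : R) (fun y : R => 1 - y ^+ 2) (- (2 * x)).
  have := is_derive_poly (1 - 'X^2) x; rewrite derivB derivXn derivC sub0r.
  rewrite (_ : horner _ = fun y => 1 - y ^+ 2); last by apply/funext => y; rewrite !hornerE.
  by rewrite !hornerE /= mulr_natl.
exact: (@is_derive1_comp R Num.sqrt (fun y => 1 - y ^+ 2) x _ _ (is_derive1_sqrt x2) d1).
Qed.

Lemma is_derive_sector (k x : R) : -1 < x < 1 ->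
  is_derive x 1 (fun y => (y * Num.sqrt (1 - y ^+ 2) + asin y) / 2 - k * y ^+ 2 / 2)
    (Num.sqrt (1 - x ^+ 2) - k * x).
Proof.
move=> x1; have x2 : 0 < 1 - x ^+ 2 by move: x1 => /andP[]; nra.
have d2 := is_derive_circle x1.
have d3 := is_deriveM (is_derive_id x (1 : R)) d2.
have d4 := is_deriveD d3 (is_derive1_asin x1).
have d5 : is_derive x (1 : R) (horner (- (k / 2) *: 'X^2)) (- (k * x)).
  have := is_derive_poly (- (k / 2) *: 'X^2) x; rewrite derivZ derivXn.
  by rewrite !hornerE /= => /is_derive_eq; apply; rewrite -mulr_natl; field.
have d6 := is_deriveD (is_deriveZ (2^-1) d4) d5.
have -> : (fun y => (y * Num.sqrt (1 - y ^+ 2) + asin y) / 2 - k * y ^+ 2 / 2) =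
  2^-1 \*: (id * (fun y => Num.sqrt (1 - y ^+ 2)) + asin) + horner (- (k / 2) *: 'X^2).
  by apply/funext => y; rewrite !fctE !hornerE /= /GRing.scale /=; field.
apply: is_derive_eq d6 _; rewrite /GRing.scale /=.
set w := Num.sqrt _; have w0 : w != 0 by rewrite gt_eqF// sqrtr_gt0.
have ww : w ^+ 2 = 1 - x ^+ 2 by rewrite sqr_sqrtr// ltW.
by field: ww.
Qed.

Lemma integral_sector (k b : R) : 0 <= b < 1 ->
  (\int[mu1]_(x in `[0%R, b]) (Num.sqrt (1 - x ^+ 2) - k * x)%:E =
   ((b * Num.sqrt (1 - b ^+ 2) + asin b) / 2 - k * b ^+ 2 / 2)%:E)%E.
Proof.
move=> /andP[b0 b1].
have B (x : R) : x \in `[0, b] -> -1 < x < 1.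
  by rewrite in_itv /= => /andP[? ?]; apply/andP; split; lra.
rewrite (FTC_itv b0 (fun x xb => is_derive_sector k (B x xb))).
  have as0 : asin 0 = 0 :> R.
    have := @sinK R 0; rewrite sin0; apply.
    by rewrite in_itv/= oppr_le0 divr_ge0 ?pi_ge0.
  by rewrite as0 mul0r add0r expr0n /= mulr0 !mul0r subr0 subr0.
move=> x /B x1; have d2 := is_derive_circle x1.
by apply: derivableB; [exact: ex_derive|exact: derivableM].
Qed.

(** A sector of half-angle h around the second axis. By reflection it is twice its right half, which
    lies over [0, sin h] between the line of slope cot h and the unit circle. Since h < pi/2, the
    interval stays away from 1, where the circle has a vertical tangent. *)
Lemma leb_wedge (h : R) : 0 < h < pi / 2 ->
  leb R 2 [set u : 'rV[R]_2 | `|u 0 0| * cos h < u 0 1 * sin h /\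
                              u 0 0 ^+ 2 + u 0 1 ^+ 2 <= 1] = h%:E.
Proof.
move=> /andP[h0 hpi].
have [sh ch] : 0 < sin h /\ 0 < cos h.
  split; first by apply: sin_gt0_pi; apply/andP; split => //; have := pi_gt0 R; lra.
  by apply: cos_gt0_pihalf; apply/andP; split => //; have := pi_gt0 R; lra.
have sc : sin h ^+ 2 + cos h ^+ 2 = 1 by rewrite addrC cos2Dsin2.
have sh1 : sin h < 1 by nra.
set W := [set _ | _].
have mc i : measurable_fun setT (fun u : 'rV[R]_2 => u 0 i) by exact: measurable_coord.
have mD : measurable [set u : 'rV[R]_2 | u 0 0 ^+ 2 + u 0 1 ^+ 2 <= 1].
  by apply: measurable_set_le => //; apply: measurable_funD; exact: measurable_funX.
have mW : measurable W.
  apply: measurableI => //; apply: measurable_set_lt; apply: measurable_funM => //.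
  exact: measurableT_comp.
pose W0 := [set u : 'rV[R]_2 | 0 <= u 0 0] `&` W.
have mW0 : measurable W0.
  by apply: measurableI => //; exact: measurable_set_le.
suff W0E : leb R 2 W0 = (h / 2)%:E.
  have e1 : leb R 2 (W `&` [set u : 'rV[R]_2 | 0 < u 0 0]) = (h / 2)%:E.
    rewrite -W0E [RHS](leb_split 0 mW0) [X in (_ + X)%E](_ : _ = 0%E) ?adde0.
      congr (leb R 2 _); apply/seteqP; split=> u /=; last by case=> -[].
      by move=> [Wu u0]; do 2 split => //; exact: ltW.
    rewrite (_ : _ `&` _ = set0) ?measure0//; apply/seteqP; split=> u //= [[]].
    by move=> u1 _ /(le_lt_trans u1); rewrite ltxx.
  have e2 : leb R 2 (W `&` [set u : 'rV[R]_2 | u 0 0 < 0]) = (h / 2)%:E.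
    rewrite -e1 (leb_flip 0); last first.
      by apply: measurableI => //; exact: measurable_set_lt.
    congr (leb R 2 _); apply/seteqP; split=> u /=; rewrite /W /= !mxE /=;
      by rewrite normrN sqrrN oppr_lt0.
  by rewrite (leb_split 0 mW) e1 e2 -EFinD; congr EFin; lra.
rewrite lebS (_ : (fun _ => _) =
  (fun x => (Num.sqrt (1 - x ^+ 2) - cos h / sin h * x)%:E) \_ `[0, sin h]); last first.
  apply/funext => y; rewrite leb1E; last exact: measurable_section2.
  rewrite patchE mem_setE in_itv /=.
  have e0 x : rcons_rv (y : measurableTypeR R, const_mx x : 'rV[R]_1) 0 0 = y.
    exact: rcons_rv0.
  have e1 x : rcons_rv (y : measurableTypeR R, const_mx x : 'rV[R]_1) 0 1 = x.
    rewrite (_ : 1 = lift ord0 ord0); last exact/val_inj.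
    by rewrite rcons_rvS mxE.
  rewrite (_ : [set _ | _] = [set x : measurableTypeR R | 0 <= y /\
     `|y| * cos h < (x : R) * sin h /\ y ^+ 2 + (x : R) ^+ 2 <= 1]); last first.
    by apply/seteqP; split=> x /=; rewrite /W0 /W /= e0 e1.
  case: ifPn => [/andP[y0 yh]|yh].
    have y2 : 0 <= 1 - y ^+ 2 by nra.
    rewrite (_ : [set _ | _] = `]cos h / sin h * y, Num.sqrt (1 - y ^+ 2)]%classic); last first.
      apply/seteqP; split=> x /=; rewrite in_itv /= ger0_norm// mulrAC ltr_pdivrMr//.
        move=> [_ [h1 h2]]; rewrite mulrC h1 /=; have x0 : 0 < x by nra.
        by rewrite -(ger0_norm (ltW x0)) -sqrtr_sqr ler_wsqrtr//; lra.
      move=> /andP[h1 h2]; do 2 split => //; first by rewrite mulrC.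
      have x0 : 0 < x by nra.
      suff : x ^+ 2 <= Num.sqrt (1 - y ^+ 2) ^+ 2 by rewrite sqr_sqrtr//; lra.
      by rewrite ler_sqr// nnegrE ?sqrtr_ge0// ltW.
    rewrite lebesgue_measure_itv /= lte_fin; case: ifPn => [_|]; first by rewrite EFinB.
    rewrite -leNgt => h1; congr EFin.
    have : cos h / sin h * y <= Num.sqrt (1 - y ^+ 2); last by lra.
    have c0 : 0 <= cos h / sin h * y by rewrite mulr_ge0// divr_ge0// ltW.
    rewrite -(ger0_norm c0) -sqrtr_sqr ler_wsqrtr// !exprMn exprVn.
    have -> : cos h ^+ 2 = 1 - sin h ^+ 2 by lra.
    rewrite mulrAC ler_pdivrMr ?exprn_gt0//.
    have : y ^+ 2 <= sin h ^+ 2 by rewrite ler_sqr// nnegrE ltW.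
    by nra.
  rewrite (_ : [set _ | _] = set0) ?measure0//; apply/seteqP; split=> x //= [y0 [h1 h2]].
  move: yh; rewrite y0 /= -ltNge => yh.
  rewrite ger0_norm// in h1.
  have : (y * cos h) ^+ 2 < (x * sin h) ^+ 2.
    by rewrite ltr_sqr// nnegrE; nra.
  rewrite !exprMn; have -> : cos h ^+ 2 = 1 - sin h ^+ 2 by lra.
  have : sin h ^+ 2 < y ^+ 2 by rewrite ltr_sqr// nnegrE ltW.
  by nra.
rewrite -integral_mkcond integral_sector; last by rewrite sh1 ltW.
congr EFin.
have -> : Num.sqrt (1 - sin h ^+ 2) = cos h.
  have -> : 1 - sin h ^+ 2 = cos h ^+ 2 by lra.
  by rewrite sqrtr_sqr ger0_norm// ltW.
rewrite sinK; last by rewrite in_itv /=; apply/andP; split; have := pi_gt0 R; lra.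
by field; rewrite gt_eqF.
Qed.

(** In coordinates along two unit vectors with inner product c this is a circular sector of angle
    [acos c]; its area is divided by the Jacobian, the sine of that angle. *)
Lemma leb_sector1 (c : R) : -1 < c < 1 ->
  leb R 2 [set t : 'rV[R]_2 | [/\ 0 < t 0 0, 0 < t 0 1 &
     t 0 0 ^+ 2 + t 0 1 ^+ 2 + 2 * c * (t 0 0 * t 0 1) <= 1]] =
  (acos c / (2 * Num.sqrt (1 - c ^+ 2)))%:E.
Proof.
move=> /andP[c0 c1]; pose h := acos c / 2.
have ch : c = cos (h + h) by rewrite /h -splitr acosK// in_itv /=; lra.
have h0 : 0 < h by rewrite /h divr_gt0// acos_gt0//; lra.
have h1 : h < pi / 2 by rewrite /h ltr_pM2r ?invr_gt0// acos_ltpi//; lra.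
have [sh chp] : 0 < sin h /\ 0 < cos h.
  split; first by apply: sin_gt0_pi; apply/andP; split => //; have := pi_gt0 R; lra.
  by apply: cos_gt0_pihalf; apply/andP; split => //; have := pi_gt0 R; lra.
have sc : sin h ^+ 2 + cos h ^+ 2 = 1 by rewrite addrC cos2Dsin2.
(* The rows are the unit vectors at angle h on either side of the second axis, so their inner
   product is cos 2h = c. *)
pose A : 'M[R]_2 := \matrix_(i, j) if j == 0 then (if i == 0 then sin h else - sin h) else cos h.
have dA : \det A = 2 * sin h * cos h by rewrite det_mx22 !mxE /=; ring.
have := leb_wedge (_ : 0 < h < pi / 2); rewrite h0 h1 => /(_ isT).
set W := [set _ | _] => WE.
have mc i : measurable_fun setT (fun u : 'rV[R]_2 => u 0 i) by exact: measurable_coord.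
have mW : measurable W.
  apply: measurableI.
    apply: measurable_set_lt; apply: measurable_funM => //.
    exact: measurableT_comp.
  by apply: measurable_set_le => //; apply: measurable_funD; exact: measurable_funX.
have dA0 : 0 < \det A by rewrite dA !mulr_gt0.
have tA (t : 'rV[R]_2) : (t *m A) 0 0 = sin h * (t 0 0 - t 0 1) /\
    (t *m A) 0 1 = cos h * (t 0 0 + t 0 1).
  rewrite !mxE !big_ord_recl !big_ord0 !mxE /= !addr0 (_ : lift ord0 ord0 = 1); last exact/val_inj.
  by split; ring.
rewrite (@leb_mulmx _ _ A) ?gt_eqF// in WE.
rewrite gtr0_norm// in WE.
have SE : [set t : 'rV[R]_2 | [/\ 0 < t 0 0, 0 < t 0 1 &
     t 0 0 ^+ 2 + t 0 1 ^+ 2 + 2 * c * (t 0 0 * t 0 1) <= 1]] = [set t | W (t *m A)].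
  have cE : c = cos h ^+ 2 - sin h ^+ 2 by rewrite ch cosD !expr2.
  have wE (x y : R) : (`|sin h * x| * cos h < cos h * y * sin h) = (`|x| < y).
    rewrite normrM (gtr0_norm sh) [X in X < _](_ : _ = (sin h * cos h) * `|x|); last by ring.
    rewrite [X in _ < X](_ : _ = (sin h * cos h) * y); last by ring.
    by rewrite ltr_pM2l ?mulr_gt0.
  apply/seteqP; split=> t /=; rewrite /W /= (tA t).1 (tA t).2 wE ltr_norml.
    move=> [t0 t1 t2]; split; first by apply/andP; split; lra.
    by apply: le_trans t2; rewrite cE; nra.
  move=> [/andP[t3 t4] t2]; split; [lra|lra|].
  by apply: le_trans t2; rewrite cE; nra.
rewrite SE; have sE : Num.sqrt (1 - c ^+ 2) = 2 * sin h * cos h.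
  rewrite -sin_acos; last by apply/andP; split; lra.
  by rewrite [acos c]splitr -/h sinD; ring.
have fin : leb R 2 [set t | W (t *m A)] \is a fin_num.
  rewrite ge0_fin_numE// ltNge; apply/negP; rewrite leye_eq => /eqP E.
  by move: WE; rewrite E mulry gtr0_sg// mul1e.
move: WE; rewrite -(fineK fin) -EFinM => -[WE]; congr EFin.
rewrite sE -dA [RHS](_ : _ = h / \det A); last by rewrite /h; field; rewrite gt_eqF.
by rewrite -WE mulrC mulKf// gt_eqF.
Qed.

End sector.

(** * Spherical triangles *)

Section girard.
Variable R : realType.
Local Notation mu1 := (@lebesgue_measure R).

(** Rescaling the coordinates by sqrt(r/p) and sqrt(r/s) reduces to two unit vectors with cosine q /
    sqrt(ps). The value r = 0 is included because it occurs in the extreme slices of a lune; the set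
    is then empty since the form is definite. *)
Lemma leb_sector (p q s r : R) : 0 < p -> 0 < s -> q ^+ 2 < p * s -> 0 <= r ->
  leb R 2 [set t : 'rV[R]_2 | [/\ 0 < t 0 0, 0 < t 0 1 &
     p * t 0 0 ^+ 2 + s * t 0 1 ^+ 2 + 2 * q * (t 0 0 * t 0 1) <= r]] =
  (r * acos (q / Num.sqrt (p * s)) / (2 * Num.sqrt (p * s - q ^+ 2)))%:E.
Proof.
move=> p0 s0 qps; rewrite le_eqVlt => /orP[/eqP <-|r0].
  rewrite !mul0r (_ : [set _ | _] = set0) ?measure0//; apply/seteqP; split=> t //= [t0 t1 t2].
  have := mulr_gt0 p0 t0; have := mulr_gt0 s0 t1 => h1 h2.
  have : (p * t 0 0 + q * t 0 1) ^+ 2 + (p * s - q ^+ 2) * t 0 1 ^+ 2 <= 0.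
    have -> : (p * t 0 0 + q * t 0 1) ^+ 2 + (p * s - q ^+ 2) * t 0 1 ^+ 2 =
      p * (p * t 0 0 ^+ 2 + s * t 0 1 ^+ 2 + 2 * q * (t 0 0 * t 0 1)) by ring.
    by rewrite pmulr_rle0.
  have h3 : 0 < (p * s - q ^+ 2) * t 0 1 ^+ 2 by rewrite mulr_gt0 ?subr_gt0 ?exprn_gt0.
  have := sqr_ge0 (p * t 0 0 + q * t 0 1); lra.
have mc i : measurable_fun setT (fun u : 'rV[R]_2 => u 0 i) by exact: measurable_coord.
set S := [set t | _].
have mS : measurable S.
  rewrite (_ : S = [set t : 'rV[R]_2 | 0 < t 0 0] `&` [set t : 'rV[R]_2 | 0 < t 0 1] `&`
    [set t : 'rV[R]_2 | p * t 0 0 ^+ 2 + s * t 0 1 ^+ 2 + 2 * q * (t 0 0 * t 0 1) <= r]); last first.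
    by apply/seteqP; split=> t /=; [case|case=> -[]].
  apply: measurableI; first by apply: measurableI; exact: measurable_set_lt.
  apply: measurable_set_le => //.
  by repeat (apply: measurable_funD => //|| apply: measurable_funM => // || apply: measurable_funX => //).
have ps0 : 0 < p * s by rewrite mulr_gt0.
set w := Num.sqrt (p * s); have w0 : 0 < w by rewrite sqrtr_gt0.
have w2 : w ^+ 2 = p * s by rewrite sqr_sqrtr// ltW.
pose a : 'rV[R]_2 := \row_i (if i == 0 then Num.sqrt (r / p) else Num.sqrt (r / s)).
have a00 : a 0 0 = Num.sqrt (r / p) by rewrite mxE.
have a01 : a 0 1 = Num.sqrt (r / s) by rewrite mxE.
have a0 i : 0 < a 0 i by rewrite mxE; case: ifP => _; rewrite sqrtr_gt0 divr_gt0.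
clearbody a.
have a0a1 : a 0 0 * a 0 1 = r / w.
  rewrite a00 a01 -sqrtrM ?divr_ge0 ?ltW// mulrACA -expr2 -invfM sqrtrM ?sqr_ge0//.
  by rewrite sqrtr_sqr gtr0_norm// sqrtrV// ltW.
have a02 : a 0 0 ^+ 2 = r / p by rewrite a00 sqr_sqrtr// divr_ge0 ?ltW.
have a12 : a 0 1 ^+ 2 = r / s by rewrite a01 sqr_sqrtr// divr_ge0 ?ltW.
rewrite (leb_scale_coord a0 mS).
rewrite [X in leb R 2 X](_ : _ = [set t : 'rV[R]_2 | [/\ 0 < t 0 0, 0 < t 0 1 &
     t 0 0 ^+ 2 + t 0 1 ^+ 2 + 2 * (q / w) * (t 0 0 * t 0 1) <= 1]]); last first.
  have E (t : 'rV[R]_2) : p * (t 0 0 * a 0 0) ^+ 2 + s * (t 0 1 * a 0 1) ^+ 2 +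
      2 * q * (t 0 0 * a 0 0 * (t 0 1 * a 0 1)) =
      r * (t 0 0 ^+ 2 + t 0 1 ^+ 2 + 2 * (q / w) * (t 0 0 * t 0 1)).
    rewrite [t 0 0 * a 0 0 * _]mulrACA a0a1 !exprMn a02 a12; field.
    by rewrite !gt_eqF.
  apply/seteqP; split=> t /=; rewrite /S /= !mxE E !pmulr_lgt0//;
    by rewrite -{2}[r]mulr1 ler_pM2l.
have cw : (q / w) ^+ 2 < 1.
  by rewrite exprMn exprVn w2 ltr_pdivrMr ?mul1r.
rewrite leb_sector1; last by apply/andP; split; nra.
rewrite -EFinM big_ord_recl big_ord_recl big_ord0 mulr1.
rewrite (_ : lift ord0 ord0 = 1) ?a0a1; last exact/val_inj.
congr EFin.
have -> : p * s - q ^+ 2 = w ^+ 2 * (1 - (q / w) ^+ 2).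
  by rewrite -w2; field; rewrite gt_eqF.
rewrite (sqrtrM _ (sqr_ge0 w)) sqrtr_sqr gtr0_norm//.
set u := Num.sqrt (1 - _); have u0 : u != 0 by rewrite gt_eqF// sqrtr_gt0 subr_gt0.
by field; rewrite u0 gt_eqF.
Qed.

(* The quadratic form of three unit vectors with cosines [x] (of 1, 2), [y] (of 0, 2) and [z]
   (of 0, 1); [det3] is its determinant and [dihedral x y z] the angle at vector 0 of the
   spherical triangle they span. *)
Definition form3 (x y z : R) (t : 'rV[R]_3) :=
  t 0 0 ^+ 2 + t 0 1 ^+ 2 + t 0 2 ^+ 2 +
  2 * (z * (t 0 0 * t 0 1) + y * (t 0 0 * t 0 2) + x * (t 0 1 * t 0 2)).

Definition det3 (x y z : R) := 1 + 2 * (x * y * z) - x ^+ 2 - y ^+ 2 - z ^+ 2.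

Definition dihedral (x y z : R) :=
  acos ((x - y * z) / Num.sqrt ((1 - y ^+ 2) * (1 - z ^+ 2))).

Lemma measurable_form3 x y z : measurable_fun setT (form3 x y z).
Proof.
have mc i : measurable_fun setT (fun u : 'rV[R]_3 => u 0 i) by exact: measurable_coord.
by repeat (apply: measurable_funD => //|| apply: measurable_funM => // || apply: measurable_funX => //).
Qed.

Lemma measurable_ball3 x y z : measurable [set t | form3 x y z t <= 1].
Proof. by apply: measurable_set_le => //; exact: measurable_form3. Qed.

Lemma measurable_pos n (k : 'I_n) : measurable [set t : 'rV[R]_n | 0 < t 0 k].
Proof. by apply: measurable_set_lt => //; exact: measurable_coord. Qed.

Lemma integral_1mx2 (K : R) :
  (\int[mu1]_(x in `[(-1)%R, 1%R]) ((1 - x ^+ 2) * K)%:E = (4 / 3 * K)%:E)%E.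
Proof.
pose p : {poly R} := K *: (1 - 'X^2).
pose q : {poly R} := K *: ('X - 3^-1 *: 'X^3).
have dq : q^`() = p.
  rewrite /q /p derivZ derivB derivX derivZ derivXn /= -(scaler_nat 3 'X^2).
  by rewrite scalerA mulVf ?scale1r ?pnatr_eq0.
have px x : p.[x] = (1 - x ^+ 2) * K by rewrite !hornerE mulrC.
under eq_integral do rewrite -px.
have dF (x : R) : x \in `[-1, 1] -> is_derive x 1 (horner q) p.[x].
  by rewrite -dq => _; exact: is_derive_poly.
have le11 : -1 <= 1 :> R by lra.
rewrite (FTC_itv le11 dF); last by move=> x _; exact: derivable_horner.
by rewrite /q !hornerE /=; congr EFin; field.
Qed.

(** Slicing perpendicularly to vector 0 gives plane sectors of the dihedral angle and squared radius
    1 - s^2; the integral of 1 - s^2 over [-1, 1] is 4/3. *)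
Lemma leb_lune (x y z : R) : y ^+ 2 < 1 -> z ^+ 2 < 1 -> 0 < det3 x y z ->
  leb R 3 [set t : 'rV[R]_3 | [/\ 0 < t 0 1, 0 < t 0 2 & form3 x y z t <= 1]] =
  (2 / 3 * dihedral x y z / Num.sqrt (det3 x y z))%:E.
Proof.
move=> y1 z1 d0.
pose S := [set t : 'rV[R]_3 | [/\ 0 < t 0 1, 0 < t 0 2 &
   t 0 0 ^+ 2 + ((1 - z ^+ 2) * t 0 1 ^+ 2 + (1 - y ^+ 2) * t 0 2 ^+ 2 +
   2 * (x - y * z) * (t 0 1 * t 0 2)) <= 1]].
have mc i : measurable_fun setT (fun u : 'rV[R]_3 => u 0 i) by exact: measurable_coord.
have mS : measurable S.
  rewrite (_ : S = [set t : 'rV[R]_3 | 0 < t 0 1] `&` [set t : 'rV[R]_3 | 0 < t 0 2] `&`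
    [set t : 'rV[R]_3 | t 0 0 ^+ 2 + ((1 - z ^+ 2) * t 0 1 ^+ 2 + (1 - y ^+ 2) * t 0 2 ^+ 2 +
       2 * (x - y * z) * (t 0 1 * t 0 2)) <= 1]); last first.
    by apply/seteqP; split=> t /=; [case|case=> -[]].
  apply: measurableI; first by apply: measurableI; exact: measurable_pos.
  apply: measurable_set_le => //.
  by repeat (apply: measurable_funD => //|| apply: measurable_funM => // || apply: measurable_funX => //).
(* Completing the square: replacing t0 by t0 + z t1 + y t2, a shear of determinant 1, removes the
   cross terms with t0. *)
pose c : 'cV[R]_2 := \col_i if i == 0 then z else y.
have l1 : 1 = lift ord0 ord0 :> 'I_3 by exact/val_inj.
have l2 : 2 = lift ord0 (1 : 'I_2) :> 'I_3 by exact/val_inj.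
transitivity (leb R 3 S).
  rewrite [RHS](lebJ_lshear c mS) det_lblock !det1 mulr1 normr1 mul1e.
  congr (leb R 3 _); apply/seteqP; split=> t /=;
    rewrite -(pair_of_rvK t); move: (pair_of_rv t) => [t0 u];
    rewrite /S /form3 /= rcons_rv_mulmx mulr1 scaler0 add0r mulmx1 l2 l1 !rcons_rvS !rcons_rv0 /=;
    rewrite !mxE !big_ord_recl big_ord0 !mxE /= (_ : lift ord0 ord0 = 1) ?addr0; try exact/val_inj;
    move=> [h1 h2 h3]; split=> //; apply: le_trans h3; rewrite le_eqVlt; apply/orP; left; apply/eqP; ring.
have p1 : 0 < 1 - z ^+ 2 by lra.
have p2 : 0 < 1 - y ^+ 2 by lra.
have pd : (x - y * z) ^+ 2 < (1 - z ^+ 2) * (1 - y ^+ 2).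
  rewrite -subr_gt0; move: d0; congr (0 < _); rewrite /det3; ring.
have pdE : (1 - z ^+ 2) * (1 - y ^+ 2) - (x - y * z) ^+ 2 = det3 x y z.
  by rewrite /det3; ring.
rewrite lebS (_ : (fun _ => _) =
  (fun s => ((1 - s ^+ 2) * (dihedral x y z / (2 * Num.sqrt (det3 x y z))))%:E) \_ `[-1, 1]); last first.
  apply/funext => s; rewrite patchE mem_setE in_itv /=.
  rewrite (_ : [set _ | _] = [set u : 'rV[R]_2 | [/\ 0 < u 0 0, 0 < u 0 1 &
   (1 - z ^+ 2) * u 0 0 ^+ 2 + (1 - y ^+ 2) * u 0 1 ^+ 2 +
   2 * (x - y * z) * (u 0 0 * u 0 1) <= 1 - s ^+ 2]]); last first.
    apply/seteqP; split=> u /=; rewrite /S /= l2 l1 !rcons_rvS rcons_rv0 /= => -[h1 h2 h3];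
      split=> //; lra.
  case: ifPn => [/andP[s0 s1]|sN].
    rewrite leb_sector//; last by nra.
    by rewrite pdE /dihedral [X in Num.sqrt X]mulrC mulrA.
  rewrite (_ : [set _ | _] = set0) ?measure0//; apply/seteqP; split=> u //= [h1 h2 h3].
  have : (1 - z ^+ 2) * ((1 - z ^+ 2) * u 0 0 ^+ 2 + (1 - y ^+ 2) * u 0 1 ^+ 2 +
   2 * (x - y * z) * (u 0 0 * u 0 1)) = ((1 - z ^+ 2) * u 0 0 + (x - y * z) * u 0 1) ^+ 2 +
     det3 x y z * u 0 1 ^+ 2 by rewrite /det3; ring.
  move: h3; set f := (X in X <= _) => h3 fE.
  have f0 : 0 <= f.
    rewrite -(pmulr_rge0 _ p1) fE addr_ge0 ?sqr_ge0// mulr_ge0 ?sqr_ge0//; exact: ltW.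
  move/negP: sN; apply; apply/andP; split; nra.
rewrite -integral_mkcond integral_1mx2; congr EFin.
by field; rewrite gt_eqF// sqrtr_gt0.
Qed.

(** The open cone over a spherical triangle, cut by the unit ball, in coordinates along the three
    vertices. *)
Definition octant (x y z : R) :=
  [set t : 'rV[R]_3 | [/\ 0 < t 0 0, 0 < t 0 1, 0 < t 0 2 & form3 x y z t <= 1]].

Lemma measurable_octant x y z : measurable (octant x y z).
Proof.
rewrite (_ : octant x y z = [set t : 'rV[R]_3 | 0 < t 0 0] `&` [set t : 'rV[R]_3 | 0 < t 0 1]
  `&` [set t : 'rV[R]_3 | 0 < t 0 2] `&` [set t | form3 x y z t <= 1]); last first.
  by apply/seteqP; split=> t /=; [case|case=> -[[]]].
apply: measurableI; last exact: measurable_ball3.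
by apply: measurableI; [apply: measurableI|]; exact: measurable_pos.
Qed.

Lemma leb_octant_swap01 x y z : leb R 3 (octant x y z) = leb R 3 (octant y x z).
Proof.
rewrite (leb_perm (tperm 0 1) (measurable_octant x y z)); congr (leb R 3 _).
by apply/seteqP; split=> t; rewrite /octant /form3 /= !mxE tpermL tpermR tpermD// => -[h0 h1 h2 h3];
  split=> //; lra.
Qed.

Lemma leb_octant_swap02 x y z : leb R 3 (octant x y z) = leb R 3 (octant z y x).
Proof.
rewrite (leb_perm (tperm 0 2) (measurable_octant x y z)); congr (leb R 3 _).
by apply/seteqP; split=> t; rewrite /octant /form3 /= !mxE tpermL tpermR tpermD// => -[h0 h1 h2 h3];
  split=> //; lra.
Qed.

(* Girard's argument: a lune is a triangle together with its mirror triangle across a side. *)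
Lemma leb_lune_octants x y z :
  leb R 3 [set t : 'rV[R]_3 | [/\ 0 < t 0 1, 0 < t 0 2 & form3 x y z t <= 1]] =
  (leb R 3 (octant x y z) + leb R 3 (octant x (- y) (- z)))%E.
Proof.
set S := [set _ | _].
have mS : measurable S.
  rewrite (_ : S = [set t : 'rV[R]_3 | 0 < t 0 1] `&` [set t : 'rV[R]_3 | 0 < t 0 2]
    `&` [set t | form3 x y z t <= 1]); last by apply/seteqP; split=> t /=; [case|case=> -[]].
  apply: measurableI; last exact: measurable_ball3.
  by apply: measurableI; exact: measurable_pos.
rewrite [LHS](leb_split (0 : 'I_3) mS); apply: (f_equal2 (fun a b => (a + b)%E)).
  by congr (leb R 3 _); apply/seteqP; split=> t /=; rewrite /S /octant /=; [case=> -[]|case].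
rewrite [LHS](leb_flip 0); last first.
  by apply: measurableI => //; apply: measurable_set_lt => //; exact: measurable_coord.
congr (leb R 3 _); apply/seteqP; split=> t; rewrite /S /octant /form3 /= !mxE /= oppr_lt0.
  by move=> [[h1 h2 h3] h0]; split=> //; lra.
by move=> [h0 h1 h2 h3]; split=> //; split=> //; lra.
Qed.

(** Negating vector 0 or vector 1 gives two neighbours of the triangle. Each of them completes the
    triangle to a lune, and together, after taking the antipode of one, they form the lune at vector
    2 with the supplementary angle. The triangle is thus half of the sum of the first two lunes
    minus the third, and the supplement is the source of - pi. Antipodes come for free, since the
    form depends only on the cosines. *)
Lemma leb_octant x y z : x ^+ 2 < 1 -> y ^+ 2 < 1 -> z ^+ 2 < 1 -> 0 < det3 x y z ->
  leb R 3 (octant x y z) =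
  ((dihedral x y z + dihedral y x z + dihedral z y x - pi) / (3 * Num.sqrt (det3 x y z)))%:E.
Proof.
move=> x1 y1 z1 d0.
have d1 : det3 y x z = det3 x y z by rewrite /det3; ring.
have d2 : det3 (- z) y (- x) = det3 x y z by rewrite /det3; ring.
have a3 : dihedral (- z) y (- x) = pi - dihedral z y x.
  rewrite /dihedral -acosN; first by congr acos; rewrite sqrrN -[RHS]mulNr; congr (_ * _); ring.
  set w := Num.sqrt _.
  have w0 : 0 < w by rewrite sqrtr_gt0 mulr_gt0// subr_gt0.
  have w2 : w ^+ 2 = (1 - y ^+ 2) * (1 - x ^+ 2) by rewrite sqr_sqrtr// mulr_ge0// ltW// subr_gt0.
  have : ((z - y * x) / w) ^+ 2 <= 1.
    rewrite exprMn exprVn ler_pdivrMr ?exprn_gt0// mul1r w2.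
    rewrite -subr_ge0; apply/ltW; move: d0; congr (0 < _); rewrite /det3; ring.
  by move=> h; apply/andP; split; nra.
have e1 := leb_lune_octants x y z; rewrite leb_lune// in e1.
have e2 := leb_lune_octants y x z; rewrite leb_lune ?d1// in e2.
have e3 := leb_lune_octants (- z) y (- x); rewrite leb_lune ?d2 ?sqrrN// opprK in e3.
rewrite (leb_octant_swap02 (- z)) (leb_octant_swap02 (- z) (- y)) a3 in e3.
rewrite (leb_octant_swap01 y x z) (leb_octant_swap01 y (- x)) in e2.
move: e1 e2 e3; set o := leb R 3 _; set w1 := leb R 3 _; set w2 := leb R 3 _.
have o0 : (0 <= o)%E by exact: measure_ge0.
have w10 : (0 <= w1)%E by exact: measure_ge0.
have w20 : (0 <= w2)%E by exact: measure_ge0.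
case: o o0 => [a||]// _; case: w1 w10 => [w1||]// _; case: w2 w20 => [w2||]// _.
move=> [e1] [e2] [e3].
congr EFin; set u := Num.sqrt _ in e1 e2 e3 *.
have u0 : u != 0 by rewrite gt_eqF// sqrtr_gt0.
have -> : a = ((a + w1) + (a + w2) - (w2 + w1)) / 2 by field.
by rewrite -e1 -e2 -e3; field.
Qed.

End girard.

(** * L'Huilier's formula for isosceles spherical triangles *)

Section excess.
Variable R : realType.

Lemma cos_half_acos (c : R) : -1 <= c <= 1 -> cos (acos c / 2) = Num.sqrt ((1 + c) / 2).
Proof.
move=> c1; have /andP[cge cle] := c1.
have e : cos (acos c / 2) ^+ 2 = (1 + c) / 2.
  have : c = cos (acos c / 2 *+ 2) by rewrite -mulr_natr divfK ?acosK ?in_itv.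
  by rewrite cos_mulr2n mulr2n => h; rewrite {2}h; field.
rewrite -e sqrtr_sqr ger0_norm// cos_ge0_pihalf//.
have := acos_ge0 c1; have := acos_lepi c1; have := pi_gt0 R => h1 h2 h3.
by apply/andP; split; lra.
Qed.

Lemma sin_half_acos (c : R) : -1 <= c <= 1 -> sin (acos c / 2) = Num.sqrt ((1 - c) / 2).
Proof.
move=> c1; have /andP[cge cle] := c1.
have e : sin (acos c / 2) ^+ 2 = (1 - c) / 2.
  have := cos2Dsin2 (acos c / 2); rewrite cos_half_acos// sqr_sqrtr; last by rewrite divr_ge0//; lra.
  by move=> h; lra.
rewrite -e sqrtr_sqr ger0_norm// sin_ge0_pi//.
have := acos_ge0 c1; have := acos_lepi c1; have := pi_gt0 R => h1 h2 h3.
by apply/andP; split; lra.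
Qed.

Lemma tan_mul_tan (p q : R) :
  tan p * tan q = (cos (p - q) - cos (p + q)) / (cos (p - q) + cos (p + q)).
Proof.
rewrite /tan mulrACA -invfM cosB cosD.
rewrite [X in _ = X / _](_ : _ = 2 * (sin p * sin q)); last by ring.
rewrite [X in _ = _ / X](_ : _ = 2 * (cos p * cos q)); last by ring.
by rewrite -[RHS]mulf_div divff ?mul1r// pnatr_eq0.
Qed.

Lemma cos_2atan_sqrt (T : R) : 0 <= T -> cos (2 * atan (Num.sqrt T)) = (1 - T) / (1 + T).
Proof.
move=> T0; rewrite mulr_natl cos_mulr2n cos_atan exprVn sqr_sqrtr; last by rewrite addr_ge0 ?sqr_ge0.
by rewrite sqr_sqrtr// mulr2n; field; rewrite gt_eqF//; lra.
Qed.

(** The sides have cosines a, a, b, and the semiperimeter is [acos a + acos b / 2]. The condition 2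
    a^2 < 1 + b is the triangle inequality [acos b < 2 * acos a]. The identity is proved by
    comparing the cosines of half of both sides. *)
Lemma isosceles_excess (a b : R) : 0 < a < 1 -> -1 < b < 1 -> 2 * a ^+ 2 < 1 + b ->
  0 <= dihedral a b a + dihedral b a a + dihedral a b a - pi ->
  dihedral a b a + dihedral b a a + dihedral a b a - pi =
  4 * atan (Num.sqrt (tan (acos a / 2 + acos b / 4) * tan (acos a / 2 - acos b / 4) *
                      tan (acos b / 4) ^+ 2)).
Proof.
move=> /andP[a0 a1] /andP[b0 b1] ab E0.
(* [C] and [s] are the cosine and sine of half the base, [q] is the sine of a leg. Below, [g / q]
   turns out to be the cosine of half the apex angle [B]; [A] is a base angle. *)
pose C := Num.sqrt ((1 + b) / 2); pose s := Num.sqrt ((1 - b) / 2).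
pose q := Num.sqrt (1 - a ^+ 2).
have C2 : C ^+ 2 = (1 + b) / 2 by rewrite sqr_sqrtr// divr_ge0//; lra.
have s2 : s ^+ 2 = (1 - b) / 2 by rewrite sqr_sqrtr// divr_ge0//; lra.
have q2 : q ^+ 2 = 1 - a ^+ 2 by rewrite sqr_sqrtr//; nra.
pose g := Num.sqrt (C ^+ 2 - a ^+ 2).
have g2 : g ^+ 2 = C ^+ 2 - a ^+ 2 by rewrite sqr_sqrtr// C2; lra.
have C0 : 0 < C by rewrite sqrtr_gt0 divr_gt0//; lra.
have s0 : 0 < s by rewrite sqrtr_gt0 divr_gt0//; lra.
have q0 : 0 < q by rewrite sqrtr_gt0; nra.
have g0 : 0 < g by rewrite sqrtr_gt0 C2; lra.
have bE : b = 2 * C ^+ 2 - 1 by lra.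
have bE' : b = 1 - 2 * s ^+ 2 by lra.
have C1 : C < 1 by nra.
have Ca : a < C by nra.
have cA : (a - b * a) / Num.sqrt ((1 - b ^+ 2) * (1 - a ^+ 2)) = a * s / (C * q).
  have -> : (1 - b ^+ 2) * (1 - a ^+ 2) = (2 * C * s * q) ^+ 2.
    by rewrite !exprMn C2 s2 q2; field.
  rewrite sqrtr_sqr ger0_norm; last by rewrite !mulr_ge0 // ltW.
  by rewrite bE'; field; rewrite !gt_eqF.
have cB : (b - a * a) / Num.sqrt ((1 - a ^+ 2) * (1 - a ^+ 2)) = 1 - 2 * (s / q) ^+ 2.
  rewrite -expr2 sqrtr_sqr ger0_norm; last by rewrite -q2 sqr_ge0.
  rewrite exprMn exprVn -q2 bE' (_ : a ^+ 2 = 1 - q ^+ 2); last by lra.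
  by field; rewrite gt_eqF.
have sq1 : (s / q) ^+ 2 + (g / q) ^+ 2 = 1.
  rewrite !exprMn exprVn g2 s2 q2 C2; field; rewrite gt_eqF//; nra.
have cA2 : (a * s / (C * q)) ^+ 2 + (g / (C * q)) ^+ 2 = 1.
  rewrite !exprMn !exprVn exprMn g2 s2 q2 C2.
  by field; rewrite !gt_eqF//; nra.
move: E0; rewrite /dihedral cA cB; set A := acos _; set B := acos _ => E0.
have cAB : -1 <= a * s / (C * q) <= 1.
  by have := sqr_ge0 (g / (C * q)); move=> h; apply/andP; split; nra.
have cBB : -1 <= 1 - 2 * (s / q) ^+ 2 <= 1.
  by have := sqr_ge0 (g / q); have := sqr_ge0 (s / q); move=> h1 h2; apply/andP; split; lra.
have cosA : cos A = a * s / (C * q) by rewrite acosK// in_itv.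
have sinA : sin A = g / (C * q).
  rewrite sin_acos// (_ : 1 - _ = (g / (C * q)) ^+ 2); last by lra.
  by rewrite sqrtr_sqr gtr0_norm// divr_gt0// mulr_gt0.
have cosB2 : cos (B / 2) = g / q.
  rewrite cos_half_acos// (_ : (1 + _) / 2 = (g / q) ^+ 2); last by lra.
  by rewrite sqrtr_sqr gtr0_norm// divr_gt0.
have sinB2 : sin (B / 2) = s / q.
  rewrite sin_half_acos// (_ : (1 - _) / 2 = (s / q) ^+ 2); last by lra.
  by rewrite sqrtr_sqr gtr0_norm// divr_gt0.
have cosE : cos ((A + B + A - pi) / 2) = (C ^+ 2 + a) / (C * (1 + a)).
  rewrite (_ : (A + B + A - pi) / 2 = A + B / 2 - pi / 2); last by field.
  rewrite cosB cos_pihalf sin_pihalf mulr0 add0r mulr1 sinD sinA cosB2 cosA sinB2.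
  have -> : g / (C * q) * (g / q) + a * s / (C * q) * (s / q) =
    (g ^+ 2 + a * s ^+ 2) / (C * q ^+ 2) by field; rewrite !gt_eqF.
  rewrite g2 s2 q2 C2; field.
  by rewrite !gt_eqF//=; nra.
pose T := (C - a) / (C + a) * ((1 - C) / (1 + C)).
have TE : tan (acos a / 2 + acos b / 4) * tan (acos a / 2 - acos b / 4) *
                      tan (acos b / 4) ^+ 2 = T.
  rewrite tan_mul_tan expr2 tan_mul_tan.
  rewrite (_ : acos a / 2 + acos b / 4 - (acos a / 2 - acos b / 4) = acos b / 2); last by field.
  rewrite (_ : acos a / 2 + acos b / 4 + (acos a / 2 - acos b / 4) = acos a); last by field.
  rewrite subrr cos0 (_ : acos b / 4 + acos b / 4 = acos b / 2); last by field.
  rewrite cos_half_acos ?acosK -/C//; first by rewrite in_itv /=; apply/andP; split; lra.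
  by apply/andP; split; lra.
have T0 : 0 <= T by rewrite /T mulr_ge0// divr_ge0//; lra.
have cosT : cos (2 * atan (Num.sqrt T)) = (C ^+ 2 + a) / (C * (1 + a)).
  rewrite cos_2atan_sqrt// /T; field.
  by rewrite !gt_eqF//=; nra.
(* Both sides lie in [0, pi], where the cosine is injective; on the left the lower bound is the
   assumption [E0]. *)
have E2 : (A + B + A - pi) / 2 = 2 * atan (Num.sqrt T).
  apply: (@cos_inj R); last by rewrite cosE cosT.
    have := acos_lepi cAB; have := acos_lepi cBB; rewrite -/A -/B => h1 h2.
    by rewrite in_itv /=; apply/andP; split; lra.
  have := atan_ltpi2 (Num.sqrt T); have := le_atan (sqrtr_ge0 T); rewrite atan0 => h1 h2.
  by rewrite in_itv /=; apply/andP; split; lra.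
rewrite TE; lra.
Qed.

End excess.

(** * Decomposition of the parallel body of a polytope *)

Section dot_product.
Variables (R : realType) (n : nat).
Implicit Types (u v w : 'rV[R]_n) (a : R).

Lemma dotvE u v : dotv u v = \sum_i u 0 i * v 0 i.
Proof. by rewrite /dotv mxE; apply: eq_bigr => i _; rewrite mxE. Qed.

Lemma dotvC u v : dotv u v = dotv v u.
Proof. by rewrite !dotvE; apply: eq_bigr => i _; rewrite mulrC. Qed.

Lemma dotvDl u v w : dotv (u + v) w = dotv u w + dotv v w.
Proof. by rewrite /dotv mulmxDl mxE. Qed.

Lemma dotvZl a u v : dotv (a *: u) v = a * dotv u v.
Proof. by rewrite /dotv -scalemxAl mxE. Qed.

Lemma dotvNl u v : dotv (- u) v = - dotv u v.
Proof. by rewrite -scaleN1r dotvZl mulN1r. Qed.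

Lemma dotvBl u v w : dotv (u - v) w = dotv u w - dotv v w.
Proof. by rewrite dotvDl dotvNl. Qed.

Lemma dotv0l v : dotv 0 v = 0.
Proof. by rewrite /dotv mul0mx mxE. Qed.

Lemma dotv_suml (J : Type) (s : seq J) (P : pred J) (f : J -> 'rV[R]_n) v :
  dotv (\sum_(j <- s | P j) f j) v = \sum_(j <- s | P j) dotv (f j) v.
Proof. by rewrite /dotv mulmx_suml summxE. Qed.

Lemma dotvDr u v w : dotv w (u + v) = dotv w u + dotv w v.
Proof. by rewrite !(dotvC w) dotvDl. Qed.

Lemma dotvZr a u v : dotv u (a *: v) = a * dotv u v.
Proof. by rewrite !(dotvC u) dotvZl. Qed.

Lemma dotvNr u v : dotv u (- v) = - dotv u v.
Proof. by rewrite !(dotvC u) dotvNl. Qed.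

Lemma dotvBr u v w : dotv w (u - v) = dotv w u - dotv w v.
Proof. by rewrite dotvDr dotvNr. Qed.

Lemma dotv_sumr (J : Type) (s : seq J) (P : pred J) (f : J -> 'rV[R]_n) v :
  dotv v (\sum_(j <- s | P j) f j) = \sum_(j <- s | P j) dotv v (f j).
Proof. by rewrite dotvC dotv_suml; apply: eq_bigr => j _; rewrite dotvC. Qed.

Lemma dotv_ge0 u : 0 <= dotv u u.
Proof. by rewrite dotvE sumr_ge0// => i _; rewrite -expr2 sqr_ge0. Qed.

Lemma dotv_eq0 u : dotv u u = 0 -> u = 0.
Proof.
rewrite dotvE => u0; apply/rowP => i; rewrite mxE.
have p0 j : true -> 0 <= u 0 j * u 0 j by rewrite -expr2 sqr_ge0.
have H := psumr_eq0P p0 u0; have /eqP := H i isT.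
by rewrite mulf_eq0 orbb => /eqP.
Qed.

Lemma enorm_le u v : dotv u u <= dotv v v -> enorm u <= enorm v.
Proof. by move=> uv; apply: ler_wsqrtr. Qed.

End dot_product.

Lemma continuous_finsum (R : realType) (T : topologicalType) (J : Type) (s : seq J)
    (F : J -> T -> R) :
  (forall j, continuous (F j)) -> continuous (fun x => \sum_(j <- s) F j x).
Proof.
move=> cF; elim: s => [|j s IH].
  by under eq_fun do rewrite big_nil; move=> x; exact: cvg_cst.
under eq_fun do rewrite big_cons.
by move=> x; apply: cvgD; [exact: cF|exact: IH].
Qed.

Section nearest_point.
Variables (R : realType) (n : nat) (I : finType) (v : I -> 'rV[R]_n).

Definition weights (w : I -> R) := (forall i, 0 <= w i) /\ \sum_i w i = 1.

Definition bary (w : I -> R) : 'rV[R]_n := \sum_i w i *: v i.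

Lemma conv_hullE x : conv_hull v x <-> exists2 w, weights w & x = bary w.
Proof.
split=> [[w [w0 [w1 ->]]]|[w [w0 w1] ->]]; first by exists w.
by exists w.
Qed.

(** The distance is minimised over the compact simplex of weights rather than over the hull, so the
    minimiser comes with its weights; [i0] makes the simplex nonempty. *)
Lemma nearest_point (i0 : I) (x : 'rV[R]_n) : exists2 w, weights w &
  forall w', weights w' -> dotv (x - bary w) (x - bary w) <= dotv (x - bary w') (x - bary w').
Proof.
(* Weight functions are read as row vectors, where a box is known to be compact. *)
pose W (u : 'rV[R]_#|I|) i := u 0 (enum_rank i).
pose U (w : I -> R) : 'rV[R]_#|I| := \row_k w (enum_val k).
have WU w : W (U w) = w by apply/funext => i; rewrite /W /U mxE enum_rankK.
pose A := [set u : 'rV[R]_#|I| | weights (W u)].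
pose f (u : 'rV[R]_#|I|) := dotv (x - bary (W u)) (x - bary (W u)).
have cW i : continuous (fun u : 'rV[R]_#|I| => W u i) by exact: coord_continuous.
have cA : compact A.
  apply: (@subclosed_compact _ A [set u : 'rV[R]_#|I| | forall k, u ord0 k \in `[0, 1]]).
  - rewrite (_ : A = (\bigcap_i [set u : 'rV[R]_#|I| | 0 <= W u i]) `&`
        [set u : 'rV[R]_#|I| | \sum_i W u i = 1]); last first.
      apply/seteqP; split=> u /= [h1 h2]; split=> // i; last exact: h1.
      by move=> _; exact: h1.
    apply: closedI.
      apply: closed_bigI => i _.
      by apply: (preimage_closed _ (@closed_ge R 0)) => u _; exact: cW.
    apply: (preimage_closed _ (@closed_eq R 1)) => u _.
    exact: continuous_finsum.
  - apply: (@rV_compact R _ (fun=> `[(0 : R), 1]%classic)).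
    by move=> _; exact: segment_compact.
  - move=> u [h0 h1] k; rewrite in_itv /=.
    have -> : u ord0 k = W u (enum_val k) by rewrite /W enum_valK.
    by rewrite h0 -h1 (bigD1 (enum_val k)) //= lerDl sumr_ge0.
have A0 : A !=set0.
  exists (U (fun i => (i == i0)%:R)); rewrite /A /= WU; split=> [i|]; first exact: ler0n.
  by rewrite (bigD1 i0)//= eqxx big1 ?addr0// => i /negPf ->.
have cf : continuous f.
  rewrite /f; under eq_fun do rewrite dotvE.
  apply: continuous_finsum => k.
  suff c1 : continuous (fun u : 'rV[R]_#|I| => (x - bary (W u)) 0 k).
    by move=> u; exact: (cvgM (c1 u) (c1 u)).
  have c2 : continuous (fun u : 'rV[R]_#|I| => \sum_i W u i * v i 0 k).
    apply: continuous_finsum => i u.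
    exact: (cvgM (cW i u) (cvg_cst (v i 0 k))).
  have -> : (fun u : 'rV[R]_#|I| => (x - bary (W u)) 0 k) =
      (fun u => x 0 k - \sum_i W u i * v i 0 k).
    by apply/funext => u; rewrite !mxE summxE; congr (_ - _); apply: eq_bigr => i _; rewrite mxE.
  move=> u; exact: (cvgB (cvg_cst (x 0 k)) (c2 u)).
have [u /set_mem uA umin] := compact_EVT_min A0 cA (continuous_subspaceT cf).
exists (W u) => // w' w'1.
have := umin (U w'); rewrite /f WU; apply; apply/mem_set.
by rewrite /A /= WU.
Qed.

End nearest_point.

Section cells.
Variables (R : realType) (n : nat) (I : finType) (v : I -> 'rV[R]_n).

(* [u] is an outer normal exposing exactly the face spanned by [S], and [h] is the value of the
   support function at [u]. *)
Definition normal_to (S : {set I}) (u : 'rV[R]_n) (h : R) :=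
  (forall i, i \in S -> dotv u (v i) = h) /\ (forall i, i \notin S -> dotv u (v i) < h).

(** The nearest point [bary v w] may lie on the boundary of the face; it is the normal [u], strictly
    smaller off [S], that singles out [S] and makes cells disjoint. *)
Definition cell (S : {set I}) (eps : R) : set 'rV[R]_n :=
  [set x | exists w u h, [/\ weights w, (forall i, i \notin S -> w i = 0), normal_to S u h,
                            dotv u u <= eps ^+ 2 & x = bary v w + u]].

Lemma dotv_subZ (u z : 'rV[R]_n) t :
  dotv (u - t *: z) (u - t *: z) = dotv u u - 2 * t * dotv u z + t ^+ 2 * dotv z z.
Proof. by rewrite dotvBl !dotvBr !dotvZl !dotvZr (dotvC z u); ring. Qed.

Lemma dotv_bary (u : 'rV[R]_n) w : dotv u (bary v w) = \sum_i w i * dotv u (v i).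
Proof. by rewrite dotv_sumr; apply: eq_bigr => i _; rewrite dotvZr. Qed.

Lemma normal_to_le S u h i : normal_to S u h -> dotv u (v i) <= h.
Proof.
move=> [h1 h2]; have [/h1->//|/h2/ltW//] := boolP (i \in S).
Qed.

Lemma normal_to_bary (S : {set I}) u h w : normal_to S u h -> weights w ->
  (forall i, i \notin S -> w i = 0) -> dotv u (bary v w) = h.
Proof.
move=> [h1 _] [_ w1] wS; rewrite dotv_bary -[RHS]mul1r -w1 mulr_suml.
apply: eq_bigr => i _; have [/h1->//|/wS->] := boolP (i \in S).
by rewrite !mul0r.
Qed.

Lemma dotv_bary_le S u h w : normal_to S u h -> weights w -> dotv u (bary v w) <= h.
Proof.
move=> Su [w0 w1]; rewrite dotv_bary -[h]mul1r -w1 mulr_suml.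
by apply: ler_sum => i _; apply: ler_wpM2l => //; exact: normal_to_le Su.
Qed.

Lemma cell_exists (i0 : I) (x : 'rV[R]_n) :
  exists w u h (S : {set I}), [/\ weights w, (forall i, i \notin S -> w i = 0), normal_to S u h &
                      x = bary v w + u].
Proof.
have [w w01 wmin] := nearest_point v i0 x.
pose u := x - bary v w; pose h := dotv u (bary v w).
have [w0 w1] := w01.
have uh i : dotv u (v i) <= h.
  rewrite leNgt; apply/negP => hi.
  pose z := v i - bary v w; pose e := dotv u z; pose K := dotv z z.
  have e0 : 0 < e by rewrite /e /z dotvBr subr_gt0.
  have K0 : 0 <= K by exact: dotv_ge0.
  have eK : 0 < e + K by lra.
  (* A step of length t towards [v i] changes the squared distance by t (t K - 2 e). This choice
     satisfies t <= 1 and t K < e, so the distance would decrease. *)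
  pose t := e / (e + K).
  have t0 : 0 < t by rewrite divr_gt0.
  have t1 : t <= 1 by rewrite ler_pdivrMr// mul1r; lra.
  pose w' j := (1 - t) * w j + t * (j == i)%:R.
  have w'01 : weights w'.
    split=> [j|]; first by rewrite addr_ge0// mulr_ge0//; lra.
    rewrite big_split /= -!mulr_sumr w1 (bigD1 i)//= eqxx big1 ?addr0 ?mulr1 ?subrK//.
    by move=> j /negPf->.
  have bw' : bary v w' = bary v w + t *: (v i - bary v w).
    rewrite /bary; under eq_bigr do rewrite scalerDl.
    rewrite big_split /=; under eq_bigr do rewrite -scalerA.
    rewrite -scaler_sumr [X in _ + X](_ : _ = t *: v i).
      by rewrite scalerBl scale1r scalerBr addrAC addrA.
    rewrite (bigD1 i)//= eqxx mulr1 big1 ?addr0// => j /negPf->.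
    by rewrite mulr0 scale0r.
  have := wmin _ w'01; rewrite bw' opprD addrA -/u -/z.
  rewrite dotv_subZ -/e -/K.
  have tE : t * (e + K) = e by rewrite divfK// gt_eqF.
  by nra.
(* Complementary slackness: the terms are nonnegative and sum to 0, so vertices of positive weight
   attain the maximum of [u]. *)
have wh i : w i * (h - dotv u (v i)) = 0.
  have H0 j : true -> 0 <= w j * (h - dotv u (v j)) by rewrite mulr_ge0// subr_ge0.
  have H1 : \sum_j w j * (h - dotv u (v j)) = 0.
    under eq_bigr do rewrite mulrBr.
    by rewrite sumrB -mulr_suml w1 mul1r -dotv_bary subrr.
  by have H := psumr_eq0P H0 H1; exact: H.
exists w, u, h, (finset (fun i => dotv u (v i) == h)); split=> //.
- move=> i; rewrite inE => hi; have /eqP := wh i.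
  by rewrite mulf_eq0 subr_eq0 [h == _]eq_sym (negPf hi) orbF => /eqP.
- split=> i; rewrite inE; first by move/eqP.
  by move=> hi; rewrite lt_neqAle hi uh.
- by rewrite addrC subrK.
Qed.

(** Monotonicity of the normal cone: u - u' is the opposite of the difference of the base points,
    and pairing the two shows that its squared norm is at most 0. *)
Lemma normal_unique (S S' : {set I}) u u' h h' w w' :
  weights w -> weights w' ->
  (forall i, i \notin S -> w i = 0) -> (forall i, i \notin S' -> w' i = 0) ->
  normal_to S u h -> normal_to S' u' h' -> bary v w + u = bary v w' + u' ->
  [/\ S = S', u = u' & bary v w = bary v w'].
Proof.
move=> w01 w'01 wS w'S uS u'S E.
have e1 := normal_to_bary uS w01 wS; have e2 := normal_to_bary u'S w'01 w'S.
have l1 := dotv_bary_le uS w'01; have l2 := dotv_bary_le u'S w01.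
have uu : u - u' = bary v w' - bary v w.
  by apply/eqP; rewrite subr_eq addrAC -E [bary v w + u]addrC addrK.
have : dotv (u - u') (u - u') = 0.
  apply/eqP; rewrite eq_le dotv_ge0 andbT {2}uu dotvBr !dotvBl; lra.
move=> /dotv_eq0 /eqP; rewrite subr_eq0 => /eqP uu'.
have bb : bary v w = bary v w'.
  by move: uu; rewrite uu' subrr => /esym/eqP; rewrite subr_eq0 => /eqP.
split=> //; move: e1 e2; rewrite uu' bb => hE h'E.
have hh : h = h' by rewrite -hE -h'E.
have SE T g : normal_to T u' g -> T = finset (fun i => dotv u' (v i) == g).
  move=> [T1 T2]; apply/setP => i; rewrite inE.
  by have [/T1->|/T2/lt_eqF->//] := boolP (i \in T); rewrite ?eqxx.
by rewrite (SE _ _ u'S) -hh; apply: SE; rewrite -uu'.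
Qed.

(** For p = [bary v w] and q in the hull, the squared distance from p + u to q is at least that of
    u, because p maximises [u] and the cross term is nonnegative. *)
Lemma edist_cell (S : {set I}) w u h : weights w -> (forall i, i \notin S -> w i = 0) ->
  normal_to S u h -> Defs.edist (bary v w + u) (conv_hull v) = enorm u.
Proof.
move=> w01 wS uS; rewrite /Defs.edist; set D := [set _ | _ in _].
have Du : D (enorm u).
  exists (bary v w); first by apply/conv_hullE; exists w.
  by rewrite addrAC subrr add0r.
have Dge y : D y -> enorm u <= y.
  move=> [q /conv_hullE[w' w'01 ->] <-]; apply: enorm_le.
  have -> : bary v w + u - bary v w' = u - (-1) *: (bary v w - bary v w').
    by rewrite scaleN1r opprK addrAC addrC.
  rewrite dotv_subZ; have := dotv_ge0 (bary v w - bary v w').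
  have : 0 <= dotv u (bary v w - bary v w').
    by rewrite dotvBr (normal_to_bary uS w01 wS) subr_ge0; exact: dotv_bary_le uS w'01.
  by lra.
apply/eqP; rewrite eq_le; apply/andP; split.
  by apply: ge_inf => //; exists (enorm u).
by apply: lb_le_inf => //; exists (enorm u).
Qed.

Lemma parallel_bodyE (i0 : I) eps : 0 <= eps ->
  parallel_body (conv_hull v) eps = \bigcup_(S in [set: {set I}]) cell S eps.
Proof.
move=> e0; have nE u : (enorm u <= eps) = (dotv u u <= eps ^+ 2).
  by rewrite /enorm -{1}(ger0_norm e0) -sqrtr_sqr ler_sqrt ?sqr_ge0.
apply/seteqP; split=> x.
  have [w [u [h [S [w01 wS uS ->]]]]] := cell_exists i0 x.
  rewrite /parallel_body /= (edist_cell w01 wS uS) nE => ue.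
  by exists S => //; exists w, u, h.
move=> [S _ [w [u [h [w01 wS uS ue ->]]]]].
by rewrite /parallel_body /= (edist_cell w01 wS uS) nE.
Qed.

Lemma trivIset_cell eps : trivIset setT (fun S => cell S eps).
Proof.
move=> S S' _ _ [x [[w [u [h [w01 wS uS _ ->]]]]]].
move=> [w' [u' [h' [w'01 w'S u'S _ E]]]].
by have [] := normal_unique w01 w'01 wS w'S uS u'S E.
Qed.

End cells.

(** * Determinant identities and volumes of orthogonal products *)

Section determinants.
Variable R : realType.

Lemma det_sylvester m k (X : 'M[R]_(m, k)) (Y : 'M[R]_(k, m)) :
  \det (1%:M + X *m Y) = \det (1%:M + Y *m X).
Proof.
have e1 : block_mx 1%:M (- X) Y 1%:M =
    block_mx 1%:M 0 Y 1%:M *m block_mx 1%:M (- X) 0 (1%:M + Y *m X).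
  by rewrite mulmx_block !mul0mx !mulmx0 !mul1mx !mulmx1 !addr0 mulmxN addrCA addNr addr0.
have e2 : block_mx 1%:M (- X) Y 1%:M =
    block_mx (1%:M + X *m Y) (- X) 0 1%:M *m block_mx 1%:M 0 Y 1%:M.
  by rewrite mulmx_block !mul0mx !mulmx0 !mul1mx !mulmx1 !add0r mulNmx addrK.
have := congr1 determinant e1; rewrite {1}e2 !det_mulmx !det_lblock !det_ublock !det1.
by rewrite !mul1r !mulr1.
Qed.

Lemma det_block_1r m (a : R) (b : 'rV[R]_m) (c : 'cV[R]_m) :
  \det (block_mx a%:M b c 1%:M : 'M[R]_(1 + m)) = a - (b *m c) 0 0.
Proof.
have -> : block_mx a%:M b c 1%:M = block_mx (a%:M - b *m c) b 0 1%:M *m block_mx 1%:M 0 c 1%:M.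
  by rewrite mulmx_block !mul0mx !mulmx0 !mul1mx !mulmx1 !add0r subrK.
rewrite det_mulmx det_ublock det_lblock !det1 !mulr1 det_mx11.
by rewrite !mxE eqxx.
Qed.

Lemma leb_affine n (L : 'M[R]_n) (b : 'rV[R]_n) (S : set 'rV[R]_n) :
  \det L != 0 -> measurable S ->
  leb R n S = (`|\det L|%:E * leb R n [set x | S (x *m L + b)%R])%E.
Proof.
move=> L0 mS; rewrite -(leb_shift b mS) (leb_mulmx L0)//.
exact: measurable_preimage_shift.
Qed.

(** The Jacobian is the determinant of the stacked rows; its square is the determinant of their Gram
    matrix, block diagonal by orthogonality. *)
Lemma leb_orthogonal_product n m k (A : 'M[R]_(m, n)) (B : 'M[R]_(k, n)) (c : 'rV[R]_n)
    (X : set 'rV[R]_m) (Y : set 'rV[R]_k) (S : set 'rV[R]_n) :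
  n = (m + k)%N -> A *m B^T = 0 -> A *m A^T \in unitmx -> B *m B^T \in unitmx ->
  measurable X -> measurable Y -> measurable S ->
  (forall w t, S (c + w *m A + t *m B) <-> X w /\ Y t) ->
  leb R n S = ((Num.sqrt (\det (A *m A^T) * \det (B *m B^T)))%:E * (leb R m X * leb R k Y))%E.
Proof.
move=> e; subst n => AB uA uB mX mY mS SE.
pose T := col_mx A B.
have BA : B *m A^T = 0 by have := congr1 trmx AB; rewrite trmx_mul trmxK trmx0.
have TT : \det T ^+ 2 = \det (A *m A^T) * \det (B *m B^T).
  rewrite expr2 -{2}(det_tr T) -det_mulmx tr_col_mx mul_col_row AB BA.
  by rewrite det_lblock.
have T0 : \det T != 0.
  by rewrite -sqrf_eq0 TT mulf_neq0// -unitfE -unitmxE.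
rewrite (leb_affine c T0 mS) -TT sqrtr_sqr; congr (_ * _)%E.
have xT x : x *m T = lsubmx x *m A + rsubmx x *m B by rewrite -{1}(hsubmxK x) mul_row_col.
rewrite -leb_prod//; congr (leb R _ _); apply/seteqP; split=> x /=;
  rewrite xT addrC addrA; first by move/SE.
by move=> h; apply/SE.
Qed.

End determinants.

(** * Cells of simplicial faces *)

Section face.
Variables (R : realType) (n : nat) (I : finType) (v : I -> 'rV[R]_n).
Variables (m : nat) (q : 'I_m.+1 -> I).
Hypothesis q_inj : injective q.

Definition face : {set I} := finset (fun i => i \in codom q).

Definition edges : 'M[R]_(m, n) := \matrix_(i, j) (v (q (lift ord0 i)) - v (q ord0)) 0 j.

Lemma row_edges i : row i edges = v (q (lift ord0 i)) - v (q ord0).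
Proof. by apply/rowP => j; rewrite !mxE. Qed.

Lemma mem_face i : (i \in face) = [exists j, q j == i].
Proof.
rewrite inE; apply/idP/existsP => [/codomP[j ->]|[j /eqP <-]]; first by exists j.
exact: codom_f.
Qed.

(** Extension by zero from the face to all vertices, written as a sum so that totals and barycentres
    follow by exchanging summations. *)
Definition spread (w : 'I_m.+1 -> R) (i : I) := \sum_j (q j == i)%:R * w j.

Lemma spread_q w j : spread w (q j) = w j.
Proof.
rewrite /spread (bigD1 j)//= eqxx mul1r big1 ?addr0// => k kj.
by rewrite (inj_eq q_inj) (negPf kj) mul0r.
Qed.

Lemma spread_notin w i : i \notin face -> spread w i = 0.
Proof.
rewrite mem_face negb_exists => /forallP iN; rewrite /spread big1// => j _.
by rewrite (negPf (iN j)) mul0r.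
Qed.

Lemma spread_restrict (w : I -> R) : (forall i, i \notin face -> w i = 0) ->
  w = spread (w \o q).
Proof.
move=> wS; apply/funext => i; have [|iN] := boolP (i \in face).
  by rewrite mem_face => /existsP[j /eqP <-]; rewrite spread_q.
by rewrite wS// spread_notin.
Qed.

Lemma sum_spread w : \sum_i spread w i = \sum_j w j.
Proof.
rewrite exchange_big /=; apply: eq_bigr => j _.
rewrite (bigD1 (q j))//= eqxx mul1r big1 ?addr0// => i.
by rewrite eq_sym => /negPf ->; rewrite mul0r.
Qed.

Lemma bary_spread w : bary v (spread w) = \sum_j w j *: v (q j).
Proof.
rewrite /bary; under eq_bigr do rewrite scaler_suml.
rewrite exchange_big /=; apply: eq_bigr => j _.
rewrite (bigD1 (q j))//= eqxx mul1r big1 ?addr0// => i.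
by rewrite eq_sym => /negPf ->; rewrite mul0r scale0r.
Qed.

Lemma bary_edges w : \sum_j w j = 1 ->
  \sum_j w j *: v (q j) = v (q ord0) + (\row_i w (lift ord0 i)) *m edges.
Proof.
move=> w1; rewrite mulmx_sum_row big_ord_recl; have := w1; rewrite big_ord_recl.
move=> /(congr1 (fun a => a - \sum_(i < m) w (lift ord0 i))); rewrite addrK => ->.
rewrite scalerBl scale1r scaler_suml -addrA; congr (_ + _).
under [in RHS]eq_bigr do rewrite row_edges mxE scalerBr.
by rewrite sumrB addrC.
Qed.

Definition unit_simplex : set 'rV[R]_m :=
  [set w | (forall i, 0 <= w 0 i) /\ \sum_i w 0 i <= 1].

Lemma unit_simplex_face (w : 'rV[R]_m) : unit_simplex w <->
  exists w' : I -> R, [/\ weights w', (forall i, i \notin face -> w' i = 0) &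
     v (q ord0) + w *m edges = bary v w' /\ forall i, w 0 i = w' (q (lift ord0 i))].
Proof.
split=> [[w0 w1]|[w' [[w'0 w'1] w'S [_ ww']]]].
  pose w' j := if unlift ord0 j is Some i then w 0 i else 1 - \sum_i w 0 i.
  have sw' : \sum_j w' j = 1.
    rewrite big_ord_recl /w' unlift_none [X in _ + X](eq_bigr (fun i => w 0 i)) ?subrK//.
    by move=> i _; rewrite liftK.
  exists (spread w'); split.
  - split; last by rewrite sum_spread.
    move=> i; apply: sumr_ge0 => j _; rewrite mulr_ge0// /w'.
    by case: (unlift _ _) => [k|]; [exact: w0|rewrite subr_ge0].
  - exact: spread_notin.
  - split; last by move=> i; rewrite spread_q /w' liftK.
    rewrite bary_spread bary_edges//; congr (_ + _ *m _).
    by apply/rowP => i; rewrite mxE /w' liftK.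
split=> [i|]; first by rewrite ww'.
move: w'1; rewrite (spread_restrict w'S) sum_spread big_ord_recl => <-.
under eq_bigr do rewrite ww'.
by rewrite lerDr /=.
Qed.

Definition outward (u : 'rV[R]_n) :=
  forall i, i \notin face -> dotv u (v i) < dotv u (v (q ord0)).

Lemma dotv_edges (u : 'rV[R]_n) : u *m edges^T = 0 <->
  forall j, dotv u (v (q j)) = dotv u (v (q ord0)).
Proof.
have E i : (u *m edges^T) 0 i = dotv u (v (q (lift ord0 i))) - dotv u (v (q ord0)).
  by rewrite -dotvBr -row_edges /dotv !mxE; apply: eq_bigr => k _; rewrite !mxE.
split=> [u0 j|H].
  have [i ->|->//] := unliftP ord0 j.
  by apply/eqP; rewrite -subr_eq0 -E u0 mxE.
by apply/rowP => i; rewrite E H subrr mxE.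
Qed.

Lemma normal_to_face u h : normal_to v face u h <->
  [/\ u *m edges^T = 0, outward u & h = dotv u (v (q ord0))].
Proof.
have q0 j : q j \in face by rewrite mem_face; apply/existsP; exists j.
split=> [[h1 h2]|[u0 uO ->]].
  split; last by rewrite h1.
    by apply/dotv_edges => j; rewrite !h1.
  by move=> i /h2; rewrite -(h1 _ (q0 ord0)).
split=> [i|i]; last exact: uO.
by rewrite mem_face => /existsP[j /eqP <-]; move/dotv_edges: u0.
Qed.

Lemma cell_faceE eps : cell v face eps = [set x | exists (w : 'rV[R]_m) (u : 'rV[R]_n),
  [/\ unit_simplex w, u *m edges^T = 0, outward u, dotv u u <= eps ^+ 2 &
      x = v (q ord0) + w *m edges + u]].
Proof.
apply/seteqP; split=> x.
  move=> [w [u [h [w01 wS /normal_to_face[u0 uO _] ue ->]]]].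
  have wE := spread_restrict wS; have [w0 w1] := w01.
  have w1' : \sum_j (w \o q) j = 1 by rewrite -sum_spread -wE.
  exists (\row_i w (q (lift ord0 i))), u; split=> //.
    apply/unit_simplex_face; exists w; split=> //; split; last by move=> i; rewrite mxE.
    by rewrite [in RHS]wE bary_spread bary_edges.
  by rewrite [in LHS]wE bary_spread bary_edges.
move=> [w [u [/unit_simplex_face[w' [w'01 w'S [wE _]]] u0 uO ue ->]]].
exists w', u, (dotv u (v (q ord0))); split=> //; last by rewrite wE.
exact/normal_to_face.
Qed.

Hypothesis edges_unit : edges *m edges^T \in unitmx.

(** A right inverse of [edges]: it reads off the edge coordinates of a point, while [Pn] is the
    orthogonal projection onto the normal space. *)
Let M : 'M[R]_(n, m) := edges^T *m invmx (edges *m edges^T).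
Let Pn : 'M[R]_n := 1%:M - M *m edges.

Let AM : edges *m M = 1%:M.
Proof. by rewrite mulmxA mulmxV. Qed.

Let APn : edges *m Pn = 0.
Proof. by rewrite mulmxBr mulmx1 mulmxA AM mul1mx subrr. Qed.

Let PnA : Pn *m edges^T = 0.
Proof.
rewrite mulmxBl mul1mx -mulmxA -[M *m (_ *m _)]mulmxA.
by rewrite mulVmx// mulmx1 subrr.
Qed.

(** The existential quantifiers of [cell] are replaced by conditions on linear images of x, from
    which measurability and scaling can be read. *)
Lemma cell_face_coord eps : cell v face eps = [set x |
  [/\ unit_simplex ((x - v (q ord0)) *m M), outward ((x - v (q ord0)) *m Pn) &
      dotv ((x - v (q ord0)) *m Pn) ((x - v (q ord0)) *m Pn) <= eps ^+ 2]].
Proof.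
rewrite cell_faceE; apply/seteqP; split=> x /=.
  move=> [w [u [w01 u0 uO ue ->]]].
  have uM : u *m M = 0 by rewrite mulmxA u0 mul0mx.
  have -> : v (q ord0) + w *m edges + u - v (q ord0) = w *m edges + u.
    by rewrite addrAC [v (q ord0) + _]addrC addrK.
  have -> : (w *m edges + u) *m M = w by rewrite mulmxDl uM -mulmxA AM mulmx1 addr0.
  have -> : (w *m edges + u) *m Pn = u.
    by rewrite mulmxDl -mulmxA APn mulmx0 add0r mulmxBr mulmx1 mulmxA uM mul0mx subr0.
  by [].
move=> [w01 uO ue]; set y := x - _ in w01 uO ue *.
exists (y *m M), (y *m Pn); split=> //; first by rewrite -mulmxA PnA mulmx0.
by rewrite mulmxBr mulmx1 -mulmxA -addrA [X in _ + X]addrC subrK addrC subrK.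
Qed.

Lemma measurable_dotv (f g : 'rV[R]_n -> 'rV[R]_n) :
  measurable_fun setT f -> measurable_fun setT g ->
  measurable_fun setT (fun x => dotv (f x) (g x)).
Proof.
move=> mf mg; under eq_fun do rewrite dotvE.
apply: measurable_sum => k; apply: measurable_funM;
  by apply: (measurableT_comp (measurable_coord k)).
Qed.

Lemma measurable_unit_simplex : measurable unit_simplex.
Proof. exact: measurable_ge0_sum_le. Qed.

Lemma measurable_outward : measurable [set u | outward u].
Proof.
rewrite (_ : [set _ | _] = \bigcap_(i in [set i | i \notin face])
    [set u | dotv u (v i) < dotv u (v (q ord0))]); last by apply/seteqP; split=> u.
apply: fin_bigcap_measurable => // i _.
by apply: measurable_set_lt; apply: measurable_dotv.
Qed.

Lemma measurable_cell eps : measurable (cell v face eps).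
Proof.
rewrite cell_face_coord.
pose b k (N : 'M[R]_(n, k)) x := x *m N + (- v (q ord0)) *m N.
have bE k (N : 'M[R]_(n, k)) x : (x - v (q ord0)) *m N = b k N x by rewrite mulmxDl.
have mb k (N : 'M[R]_(n, k)) : measurable_fun setT (b k N) by exact: measurable_affine.
rewrite (_ : [set _ | _] = (b m M @^-1` unit_simplex) `&` (b n Pn @^-1` [set u | outward u])
   `&` [set x | dotv (b n Pn x) (b n Pn x) <= eps ^+ 2]); last first.
  by apply/seteqP; split=> x /=; rewrite !bE; [case|case=> -[]].
apply: measurableI; last by apply: measurable_set_le => //; exact: measurable_dotv.
apply: measurableI; rewrite -[X in measurable X]setTI; apply: mb => //.
  exact: measurable_unit_simplex.
exact: measurable_outward.
Qed.

(** The map [L] fixes the edge directions and stretches the normal ones by lam, so it carries the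
    cell of radius 1 onto that of radius lam; Sylvester's identity gives its determinant. *)
Lemma leb_cell_scale (lam : R) : 0 < lam -> (m <= n)%N ->
  leb R n (cell v face lam) = ((lam ^+ (n - m))%:E * leb R n (cell v face 1))%E.
Proof.
move=> l0 mn; pose L := M *m edges + lam *: Pn.
have LE : L = lam *: (1%:M + (lam^-1 - 1) *: M *m edges).
  rewrite scalerDr -scalemxAl scalerA mulrBr mulfV ?gt_eqF// mulr1 scalerBl scale1r.
  by rewrite /L /Pn scalerBr addrCA.
have dL : \det L = lam ^+ (n - m).
  rewrite LE detZ det_sylvester -scalemxAr AM -[1%:M in X in X + _]scale1r -scalerDl.
  rewrite addrCA subrr addr0 scale_scalar_mx mulr1 det_scalar exprVn.
  by rewrite -{1}(subnK mn) exprD mulfK// expf_neq0// gt_eqF.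
rewrite (@leb_affine _ _ L (v (q ord0) - v (q ord0) *m L)).
- rewrite dL ger0_norm ?exprn_ge0 ?ltW//; congr (_ * leb R n _)%E.
  have LM : L *m M = M.
    rewrite mulmxDl -mulmxA AM mulmx1 -scalemxAl mulmxBl mul1mx -mulmxA AM mulmx1.
    by rewrite subrr scaler0 addr0.
  have LP : L *m Pn = lam *: Pn.
    rewrite mulmxDl -mulmxA APn mulmx0 add0r -scalemxAl [Pn *m Pn]mulmxBl mul1mx -mulmxA APn.
    by rewrite mulmx0 subr0.
  have E x : x *m L + (v (q ord0) - v (q ord0) *m L) - v (q ord0) = (x - v (q ord0)) *m L.
    by rewrite -addrA [v _ - _ - _]addrAC subrr add0r mulmxBl.
  rewrite !cell_face_coord; apply/seteqP; split=> x /=; rewrite E;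
    move: (x - _) => y; rewrite -!(mulmxA y) LM LP -scalemxAr;
    move: (y *m Pn) => u [w01 uO ue]; split=> //.
  - by move=> i /uO; rewrite !dotvZl ltr_pM2l.
  - by move: ue; rewrite expr1n dotvZl dotvZr mulrA -expr2 -{2}[lam ^+ 2]mulr1 ler_pM2l ?exprn_gt0.
  - by move=> i /uO; rewrite !dotvZl ltr_pM2l.
  - by move: ue; rewrite expr1n dotvZl dotvZr mulrA -expr2 -{2}[lam ^+ 2]mulr1 ler_pM2l ?exprn_gt0.
- by rewrite dL expf_neq0// gt_eqF.
- exact: measurable_cell.
Qed.

Lemma leb_cell_prod k (B : 'M[R]_(k, n)) (Y : set 'rV[R]_k) : n = (m + k)%N ->
  edges *m B^T = 0 -> B *m B^T \in unitmx -> measurable Y ->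
  (forall t, Y t <-> outward (t *m B) /\ dotv (t *m B) (t *m B) <= 1) ->
  leb R n (cell v face 1) =
  ((Num.sqrt (\det (edges *m edges^T) * \det (B *m B^T)) / m`!%:R)%:E * leb R k Y)%E.
Proof.
move=> e AB uB mY YE; have BA : B *m edges^T = 0 by have := congr1 trmx AB; rewrite trmx_mul trmxK trmx0.
rewrite (leb_orthogonal_product (c := v (q ord0)) e AB edges_unit uB
  measurable_unit_simplex mY (measurable_cell 1)).
  by rewrite leb_simplex ?ler01// expr1n div1r [in RHS]EFinM -muleA.
move=> w t; rewrite cell_faceE /=; split=> [[w' [u [w01 u0 uO ue E]]]|[w01 /YE[uO ue]]].
  have E1 : w *m edges + t *m B = w' *m edges + u.
    by apply: (addrI (v (q ord0))); rewrite !addrA.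
  have ww : w = w'.
    have : (w *m edges + t *m B) *m M = (w' *m edges + u) *m M by rewrite E1.
    rewrite !mulmxDl -!mulmxA AM !mulmx1.
    rewrite [B *m M]mulmxA BA mul0mx mulmx0 addr0.
    by rewrite [u *m M]mulmxA u0 mul0mx addr0.
  move: E1; rewrite ww => /addrI tu; split=> //; apply/YE; rewrite tu.
  by split=> //; move: ue; rewrite expr1n.
by exists w, (t *m B); split=> //; rewrite ?expr1n// -mulmxA BA mulmx0.
Qed.

End face.

Lemma face_enum (I : finType) (S : {set I}) : S != finset.set0 ->
  exists m (q : 'I_m.+1 -> I), [/\ injective q, face q = S & #|S| = m.+1].
Proof.
move=> S0; have cS : #|S| = #|S|.-1.+1 by rewrite prednK// card_gt0.
exists #|S|.-1, (fun j => enum_val (cast_ord (esym cS) j)); split=> //.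
  by move=> i j /enum_val_inj /cast_ord_inj.
apply/setP => i; rewrite mem_face; apply/existsP/idP => [[j /eqP <-]|iS].
  exact: enum_valP.
by exists (cast_ord cS (enum_rank_in iS i)); rewrite cast_ordK enum_rankK_in.
Qed.

(** * The complementarity polytope *)

Section block_simplex.
Variables (R : realType) (d n : nat) (J : finType).
Variable v : J * 'I_d -> 'rV[R]_n.
Hypothesis d_gt0 : (0 < d)%N.
Hypothesis gram : forall i j, dotv (v i) (v j) = (i == j)%:R - (i.1 == j.1)%:R / d%:R.

Section one_face.
Variables (m : nat) (q : 'I_m.+1 -> J * 'I_d).
Hypothesis q_inj : injective q.

Definition occ (r : J) : nat := \sum_(j < m.+1) ((q j).1 == r).

Hypothesis occ_lt : forall r, (occ r < d)%N.

Let D : R := d%:R.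
Let D0 : D != 0. Proof. by rewrite pnatr_eq0 -lt0n. Qed.

Let occR r : (occ r)%:R = \sum_(j < m.+1) ((q j).1 == r)%:R :> R.
Proof. by rewrite natr_sum. Qed.

Let occ_pos r : 0 < D - (occ r)%:R :> R.
Proof. by rewrite subr_gt0 ltr_nat. Qed.

(* The weights for which [h] below has inner product 1 with every vertex of the face. *)
Let mu (i : 'I_m.+1) : R := D / (D - (occ (q i).1)%:R).

Lemma sum_occ (F : J -> R) : \sum_(j < m.+1) F (q j).1 = \sum_r (occ r)%:R * F r.
Proof.
under [RHS]eq_bigr do rewrite occR mulr_suml.
rewrite exchange_big /=; apply: eq_bigr => j _.
rewrite (bigD1 (q j).1)//= eqxx mul1r big1 ?addr0// => r.
by rewrite eq_sym => /negPf ->; rewrite mul0r.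
Qed.

Let h : 'rV[R]_n := \sum_j mu j *: v (q j).

Let dotv_h j : dotv h (v (q j)) = 1.
Proof.
rewrite dotv_suml; under eq_bigr do rewrite dotvZl gram mulrBr.
rewrite sumrB (bigD1 j)//= eqxx mulr1 big1 ?addr0; last first.
  by move=> i /negPf ij; rewrite (inj_eq q_inj) ij mulr0.
under eq_bigr do rewrite mulrA.
rewrite -mulr_suml [X in X / _](_ : _ = mu j * (occ (q j).1)%:R).
  by rewrite /mu -/D; have := occ_pos (q j).1 => h0; field; rewrite D0 gt_eqF.
rewrite occR mulr_sumr; apply: eq_bigr => i _.
by have [e|] := eqVneq; rewrite ?mulr0// /mu e.
Qed.

Let sigma := \sum_r (occ r)%:R * (D / (D - (occ r)%:R)).

Let sigmaE : sigma = \sum_j mu j.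
Proof. by rewrite /mu (sum_occ (fun r => D / (D - (occ r)%:R))). Qed.

Let sigma_gt0 : 0 < sigma.
Proof.
have mu0 i : 0 < mu i by rewrite divr_gt0// lt0r D0 ler0n.
by rewrite sigmaE big_ord_recl ltr_pwDl// sumr_ge0// => i _; exact: ltW.
Qed.

Let V0 := v (q ord0).
Let V' : 'M[R]_(m, n) := \matrix_(i, j) v (q (lift ord0 i)) 0 j.
Let V : 'M[R]_(1 + m, n) := col_mx V0 V'.

Let VE (i : 'I_(1 + m)) j : V i j = v (q i) 0 j.
Proof.
rewrite /V; case: (split_ordP i) => k ->.
  by rewrite col_mxEu ord1; congr (v (q _) 0 j); exact/val_inj.
by rewrite col_mxEd mxE; congr (v (q _) 0 j); exact/val_inj.
Qed.

Let incidence : 'M[R]_(1 + m, #|J|) := \matrix_(i, r) ((q i).1 == enum_val r)%:R.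

Let gramV : V *m V^T = 1%:M + (- D^-1 *: incidence) *m incidence^T.
Proof.
apply/matrixP => i j; rewrite [LHS]mxE.
transitivity (dotv (v (q i)) (v (q j))).
  by rewrite dotvE; apply: eq_bigr => k _; rewrite [V^T _ _]mxE !VE.
rewrite gram !mxE (inj_eq q_inj); congr (_ + _).
rewrite (bigD1 (enum_rank (q i).1))//= !mxE enum_rankK eqxx mulr1.
rewrite [(q j).1 == _]eq_sym big1 ?addr0; first by rewrite mulNr mulrC.
move=> r rN; rewrite !mxE [_ == enum_val r](_ : _ = false) ?mulr0 ?mul0r//.
by apply/negP => /eqP qr; move/negP: rN; apply; rewrite qr enum_valK.
Qed.

Lemma det_gram_face : \det (V *m V^T) = \prod_r (1 - (occ r)%:R / D).
Proof.
(* The reversed product of incidence matrices is indexed by the simplices; it is diagonal because a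
   vertex belongs to only one simplex, and its entries count the vertices of the face. *)
rewrite gramV det_sylvester -scalemxAr.
rewrite (_ : _ + _ = diag_mx (\row_r (1 - (occ (enum_val r))%:R / D))).
  rewrite det_diag (reindex (@enum_val J J)) /=; last first.
    by apply: onW_bij; exact: enum_val_bij.
  by apply: eq_bigr => r _; rewrite mxE.
apply/matrixP => r s; rewrite !mxE.
have [<-|rs] := eqVneq r s.
  rewrite !mulr1n occR mulNr [in RHS]mulrC; congr (_ - _ * _).
  by apply: eq_bigr => i _; rewrite !mxE -natrM mulnb andbb.
rewrite !mulr0n add0r big1 ?mulr0// => i _; rewrite !mxE -natrM mulnb.
case: eqP => // e1; case: eqP => // e2; move/eqP: rs => []; apply: enum_val_inj.
by rewrite -e1.
Qed.

(** The vector [h] is orthogonal to all edges and has squared norm [sigma]. The matrix [L], also of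
    determinant [sigma], turns the vertices into [h] and the edges; comparing Gram determinants,
    sigma^2 times that of the vertices is sigma times that of the edges. *)
Lemma det_edges_face : \det (edges v q *m (edges v q)^T) =
  \prod_r (1 - (occ r)%:R / D) * \sum_r (occ r)%:R * (D / (D - (occ r)%:R)).
Proof.
set A := edges v q.
pose mu' : 'rV[R]_m := \row_i mu (lift ord0 i).
pose L : 'M[R]_(1 + m) := block_mx (mu ord0)%:M mu' (- const_mx 1) 1%:M.
have hE : (mu ord0)%:M *m V0 + mu' *m V' = h.
  rewrite /h big_ord_recl mul_scalar_mx; congr (_ + _).
  rewrite mulmx_sum_row; apply: eq_bigr => i _; rewrite mxE; congr (_ *: _).
  by apply/rowP => j; rewrite !mxE.
have AE : - const_mx 1 *m V0 + 1%:M *m V' = A.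
  rewrite mul1mx mulNmx addrC; apply/matrixP => i j.
  by rewrite !mxE big_ord1 !mxE mul1r.
have LV : L *m V = col_mx h A by rewrite mul_block_col hE AE.
have hA : h *m A^T = 0 by apply/dotv_edges => j; rewrite !dotv_h.
have Ah : A *m h^T = 0 by have := congr1 trmx hA; rewrite trmx_mul trmxK trmx0.
have hh : h *m h^T = sigma%:M.
  rewrite [LHS]mx11_scalar -/(dotv h h) sigmaE {2}/h dotv_sumr.
  by congr (_%:M); apply: eq_bigr => j _; rewrite dotvZr dotv_h mulr1.
have dL : \det L = sigma.
  rewrite det_block_1r mulmxN mxE opprK sigmaE big_ord_recl; congr (_ + _).
  by rewrite mxE; apply: eq_bigr => i _; rewrite !mxE mulr1.
have : \det ((L *m V) *m (L *m V)^T) = sigma * \det (A *m A^T).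
  by rewrite LV tr_col_mx mul_col_row hA Ah hh det_lblock det_scalar1.
have -> : (L *m V) *m (L *m V)^T = L *m (V *m V^T) *m L^T by rewrite trmx_mul !mulmxA.
rewrite (det_mulmx _ L^T) (det_mulmx L) det_tr dL det_gram_face => E.
by apply: (mulfI (lt0r_neq0 sigma_gt0)); rewrite -E /sigma; ring.
Qed.

Lemma det_edges_face_gt0 : 0 < \det (edges v q *m (edges v q)^T).
Proof.
rewrite det_edges_face mulr_gt0//; apply: prodr_gt0 => r _.
by rewrite subr_gt0 ltr_pdivrMr ?mul1r ?ltr_nat// ltr0n.
Qed.

Lemma edges_face_unit : edges v q *m (edges v q)^T \in unitmx.
Proof. by rewrite unitmxE unitfE gt_eqF// det_edges_face_gt0. Qed.

Lemma face_spanning (u : 'rV[R]_n) : n = m.+1 -> (forall j, dotv u (v (q j)) = 0) -> u = 0.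
Proof.
move=> nm uv; have uV : u *m V^T = 0.
  apply/rowP => j; rewrite [RHS]mxE -(uv j) dotvE mxE.
  by apply: eq_bigr => k _; rewrite [V^T _ _]mxE VE.
have Vu : V *m V^T \in unitmx.
  rewrite unitmxE unitfE det_gram_face gt_eqF//; apply: prodr_gt0 => r _.
  by rewrite subr_gt0 ltr_pdivrMr ?mul1r ?ltr_nat// ltr0n.
have Vf : row_full V.
  rewrite /row_full eqn_leq rank_leq_col /= (leq_trans _ (mxrankM_maxl V V^T))//.
  by rewrite (mxrank_unit Vu) nm.
have /row_fullP[W WV] := Vf.
by rewrite -[u]mulmx1 -[1%:M]trmx1 -WV trmx_mul mulmxA uV mul0mx.
Qed.

End one_face.

End block_simplex.

Section simplex_join.
Variables (R : realType) (d n : nat) (J : finType).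
Variable v : J * 'I_d -> 'rV[R]_n.
Hypothesis d_gt1 : (1 < d)%N.
Hypothesis J_gt0 : (0 < #|J|)%N.
Hypothesis nE : n = (#|J| * d.-1)%N.
Hypothesis gram : forall i j, dotv (v i) (v j) = (i == j)%:R - (i.1 == j.1)%:R / d%:R.

Let d_gt0 : (0 < d)%N. Proof. exact: ltnW. Qed.
Let D0 : d%:R != 0 :> R. Proof. by rewrite pnatr_eq0 -lt0n. Qed.

Definition missing (S : {set J * 'I_d}) (r : J) : {set 'I_d} :=
  finset (fun k => (r, k) \notin S).

Definition proper_face (S : {set J * 'I_d}) :=
  (S != finset.set0) && [forall r, missing S r != finset.set0].

Lemma occ_missing m (q : 'I_m.+1 -> J * 'I_d) r : injective q ->
  (occ q r + #|missing (face q) r| = d)%N.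
Proof.
move=> q_inj; rewrite -[RHS](card_ord d) -(cardsC (missing (face q) r)) addnC.
congr (_ + _)%N; rewrite /occ -sum1_card.
transitivity (\sum_(k < d) \sum_(j < m.+1) (q j == (r, k)))%N.
  rewrite exchange_big /=; apply: eq_bigr => j _.
  case: (q j) => r' k' /=; rewrite (bigD1 k')//= xpair_eqE eqxx andbT big1 ?addn0// => k.
  by rewrite xpair_eqE eq_sym => /negPf ->; rewrite andbF.
rewrite [RHS]big_mkcond; apply: eq_bigr => k _ /=; rewrite !inE negbK.
case: ifPn => [/codomP[j e]|kN].
  rewrite (bigD1 j)//= e eqxx big1 ?addn0// => i /negPf ij.
  by rewrite (inj_eq q_inj) ij.
rewrite big1// => j _; case: eqP => // e; move/negP: kN => []; rewrite -e.
exact: codom_f.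
Qed.

Lemma occ_lt m (q : 'I_m.+1 -> J * 'I_d) r : injective q -> proper_face (face q) ->
  (occ q r < d)%N.
Proof.
move=> q_inj /andP[_ /forallP /(_ r)]; rewrite -card_gt0 => m0.
by rewrite -[X in (_ < X)%N](occ_missing r q_inj) -[X in (X < _)%N]addn0 ltn_add2l.
Qed.

Lemma sum_occ_card m (q : 'I_m.+1 -> J * 'I_d) : (\sum_r occ q r)%N = m.+1.
Proof.
rewrite exchange_big /= -[RHS]card_ord -sum1_card; apply: eq_bigr => j _.
rewrite (bigD1 (q j).1)//= eqxx big1 ?addn0// => r.
by rewrite eq_sym => /negPf ->.
Qed.

Lemma proper_face_card m (q : 'I_m.+1 -> J * 'I_d) : injective q -> proper_face (face q) ->
  (m < n)%N.
Proof.
move=> q_inj pS; rewrite -(sum_occ_card q) nE -sum_nat_const.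
by apply: leq_sum => r _; rewrite -ltnS prednK// occ_lt.
Qed.

(** That each simplex is centred follows from the inner products: the sum has squared norm 0. *)
Lemma block_sum r : \sum_(k < d) v (r, k) = 0.
Proof.
apply: dotv_eq0; rewrite dotv_suml big1// => k _; rewrite dotv_sumr.
under eq_bigr do rewrite gram /= eqxx xpair_eqE eqxx /=.
rewrite sumrB (bigD1 k)//= eqxx big1 ?addr0; last by move=> l /negPf; rewrite eq_sym => ->.
by rewrite sumr_const card_ord -[X in _ - X]mulr_natr div1r mulVf// subrr.
Qed.

(** Dropping one vertex from every simplex leaves n vertices with nonsingular Gram matrix, hence a
    basis. *)
Lemma spanning (u : 'rV[R]_n) : (forall i, dotv u (v i) = 0) -> u = 0.
Proof.
move=> uv; pose k0 : 'I_d := Ordinal d_gt0.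
pose S : {set J * 'I_d} := finset (fun i => i.2 != k0).
have cS : #|S| = n.
  rewrite nE (_ : S = finset.setX [set: J]%SET (~: [set k0])%SET).
    by rewrite cardsX cardsT cardsC1 card_ord.
  by apply/setP => i; rewrite !inE.
have S0 : S != finset.set0.
  by rewrite -card_gt0 cS nE muln_gt0 J_gt0 -subn1 subn_gt0.
have [m [q [q_inj qS cSm]]] := face_enum S0.
apply: (face_spanning d_gt0 gram q_inj) => // [r|]; last by rewrite -cS cSm.
apply: occ_lt => //; rewrite /proper_face qS S0 /=; apply/forallP => s.
by apply/set0Pn; exists k0; rewrite !inE negbK.
Qed.

Lemma normal_full u h : normal_to v [set: J * 'I_d]%SET u h -> u = 0.
Proof.
move=> [u1 _]; have [r0 _] : exists r : J, r \in J by apply/card_gt0P.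
have h0 : h = 0.
  have : \sum_(l < d) dotv u (v (r0, l)) = 0 by rewrite -dotv_sumr block_sum dotvC dotv0l.
  rewrite (eq_bigr (fun=> h)) => [|l _]; last by rewrite u1 ?inE.
  rewrite sumr_const card_ord -mulr_natr => /eqP.
  by rewrite mulf_eq0 (negPf D0) orbF => /eqP.
by apply: spanning => i; rewrite u1 ?inE.
Qed.

(** If [S] contains a whole simplex, the common value h is 0, since the vertices of that simplex sum
    to 0. All values are then at most 0, yet sum to 0 over every simplex, so none can be strictly
    negative. *)
Lemma cell_improper S eps : S != [set: J * 'I_d]%SET -> ~~ proper_face S ->
  cell v S eps = set0.
Proof.
move=> ST; rewrite negb_and negbK => /orP[/eqP S0|].
  apply/seteqP; split=> x //= [w [_ [_ [[_ w1] wS _ _ _]]]].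
  move: w1; rewrite big1 => [/eqP|i _]; last by rewrite wS// S0 inE.
  by rewrite eq_sym oner_eq0.
rewrite negb_forall => /existsP[r]; rewrite negbK => /eqP mr.
apply/seteqP; split=> x //= [_ [u [h [_ _ uS _ _]]]].
have uS1 i : i \in S -> dotv u (v i) = h by case: uS => + _; apply.
have inS k : (r, k) \in S by move/setP: mr => /(_ k); rewrite !inE => /negbFE.
have bsum s : \sum_(l < d) dotv u (v (s, l)) = 0 by rewrite -dotv_sumr block_sum dotvC dotv0l.
have h0 : h = 0.
  have := bsum r; rewrite (eq_bigr (fun=> h)) => [|l _]; last by rewrite uS1.
  rewrite sumr_const card_ord -mulr_natr => /eqP.
  by rewrite mulf_eq0 (negPf D0) orbF => /eqP.
have [[s k] sk] : exists i, i \notin S.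
  by move: ST; rewrite -finset.subTset => /subsetPn[i _ iS]; exists i.
have ule i : dotv u (v i) <= 0 by rewrite -h0; exact: normal_to_le uS.
have : dotv u (v (s, k)) < 0 by rewrite -h0; case: uS => _; apply.
have := bsum s; rewrite (bigD1 k)//= => E.
have : \sum_(l < d | l != k) dotv u (v (s, l)) <= 0 by apply: sumr_le0.
lra.
Qed.

Lemma cell_full eps : cell v [set: J * 'I_d]%SET eps = cell v [set: J * 'I_d]%SET 0.
Proof.
apply/seteqP; split=> x [w [u [h [w01 wS uS ue ->]]]]; exists w, u, h; split=> //.
  by rewrite (normal_full uS) dotv0l expr0n.
by rewrite (normal_full uS) dotv0l sqr_ge0.
Qed.

Lemma cell_zero S : proper_face S -> cell v S 0 = set0.
Proof.
move=> /andP[/set0Pn[i iS] /forallP mS]; apply/seteqP; split=> x //=.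
move=> [_ [u [h [_ _ [u1 u2] ue _]]]].
have u0 : u = 0 by apply: dotv_eq0; apply/eqP; rewrite eq_le dotv_ge0 andbT; rewrite expr0n in ue.
have h0 := u1 _ iS; have /set0Pn[k] := mS i.1; rewrite inE => /u2.
by rewrite -h0 u0 !dotv0l ltxx.
Qed.

Lemma measurable_proper_cell S eps : proper_face S -> measurable (cell v S eps).
Proof.
move=> pS; have /andP[S0 _] := pS; have [m [q [q_inj qS _]]] := face_enum S0.
rewrite -qS; apply: measurable_cell => //.
by apply: (edges_face_unit d_gt0 gram) => // r; apply: occ_lt => //; rewrite qS.
Qed.

Lemma leb_proper_cell S eps : proper_face S -> 0 <= eps ->
  leb R n (cell v S eps) = ((eps ^+ (n.+1 - #|S|))%:E * leb R n (cell v S 1))%E.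
Proof.
move=> pS; have /andP[S0 _] := pS; have [m [q [q_inj qS cS]]] := face_enum S0.
have mn : (m < n)%N by apply: (proper_face_card q_inj); rewrite qS.
rewrite le_eqVlt => /orP[/eqP <-|e0].
  rewrite cell_zero// measure0 cS subSS expr0n subn_eq0 leqNgt mn.
  by rewrite mul0e.
rewrite cS subSS -qS; apply: leb_cell_scale => //; last exact: ltnW.
by apply: (edges_face_unit d_gt0 gram) => // r; apply: occ_lt => //; rewrite qS.
Qed.

Lemma measurable_any_cell S eps : measurable (cell v S eps).
Proof.
have [->|ST] := eqVneq S [set: J * 'I_d]%SET; last first.
  have [pS|pS] := boolP (proper_face S); first exact: measurable_proper_cell.
  by rewrite cell_improper.
have [r0 _] : exists r : J, r \in J by apply/card_gt0P.
(* The polytope is not given by linear inequalities here; its measurability comes from its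
   complement, the union of all the other cells over integer radii. *)
rewrite cell_full (_ : cell _ _ _ = ~` (\bigcup_N
   \bigcup_(T in [set T : {set J * 'I_d} | T != [set: J * 'I_d]%SET]) cell v T N%:R)).
  apply: measurableC; apply: bigcup_measurable => N _.
  apply: fin_bigcup_measurable => // T /= TT.
  have [pT|pT] := boolP (proper_face T); first exact: measurable_proper_cell.
  by rewrite cell_improper.
apply/seteqP; split=> x.
  move=> [w [u [h [w01 wS uS ue ->]]]] [N _ [T /= TT]].
  move=> [w' [u' [h' [w'01 w'S u'S _ E]]]]; move/negP: TT; apply.
  by have [<-] := normal_unique w01 w'01 wS w'S uS u'S E.
have [w [u [h [T [w01 wT uT ->]]]]] := cell_exists v (r0, Ordinal d_gt0) x.
move=> H; have [TT|TT] := eqVneq T [set: J * 'I_d]%SET.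
  rewrite TT in wT uT; exists w, u, h; split=> //.
  by rewrite (normal_full uT) dotv0l expr0n.
exfalso; apply: H; exists (Num.truncn (dotv u u)).+1 => //; exists T => //.
exists w, u, h; split=> //.
apply: (@le_trans _ _ (Num.truncn (dotv u u)).+1%:R); first exact/ltW/truncnS_gt.
by rewrite expr2 -natrM ler_nat leq_pmulr.
Qed.

Lemma leb_cell_lty S : (leb R n (cell v S 1) < +oo)%E.
Proof.
pose K := \sum_i \sum_k `|v i 0 k| + 1.
have K0 : 0 <= K by rewrite addr_ge0// sumr_ge0// => i _; apply: sumr_ge0.
apply: le_lt_trans (leb_box n K0); apply: le_measure; rewrite ?inE.
- exact: measurable_any_cell.
- rewrite (_ : [set _ | _] = \bigcap_(k in [set: 'I_n]) [set x : 'rV[R]_n | `|x 0 k| <= K]).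
    apply: fin_bigcap_measurable => // k _; apply: measurable_set_le => //.
    by apply: measurableT_comp => //; exact: measurable_coord.
  by apply/seteqP; split=> x /= H k => [_|]; exact: H.
move=> x [w [u [h [[w0 w1] _ _ ue ->]]]] k; rewrite mxE (le_trans (ler_normD _ _))// lerD//.
  rewrite /bary summxE (le_trans (ler_norm_sum _ _ _))// ler_sum// => i _.
  rewrite mxE normrM ger0_norm//.
  have wi : w i <= 1 by rewrite -w1 (bigD1 i)//= lerDl sumr_ge0.
  apply: (@le_trans _ _ `|v i 0 k|); first by rewrite ler_piMl.
  by rewrite (bigD1 k)//= lerDl sumr_ge0.
have : u 0 k ^+ 2 <= 1.
  move: ue; rewrite expr1n dotvE; apply: le_trans.
  rewrite (bigD1 k)//= -expr2 lerDl sumr_ge0// => l _.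
  by rewrite -expr2 sqr_ge0.
by move=> h1; rewrite ler_norml; apply/andP; split; nra.
Qed.

(** A face with #|S| vertices has dimension #|S| - 1, so n + 1 - #|S| is its codimension. The cell
    of the full vertex set does not depend on eps and gives the constant term. *)
Lemma steiner_formula eps : 0 <= eps ->
  leb R n (parallel_body (conv_hull v) eps) =
  (fine (leb R n (cell v [set: J * 'I_d]%SET 1)) +
   \sum_(S : {set J * 'I_d} | proper_face S)
     fine (leb R n (cell v S 1)) * eps ^+ (n.+1 - #|S|))%:E.
Proof.
move=> e0; have [r0 _] : exists r : J, r \in J by apply/card_gt0P.
rewrite (parallel_bodyE v (r0, Ordinal d_gt0) e0).
rewrite measure_fin_bigcup//; last 3 first.
- exact: finite_finset.
- exact: trivIset_cell.
- by move=> S _; exact: measurable_any_cell.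
have fin S : leb R n (cell v S 1) = (fine (leb R n (cell v S 1)))%:E.
  by rewrite fineK// ge0_fin_numE ?leb_cell_lty.
rewrite (_ : [set: {set J * 'I_d}] = [set` enum {set J * 'I_d}]); last first.
  by apply/seteqP; split=> S //= _; rewrite mem_enum.
rewrite -fsbig_seq ?enum_uniq// big_enum /=.
rewrite (bigD1 [set: J * 'I_d]%SET)//= cell_full -(cell_full 1) fin EFinD; congr (_ + _)%E.
rewrite -sumEFin (bigID proper_face) /= [X in (_ + X)%E]big1 ?adde0; last first.
  by move=> S /andP[ST pS]; rewrite cell_improper// measure0.
rewrite (eq_bigl proper_face); last first.
  move=> S; have [pS|] := boolP (proper_face S); rewrite ?andbT ?andbF//.
  apply: contraTneq pS => ->; rewrite negb_and; apply/orP; right.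
  rewrite negb_forall; apply/existsP; exists r0; rewrite negbK.
  by apply/eqP/setP => k; rewrite !inE.
by apply: eq_bigr => S pS; rewrite leb_proper_cell// fin -EFinM mulrC.
Qed.

End simplex_join.

(** * Normal cones in coordinates along facet normals *)

Section normal_cones.
Variables (R : realType) (d n : nat) (J : finType).
Variable v : J * 'I_d -> 'rV[R]_n.
Hypothesis d_gt1 : (1 < d)%N.
Hypothesis gram : forall i j, dotv (v i) (v j) = (i == j)%:R - (i.1 == j.1)%:R / d%:R.

Let d_gt0 : (0 < d)%N. Proof. exact: ltnW. Qed.

(** The facet omits the vertices (r, f r): this vector has the value 1/d on its vertices and 1/d - 1
    on the omitted ones. *)
Definition facet_normal (f : J -> 'I_d) : 'rV[R]_n := - \sum_r v (r, f r).

Lemma dotv_facet_normal f i : dotv (facet_normal f) (v i) = d%:R^-1 - (i.2 == f i.1)%:R.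
Proof.
case: i => r k /=; rewrite dotvNl dotv_suml (bigD1 r)//= big1 ?addr0 => [|s /negPf sr].
  by rewrite gram /= xpair_eqE eqxx /= [f r == k]eq_sym opprB div1r.
by rewrite gram /= xpair_eqE sr /= mul0r subrr.
Qed.

Lemma dotv_facet_normals f g :
  dotv (facet_normal f) (facet_normal g) = (\sum_r (f r == g r))%:R - #|J|%:R / d%:R.
Proof.
rewrite [facet_normal g]/facet_normal dotvNr dotv_sumr.
rewrite (eq_bigr (fun r => d%:R^-1 - (f r == g r)%:R)); last first.
  by move=> r _; rewrite dotv_facet_normal [g r == _]eq_sym.
by rewrite sumrB opprB sumr_const natr_sum -[X in _ - X]mulr_natl.
Qed.

Section cone.
Variables (m k : nat) (q : 'I_m.+1 -> J * 'I_d) (f : 'I_k -> J -> 'I_d).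
Hypothesis q_inj : injective q.
Hypothesis pS : proper_face (face q).
Hypothesis f_missing : forall l r, (r, f l r) \notin face q.

Definition normals : 'M[R]_(k, n) := \matrix_(l, j) facet_normal (f l) 0 j.

Lemma mul_normals (t : 'rV[R]_k) : t *m normals = \sum_l t 0 l *: facet_normal (f l).
Proof.
rewrite mulmx_sum_row; apply: eq_bigr => l _; congr (_ *: _).
by apply/rowP => j; rewrite !mxE.
Qed.

Lemma dotv_normals (t : 'rV[R]_k) i : dotv (t *m normals) (v i) =
  (\sum_l t 0 l) / d%:R - \sum_l t 0 l * (i.2 == f l i.1)%:R.
Proof.
rewrite mul_normals dotv_suml mulr_suml -sumrB; apply: eq_bigr => l _.
by rewrite dotvZl dotv_facet_normal mulrBr.
Qed.

Lemma dotv_normals_face (t : 'rV[R]_k) i : i \in face q ->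
  dotv (t *m normals) (v i) = (\sum_l t 0 l) / d%:R.
Proof.
move=> iS; rewrite dotv_normals [X in _ - X]big1 ?subr0// => l _.
case: eqP; rewrite ?mulr0// => il; have := f_missing l i.1.
by rewrite -il -surjective_pairing iS.
Qed.

Lemma face_q j : q j \in face q.
Proof. by rewrite mem_face; apply/existsP; exists j. Qed.

Lemma edges_normals : edges v q *m normals^T = 0.
Proof.
suff : normals *m (edges v q)^T = 0.
  by move=> /(congr1 trmx); rewrite trmx_mul trmxK trmx0.
apply/row_matrixP => l; rewrite row_mul row0 rowE; apply/dotv_edges => j.
by rewrite !dotv_normals_face ?face_q.
Qed.

(** The coefficients may be negative: what matters is that each omitted vertex receives positive
    total weight from the facets that omit it. This is what lets three normals describe a cone with
    four sides. *)
Lemma outward_normals (t : 'rV[R]_k) : outward v q (t *m normals) <->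
  forall i, i \notin face q -> 0 < \sum_l t 0 l * (i.2 == f l i.1)%:R.
Proof.
split=> H i iS; have := H i iS; rewrite (dotv_normals_face _ (face_q ord0)) dotv_normals;
  lra.
Qed.

Lemma gram_normals l l' : (normals *m normals^T) l l' =
  (\sum_r (f l r == f l' r))%:R - #|J|%:R / d%:R.
Proof.
rewrite -dotv_facet_normals dotvE mxE; apply: eq_bigr => j _.
by rewrite !mxE.
Qed.

Lemma dotv_normals_quad (t : 'rV[R]_k) : dotv (t *m normals) (t *m normals) =
  \sum_l \sum_l' t 0 l * t 0 l' * (normals *m normals^T) l l'.
Proof.
rewrite mul_normals dotv_suml; apply: eq_bigr => l _.
rewrite dotv_sumr; apply: eq_bigr => l' _.
by rewrite dotvZl dotvZr gram_normals dotv_facet_normals; ring.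
Qed.

Lemma leb_cell_normals (Y : set 'rV[R]_k) : n = (m + k)%N ->
  normals *m normals^T \in unitmx -> measurable Y ->
  (forall t, Y t <->
     (forall i, i \notin face q -> 0 < \sum_l t 0 l * (i.2 == f l i.1)%:R) /\
     \sum_l \sum_l' t 0 l * t 0 l' * (normals *m normals^T) l l' <= 1) ->
  leb R n (cell v (face q) 1) =
  ((Num.sqrt (\det (edges v q *m (edges v q)^T) * \det (normals *m normals^T))
    / m`!%:R)%:E * leb R k Y)%E.
Proof.
move=> nmk uN mY YE; apply: leb_cell_prod => //.
- by apply: (edges_face_unit d_gt0 gram) => // r; exact: occ_lt.
- exact: edges_normals.
- by move=> t; rewrite dotv_normals_quad; split=> [/YE[/outward_normals]|[/outward_normals ? ?]] //;
    apply/YE.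
Qed.

End cone.

End normal_cones.

Section small_cones.
Variable R : realType.

Lemma det_mx33 (K : comNzRingType) (A : 'M[K]_3) :
  \det A = A 0 0 * (A 1 1 * A 2 2 - A 1 2 * A 2 1)
         - A 0 1 * (A 1 0 * A 2 2 - A 1 2 * A 2 0)
         + A 0 2 * (A 1 0 * A 2 1 - A 1 1 * A 2 0).
Proof.
rewrite (expand_det_row _ 0) !big_ord_recl big_ord0 addr0 /cofactor !det_mx22 !mxE /=.
(* Entries are indexed by natural numbers so that the nested lifts of the cofactor expansion
   compute. *)
pose B (i j : nat) := A (inord i) (inord j).
have AE i j : A i j = B i j by rewrite /B !inord_val.
by rewrite !AE /= /bump /=; ring.
Qed.

(** The nonnegative excess that [isosceles_excess] asks for is supplied by Girard's formula itself,
    since a measure is nonnegative. *)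
Lemma leb_octant_isosceles (a b : R) : 0 < a < 1 -> -1 < b < 1 -> 2 * a ^+ 2 < 1 + b ->
  leb R 3 (octant a b a) =
  (4 * atan (Num.sqrt (tan (acos a / 2 + acos b / 4) * tan (acos a / 2 - acos b / 4) *
      tan (acos b / 4) ^+ 2)) / (3 * Num.sqrt (det3 a b a)))%:E.
Proof.
move=> a01 b01 ab; have /andP[a0 a1] := a01; have /andP[b0 b1] := b01.
have d0 : 0 < det3 a b a.
  rewrite (_ : det3 a b a = (1 - b) * (1 + b - 2 * a ^+ 2)); last by rewrite /det3; ring.
  by rewrite mulr_gt0//; lra.
have a2 : a ^+ 2 < 1 by nra.
have b2 : b ^+ 2 < 1 by nra.
have E := leb_octant a2 b2 a2 d0; rewrite E; congr EFin; congr (_ / _).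
apply: isosceles_excess => //.
have : (0 <= leb R 3 (octant a b a))%E by exact: measure_ge0.
by rewrite E lee_fin pmulr_lge0// invr_gt0 mulr_gt0// sqrtr_gt0.
Qed.

(** Facet normals have squared norm rho instead of 1. *)
Definition scaled_octant (rho x y z : R) :=
  [set t : 'rV[R]_3 | [/\ 0 < t 0 0, 0 < t 0 1, 0 < t 0 2 & rho * form3 x y z t <= 1]].

Lemma measurable_scaled_octant rho x y z : measurable (scaled_octant rho x y z).
Proof.
rewrite (_ : scaled_octant rho x y z = [set t : 'rV[R]_3 | 0 < t 0 0] `&`
  [set t : 'rV[R]_3 | 0 < t 0 1] `&` [set t : 'rV[R]_3 | 0 < t 0 2] `&`
  [set t | rho * form3 x y z t <= 1]); last first.
  by apply/seteqP; split=> t /=; [case|case=> -[[]]].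
apply: measurableI.
  by apply: measurableI; [apply: measurableI|]; exact: measurable_pos.
by apply: measurable_set_le => //; apply: measurable_funM => //; exact: measurable_form3.
Qed.

Lemma leb_scaled_octant rho x y z : 0 < rho ->
  ((Num.sqrt (rho ^+ 3))%:E * leb R 3 (scaled_octant rho x y z) = leb R 3 (octant x y z))%E.
Proof.
move=> rho0; set w := Num.sqrt rho; have w0 : 0 < w by rewrite sqrtr_gt0.
have w2 : w ^+ 2 = rho by rewrite sqr_sqrtr// ltW.
have -> : Num.sqrt (rho ^+ 3) = w ^+ 3.
  by rewrite -w2 exprAC sqrtr_sqr ger0_norm// exprn_ge0// ltW.
rewrite (@leb_scale_coord R 3 (const_mx w) (octant x y z)).
- apply: (f_equal2 (fun x y => (x * y)%E)).
    congr EFin; by rewrite (eq_bigr (fun=> w)) ?prodr_const ?card_ord// => i _; rewrite mxE.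
  apply: f_equal; apply/seteqP; split=> t; rewrite /scaled_octant /octant /form3 /= !mxE !pmulr_lgt0// => -[? ? ? H];
    split=> //; apply: le_trans H; rewrite le_eqVlt; apply/orP; left; apply/eqP; rewrite -w2; ring.
- by move=> i; rewrite mxE.
- exact: measurable_octant.
Qed.

End small_cones.

(** * Volumes of the cells of codimension two and three *)

Section cell_values.
Variables (R : realType) (d n : nat) (J : finType).
Variable v : J * 'I_d -> 'rV[R]_n.
Hypothesis d_gt1 : (1 < d)%N.
Hypothesis gram : forall i j, dotv (v i) (v j) = (i == j)%:R - (i.1 == j.1)%:R / d%:R.

Variable rho : R.
Hypothesis rhoE : rho = #|J|%:R - #|J|%:R / d%:R.
Hypothesis rho_gt1 : 1 < rho.

Let d_gt0 : (0 < d)%N. Proof. exact: ltnW. Qed.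
Let D0 : d%:R != 0 :> R. Proof. by rewrite pnatr_eq0 -lt0n. Qed.

(** The Gram determinant of the edges of a face, expressed by the number p r of vertices it omits
    from simplex r. *)
Definition face_weight (p : J -> nat) : R :=
  \prod_r ((p r)%:R / d%:R) * \sum_r (d%:R - (p r)%:R) * (d%:R / (p r)%:R).

Lemma det_edges_missing m (q : 'I_m.+1 -> J * 'I_d) : injective q -> proper_face (face q) ->
  \det (edges v q *m (edges v q)^T) = face_weight (fun r => #|missing (face q) r|).
Proof.
move=> q_inj pS.
have oE r : (occ q r)%:R = d%:R - #|missing (face q) r|%:R :> R.
  by rewrite -[X in X%:R - _](occ_missing r q_inj) natrD addrK.
rewrite (det_edges_face d_gt0 gram q_inj) => [|r]; last exact: occ_lt.
congr (_ * _); apply: eq_bigr => r _; rewrite oE; first by rewrite mulrBl mulfV// subKr.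
by rewrite subKr.
Qed.

(** With [dotv_facet_normals]: rho is the squared norm of a facet normal, and each simplex where two
    facets disagree lowers their inner product by 1. *)
Lemma agreements (F G : J -> 'I_d) :
  (\sum_r (F r == G r))%:R - #|J|%:R / d%:R = rho - (\sum_r (F r != G r))%:R :> R.
Proof.
rewrite rhoE -[X in _ = X%:R - _ - _]sum1_card.
rewrite (_ : (\sum_(i in J) 1 = \sum_r (F r == G r) + \sum_r (F r != G r))%N).
  by rewrite natrD; ring.
by rewrite -big_split /=; apply: eq_bigr => r _; case: (_ == _).
Qed.

(** Here [kappa] is the volume of the normal cone inside the unit ball: [Y] is that set in
    coordinates along the normals, and the square root of the determinant of [G] is their
    Jacobian. *)
Lemma leb_cell_kappa m k (q : 'I_m.+1 -> J * 'I_d) (f : 'I_k -> J -> 'I_d)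
    (Y : set 'rV[R]_k) (G : 'M[R]_k) (kappa : R) :
  injective q -> proper_face (face q) -> (forall l r, (r, f l r) \notin face q) ->
  n = (m + k)%N -> normals v f *m (normals v f)^T = G -> 0 < \det G -> measurable Y ->
  (forall t, Y t <->
     (forall i, i \notin face q -> 0 < \sum_l t 0 l * (i.2 == f l i.1)%:R) /\
     \sum_l \sum_l' t 0 l * t 0 l' * G l l' <= 1) ->
  ((Num.sqrt (\det G))%:E * leb R k Y)%E = kappa%:E ->
  leb R n (cell v (face q) 1) =
  (Num.sqrt (face_weight (fun r => #|missing (face q) r|)) / m`!%:R * kappa)%:E.
Proof.
move=> q_inj pS f_missing nmk GE d0 mY YE kE.
have w0 : 0 <= face_weight (fun r => #|missing (face q) r|).
  rewrite -det_edges_missing//; apply/ltW; apply: (det_edges_face_gt0 d_gt0 gram) => // r.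
  exact: occ_lt.
rewrite (leb_cell_normals d_gt1 gram q_inj pS f_missing nmk _ mY) GE//.
- by rewrite det_edges_missing// sqrtrM// mulrAC EFinM -muleA kE -EFinM.
- by rewrite unitmxE unitfE gt_eqF.
Qed.

Section one_block.
Variables (m k : nat) (q : 'I_m.+1 -> J * 'I_d) (r0 : J) (j : 'I_k -> 'I_d) (g : J -> 'I_d).
Hypothesis q_inj : injective q.
Hypothesis pS : proper_face (face q).
Hypothesis j_inj : injective j.
Hypothesis missing0 : missing (face q) r0 = finset (fun i => i \in codom j).
Hypothesis missing1 : forall r, r != r0 -> missing (face q) r = finset.set1 (g r).

(** The facets that contain the face: only in simplex r0 is there a choice of the vertex to omit. *)
Let f (l : 'I_k) (r : J) := if r == r0 then j l else g r.

Let f_missing l r : (r, f l r) \notin face q.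
Proof.
rewrite /f; case: (eqVneq r r0) => [->|rr0].
  by have /setP/(_ (j l)) := missing0; rewrite !inE codom_f.
by have /setP/(_ (g r)) := missing1 rr0; rewrite !inE eqxx.
Qed.

Lemma gram_one_block :
  normals v f *m (normals v f)^T = \matrix_(l, l') (rho - (l != l')%:R).
Proof.
apply/matrixP => l l'; rewrite [RHS]mxE (gram_normals gram) agreements; congr (_ - _%:R).
rewrite (bigD1 r0)//= /f eqxx (inj_eq j_inj) big1 ?addn0// => r /negPf ->.
by rewrite eqxx.
Qed.

Lemma positive_one_block (t : 'rV[R]_k) : (0 < k)%N ->
  (forall i, i \notin face q -> 0 < \sum_l t 0 l * (i.2 == f l i.1)%:R) <-> forall l, 0 < t 0 l.
Proof.
move=> k0; split=> [H l|H [r i] iS].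
  have := H (r0, f l r0) (f_missing l r0); rewrite /f /= eqxx (bigD1 l)//= eqxx mulr1 big1 ?addr0//.
  by move=> l' /negPf; rewrite (inj_eq j_inj) eq_sym => ->; rewrite mulr0.
have : i \in missing (face q) r by rewrite inE.
rewrite /f /=; have [->|rr0] := eqVneq r r0.
  rewrite missing0 inE => /codomP[l ->]; rewrite (bigD1 l)//= eqxx mulr1 ltr_pwDl// sumr_ge0// => l' _.
  by rewrite mulr_ge0// ltW.
rewrite missing1// inE => /eqP ->; rewrite (bigD1 (Ordinal k0))//= eqxx mulr1 ltr_pwDl// sumr_ge0// => l' _.
by rewrite mulr_ge0// ltW.
Qed.

Lemma leb_cell_one_block (Y : set 'rV[R]_k) (kappa : R) : n = (m + k)%N -> (0 < k)%N ->
  let G := \matrix_(l < k, l' < k) (rho - (l != l')%:R) in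
  0 < \det G -> measurable Y ->
  (forall t, Y t <-> (forall l, 0 < t 0 l) /\ \sum_l \sum_l' t 0 l * t 0 l' * G l l' <= 1) ->
  ((Num.sqrt (\det G))%:E * leb R k Y)%E = kappa%:E ->
  leb R n (cell v (face q) 1) =
  (Num.sqrt (face_weight (fun r => #|missing (face q) r|)) / m`!%:R * kappa)%:E.
Proof.
move=> nmk k0 G d0 mY YE kE; apply: (leb_cell_kappa q_inj pS f_missing nmk gram_one_block _ mY) => //.
by move=> t; rewrite YE positive_one_block.
Qed.

End one_block.

Let rho0 : 0 < rho. Proof. exact: lt_trans rho_gt1. Qed.
(** Cosine of the angle between normals of two facets that differ in a single simplex; for the
    polytope of the theorem it is cos alpha. *)
Let a := 1 - rho^-1.

Let a01 : 0 < a < 1.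
Proof.
have : rho^-1 < 1 by rewrite invf_lt1.
have : 0 < rho^-1 by rewrite invr_gt0.
by rewrite /a => h1 h2; apply/andP; split; lra.
Qed.

Let rho_a : rho * a = rho - 1.
Proof. by rewrite /a mulrBr mulr1 mulfV// gt_eqF. Qed.

Lemma leb_cell_codim2 m (q : 'I_m.+1 -> J * 'I_d) (r0 : J) (j : 'I_2 -> 'I_d) (g : J -> 'I_d) :
  n = (m + 2)%N -> injective q -> proper_face (face q) -> injective j ->
  missing (face q) r0 = finset (fun i => i \in codom j) ->
  (forall r, r != r0 -> missing (face q) r = finset.set1 (g r)) ->
  leb R n (cell v (face q) 1) =
  (Num.sqrt (face_weight (fun r => #|missing (face q) r|)) / m`!%:R * (acos a / 2))%:E.
Proof.
move=> nm q_inj pS j_inj m0 m1; have rho1 := rho_gt1.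
pose Y := [set t : 'rV[R]_2 | [/\ 0 < t 0 0, 0 < t 0 1 &
     rho * t 0 0 ^+ 2 + rho * t 0 1 ^+ 2 + 2 * (rho - 1) * (t 0 0 * t 0 1) <= 1]].
have mc i : measurable_fun setT (fun u : 'rV[R]_2 => u 0 i) by exact: measurable_coord.
have mY : measurable Y.
  rewrite (_ : Y = [set t : 'rV[R]_2 | 0 < t 0 0] `&` [set t : 'rV[R]_2 | 0 < t 0 1] `&`
    [set t : 'rV[R]_2 | rho * t 0 0 ^+ 2 + rho * t 0 1 ^+ 2 + 2 * (rho - 1) * (t 0 0 * t 0 1) <= 1]); last first.
    by apply/seteqP; split=> t /=; [case|case=> -[]].
  apply: measurableI; first by apply: measurableI; exact: measurable_set_lt.
  apply: measurable_set_le => //.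
  by repeat (apply: measurable_funD => //|| apply: measurable_funM => // || apply: measurable_funX => //).
have del0 : 0 < rho * rho - (rho - 1) ^+ 2 by rewrite expr2; nra.
have dG : \det (\matrix_(l < 2, l' < 2) (rho - (l != l')%:R)) = rho * rho - (rho - 1) ^+ 2.
  by rewrite det_mx22 !mxE /= !subr0 expr2.
apply: (leb_cell_one_block q_inj pS j_inj m0 m1 nm _ _ mY); rewrite ?dG//.
- move=> t; rewrite !big_ord_recl !big_ord0 !addr0 !mxE /=.
  rewrite (_ : lift ord0 ord0 = 1); last exact/val_inj.
  split=> [[t0 t1 H]|[tl H]].
    split; last by move: H; congr (_ <= _); rewrite /= !subr0; ring.
    move=> l; have [i ->|->//] := unliftP ord0 l; rewrite ord1.
    by rewrite (_ : lift ord0 0 = 1)//; exact/val_inj.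
  split=> //; move: H; congr (_ <= _); rewrite /= !subr0; ring.
- rewrite leb_sector//; last by rewrite -subr_gt0.
  have -> : Num.sqrt (rho * rho) = rho by rewrite -expr2 sqrtr_sqr ger0_norm// ltW.
  have -> : (rho - 1) / rho = a by rewrite -rho_a mulrC mulKf// gt_eqF.
  rewrite -EFinM; congr EFin; set w := Num.sqrt _.
  by field; rewrite gt_eqF// sqrtr_gt0.
Qed.

(** A solid angle E fills the volume E/3 of the unit ball, and E is four arctangents. The
    equilateral triangle is taken as isosceles with base equal to the legs. *)
Lemma leb_cell_codim3_one m (q : 'I_m.+1 -> J * 'I_d) (r0 : J) (j : 'I_3 -> 'I_d) (g : J -> 'I_d) :
  n = (m + 3)%N -> injective q -> proper_face (face q) -> injective j ->
  missing (face q) r0 = finset (fun i => i \in codom j) ->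
  (forall r, r != r0 -> missing (face q) r = finset.set1 (g r)) ->
  leb R n (cell v (face q) 1) =
  (Num.sqrt (face_weight (fun r => #|missing (face q) r|)) / m`!%:R *
   (4 / 3 * atan (Num.sqrt (tan (acos a / 2 + acos a / 4) * tan (acos a / 2 - acos a / 4) *
      tan (acos a / 4) ^+ 2))))%:E.
Proof.
move=> nm q_inj pS j_inj m0 m1; have /andP[a0 a1] := a01.
have d3 : 0 < det3 a a a.
  rewrite (_ : det3 a a a = (1 - a) ^+ 2 * (1 + 2 * a)); last by rewrite /det3; ring.
  by rewrite mulr_gt0 ?exprn_gt0//; lra.
have dG : \det (\matrix_(l < 3, l' < 3) (rho - (l != l')%:R)) = rho ^+ 3 * det3 a a a.
  rewrite det_mx33 !mxE /= !subr0 -rho_a /det3; ring.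
apply: (leb_cell_one_block q_inj pS j_inj m0 m1 nm _ _ (measurable_scaled_octant rho a a a)); rewrite ?dG//.
- by rewrite mulr_gt0// exprn_gt0.
- have l1 : lift ord0 ord0 = 1 :> 'I_3 by exact/val_inj.
  have l2 : lift ord0 (lift ord0 ord0) = 2 :> 'I_3 by exact/val_inj.
  move=> t; rewrite !big_ord_recl !big_ord0 !addr0 !mxE /= l2 l1 !subr0.
  rewrite /scaled_octant /form3 /=; split=> [[t0 t1 t2 H]|[tl H]].
    split; last by move: H; congr (_ <= _); rewrite -rho_a; ring.
    move=> l; have [i ->|->//] := unliftP ord0 l; have [i' ->|->] := unliftP ord0 i; rewrite ?ord1 ?l1//.
    by rewrite (_ : lift ord0 (lift ord0 0) = 2)//; exact/val_inj.
  by split=> //; move: H; congr (_ <= _); rewrite -rho_a; ring.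
rewrite sqrtrM ?exprn_ge0 ?ltW// mulrC EFinM -muleA leb_scaled_octant//.
rewrite leb_octant_isosceles ?a01//; last 2 first.
- by apply/andP; split; lra.
- by nra.
rewrite -EFinM; congr EFin; set w := Num.sqrt (det3 _ _ _).
have w0 : w != 0 by rewrite gt_eqF// sqrtr_gt0.
by field.
Qed.

(** The same cosine for facets that differ in two simplices, cos beta in the theorem. The relation b
    = 2 a - 1 expresses that the four normals at such a face form a square. *)
Let b := 1 - 2 * rho^-1.

Let rho_b : rho * b = rho - 2.
Proof. by rewrite /b mulrBr mulr1 mulrCA mulfV ?mulr1// gt_eqF. Qed.

Let b_a : b = 2 * a - 1. Proof. by rewrite /b /a; ring. Qed.

Section two_blocks.
Variables (m : nat) (q : 'I_m.+1 -> J * 'I_d) (r1 r2 : J) (j0 j1 k0 k1 : 'I_d) (g : J -> 'I_d).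
Hypothesis q_inj : injective q.
Hypothesis pS : proper_face (face q).
Hypotheses (r12 : r1 != r2) (j01 : j0 != j1) (k01 : k0 != k1).
Hypothesis missing1 : missing (face q) r1 = [set j0; j1]%SET.
Hypothesis missing2 : missing (face q) r2 = [set k0; k1]%SET.
Hypothesis missing3 : forall r, r != r1 -> r != r2 -> missing (face q) r = finset.set1 (g r).

(* The normal cone is the cone over a square; the facet normals [f 0], [f 1], [f 2] are three
   consecutive vertices of it, and the fourth is [f 0 - f 1 + f 2]. *)
Let f (l : 'I_3) (r : J) :=
  if r == r1 then (if l == 0 then j0 else j1)
  else if r == r2 then (if l == 2 then k1 else k0) else g r.

Let f_missing l r : (r, f l r) \notin face q.
Proof.
have : f l r \in missing (face q) r; last by rewrite inE.
rewrite /f; have [->|rr1] := eqVneq r r1.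
  by rewrite missing1 !inE; case: ifP => _; rewrite eqxx ?orbT.
have [->|rr2] := eqVneq r r2; last by rewrite missing3// inE.
by rewrite missing2 !inE; case: ifP => _; rewrite eqxx ?orbT.
Qed.

Let G : 'M[R]_3 := \matrix_(l, l') (rho * (if l == l' then 1 else
  if (l == 1) || (l' == 1) then a else b)).

Let gram_two_blocks : normals v f *m (normals v f)^T = G.
Proof.
apply/matrixP => l l'; rewrite [RHS]mxE (gram_normals gram) agreements.
rewrite (bigD1 r1)//= (bigD1 r2) 1?eq_sym//= /f eqxx [r2 == r1]eq_sym (negPf r12) eqxx.
rewrite big1 => [|r /andP[/negPf -> /negPf ->]]; last by rewrite eqxx.
rewrite addn0.
have c3 (i : 'I_3) : [\/ i = 0, i = 1 | i = 2].
  by case: i => -[|[|[|//]]] ?; [apply: Or31|apply: Or32|apply: Or33]; exact/val_inj.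
by case: (c3 l) => ->; case: (c3 l') => -> /=; rewrite ?eqxx ?j01 ?k01 ?[_ == j0]eq_sym
  ?[_ == k0]eq_sym ?(negPf j01) ?(negPf k01) /= ?rho_a ?rho_b ?mulr1 ?subr0.
Qed.

(** One linear inequality for each of the omitted vertices [j0], [k1], [k0], [j1], in this order;
    they are the four sides of the quadrangle. *)
Let Y := [set t : 'rV[R]_3 | [/\ 0 < t 0 0, 0 < t 0 2, 0 < t 0 0 + t 0 1, 0 < t 0 1 + t 0 2 &
  rho * form3 a b a t <= 1]].

Let positive_two_blocks (t : 'rV[R]_3) :
  (forall i, i \notin face q -> 0 < \sum_l t 0 l * (i.2 == f l i.1)%:R) <->
  [/\ 0 < t 0 0, 0 < t 0 2, 0 < t 0 0 + t 0 1 & 0 < t 0 1 + t 0 2].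
Proof.
have W i : \sum_l t 0 l * (i.2 == f l i.1)%:R = t 0 0 * (i.2 == f 0 i.1)%:R +
    t 0 1 * (i.2 == f 1 i.1)%:R + t 0 2 * (i.2 == f 2 i.1)%:R.
  have l1 : lift ord0 ord0 = 1 :> 'I_3 by exact/val_inj.
  have l2 : lift ord0 (lift ord0 ord0) = 2 :> 'I_3 by exact/val_inj.
  by rewrite !big_ord_recl big_ord0 l2 l1 addr0 addrA.
have r21 : (r2 == r1) = false by rewrite eq_sym (negPf r12).
have j10 : (j1 == j0) = false by rewrite eq_sym (negPf j01).
have k10 : (k1 == k0) = false by rewrite eq_sym (negPf k01).
split=> [H|[h0 h2 h01 h12] [r k] kS].
  have H' r k : k \in missing (face q) r -> 0 < t 0 0 * (k == f 0 r)%:R +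
    t 0 1 * (k == f 1 r)%:R + t 0 2 * (k == f 2 r)%:R.
    by rewrite inE => /H; rewrite W.
  have := H' r1 j0; have := H' r1 j1; have := H' r2 k0; have := H' r2 k1.
  rewrite missing1 missing2 !inE !eqxx !orbT /f /= !eqxx r21 (negPf j01) (negPf k01) j10 k10 !eqxx /=.
  rewrite !mulr0 !mulr1 !addr0 !add0r.
  by move=> /(_ isT) h1 /(_ isT) h2 /(_ isT) h3 /(_ isT) h4; split.
have : k \in missing (face q) r by rewrite inE.
rewrite W /=; have [->|rr1] := eqVneq r r1.
  rewrite missing1 !inE => /orP[] /eqP ->; rewrite /f /= eqxx ?(negPf j01) ?j10 eqxx;
    by rewrite !mulr0 !mulr1 ?addr0 ?add0r.
have [->|rr2] := eqVneq r r2.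
  rewrite missing2 !inE => /orP[] /eqP ->; rewrite /f /= r21 !eqxx ?(negPf k01) ?k10;
    by rewrite !mulr0 !mulr1 ?addr0 ?add0r.
rewrite missing3// inE => /eqP ->; rewrite /f /= (negPf rr1) (negPf rr2) eqxx !mulr1.
by rewrite addr_gt0.
Qed.

Let mY : measurable Y.
Proof.
have mc i : measurable_fun setT (fun u : 'rV[R]_3 => u 0 i) by exact: measurable_coord.
rewrite (_ : Y = [set t : 'rV[R]_3 | 0 < t 0 0] `&` [set t : 'rV[R]_3 | 0 < t 0 2] `&`
  [set t : 'rV[R]_3 | 0 < t 0 0 + t 0 1] `&` [set t : 'rV[R]_3 | 0 < t 0 1 + t 0 2] `&`
  [set t | rho * form3 a b a t <= 1]); last first.
  by apply/seteqP; split=> t /=; [case|case=> -[[[]]]].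
apply: measurableI.
  apply: measurableI; last by apply: measurable_set_lt => //; exact: measurable_funD.
  apply: measurableI; last by apply: measurable_set_lt => //; exact: measurable_funD.
  by apply: measurableI; exact: measurable_pos.
by apply: measurable_set_le => //; apply: measurable_funM => //; exact: measurable_form3.
Qed.

(** The sign of the middle coordinate tells on which side of the diagonal from [f 0] to [f 2] a
    point lies. *)
Let lebY : leb R 3 Y = (leb R 3 (scaled_octant rho a b a) + leb R 3 (scaled_octant rho a b a))%E.
Proof.
have rho1 := rho0.
rewrite [LHS](leb_split 1 mY); apply: (f_equal2 (fun x y => (x + y)%E)).
  apply: f_equal; apply/seteqP; split=> t; rewrite /Y /scaled_octant /=.
    by move=> [[h0 h2 h01 h12 H] h1].
  by move=> [h0 h1 h2 H]; split=> //; split=> //; exact: addr_gt0.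
(* The rows express [f 0], the fourth normal f 0 - f 1 + f 2, and [f 2] in the given basis. As b = 2
   a - 1, these three have the same inner products as [f 0], [f 1], [f 2]. *)
pose B (i j : nat) : R := match i, j with
  | 0, 0 => 1 | 1, 0 => 1 | 1, 1 => -1 | 1, 2 => 1 | 2, 2 => 1 | _, _ => 0 end.
pose L : 'M[R]_3 := \matrix_(i, j) B i j.
have dL : \det L = -1 by rewrite det_mx33 !mxE /= /B /=; ring.
have mYn : measurable (Y `&` [set t : 'rV[R]_3 | t 0 1 < 0]).
  by apply: measurableI => //; apply: measurable_set_lt => //; exact: measurable_coord.
rewrite [LHS](@leb_mulmx R 3 L _ _ mYn) dL ?oppr_eq0 ?oner_eq0// normrN normr1 mul1e.
apply: f_equal.
have xL (x : 'rV[R]_3) : [/\ (x *m L) 0 0 = x 0 0 + x 0 1, (x *m L) 0 1 = - x 0 1 &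
    (x *m L) 0 2 = x 0 1 + x 0 2].
  have l1 : lift ord0 ord0 = 1 :> 'I_3 by exact/val_inj.
  have l2 : lift ord0 (lift ord0 ord0) = 2 :> 'I_3 by exact/val_inj.
  by split; rewrite !mxE !big_ord_recl big_ord0 !mxE /= l2 l1 /B /=; ring.
apply/seteqP; split=> x; rewrite /Y /scaled_octant /form3 /=; have [-> -> ->] := xL x.
  move=> [[h0 h2 h01 h12 H] h1]; split; [lra|lra|lra|].
  by move: H; congr (_ <= _); rewrite b_a; ring.
move=> [h0 h1 h2 H]; split; last by lra.
split; [lra|lra|lra|lra|]; by move: H; congr (_ <= _); rewrite b_a; ring.
Qed.

Lemma leb_cell_codim3_two : n = (m + 3)%N ->
  leb R n (cell v (face q) 1) =
  (Num.sqrt (face_weight (fun r => #|missing (face q) r|)) / m`!%:R *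
   (8 / 3 * atan (Num.sqrt (tan (acos a / 2 + acos b / 4) * tan (acos a / 2 - acos b / 4) *
      tan (acos b / 4) ^+ 2))))%:E.
Proof.
move=> nm; have /andP[a0 a1] := a01; have rho1 := rho_gt1; have ba := b_a.
have d3 : 0 < det3 a b a.
  rewrite (_ : det3 a b a = 4 * a * (1 - a) ^+ 2); last by rewrite /det3 b_a; ring.
  by rewrite !mulr_gt0 ?exprn_gt0//; lra.
have dG : \det G = rho ^+ 3 * det3 a b a by rewrite det_mx33 !mxE /= /det3; ring.
have l1 : lift ord0 ord0 = 1 :> 'I_3 by exact/val_inj.
have l2 : lift ord0 (lift ord0 ord0) = 2 :> 'I_3 by exact/val_inj.
apply: (leb_cell_kappa q_inj pS f_missing nm gram_two_blocks _ mY).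
- by rewrite dG mulr_gt0// exprn_gt0.
- move=> t; rewrite !big_ord_recl !big_ord0 !addr0 !mxE /= l2 l1.
  have E : rho * form3 a b a t = t 0 0 * t 0 0 * (rho * 1) +
    (t 0 0 * t 0 1 * (rho * a) + t 0 0 * t 0 2 * (rho * b)) +
    (t 0 1 * t 0 0 * (rho * a) + (t 0 1 * t 0 1 * (rho * 1) + t 0 1 * t 0 2 * (rho * a)) +
    (t 0 2 * t 0 0 * (rho * b) + (t 0 2 * t 0 1 * (rho * a) + t 0 2 * t 0 2 * (rho * 1)))).
    by rewrite /form3; ring.
  rewrite -E.
  split=> [[h0 h2 h01 h12 H]|[/positive_two_blocks[h0 h2 h01 h12] H]]; last by split.
  by split=> //; apply/positive_two_blocks.
rewrite dG sqrtrM ?exprn_ge0 ?ltW// lebY mulrC EFinM -muleA muleDr ?ge0_adde_def ?inE ?measure_ge0//.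
rewrite leb_scaled_octant// leb_octant_isosceles ?a01//; last 2 first.
- by apply/andP; split; lra.
- by nra.
rewrite -EFinD -EFinM; congr EFin; set w := Num.sqrt (det3 _ _ _).
have w0 : w != 0 by rewrite gt_eqF// sqrtr_gt0.
by field.
Qed.

End two_blocks.

End cell_values.

(** * Counting faces *)

Section counting.
Variables (d : nat) (J : finType).
Hypothesis d_gt1 : (1 < d)%N.
Hypothesis J_gt2 : (2 < #|J|)%N.
Local Notation vertices := {set J * 'I_d}.

Let d_gt0 : (0 < d)%N. Proof. exact: ltnW. Qed.

Definition has_profile (p : J -> nat) (S : vertices) := [forall r, #|missing S r| == p r].

(** A vertex set amounts to an independent choice of the omitted set in every simplex, so the counts
    multiply. *)
Lemma card_profile (p : J -> nat) :
  #|finset (has_profile p)| = (\prod_r 'C(d, p r))%N.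
Proof.
pose F (S : vertices) : {ffun J -> {set 'I_d}} := [ffun r => missing S r].
pose H (f : {ffun J -> {set 'I_d}}) : vertices := finset (fun i => i.2 \notin f i.1).
have FK : cancel F H.
  by move=> S; apply/setP => -[r k]; rewrite !inE ffunE inE negbK.
have HK : cancel H F.
  by move=> f; apply/ffunP => r; rewrite ffunE; apply/setP => k; rewrite !inE negbK.
transitivity #|family (fun r => [pred A : {set 'I_d} | #|A| == p r])|.
  rewrite -!sum1_card (reindex H) /=; last by exists F => f _; [exact: HK|exact: FK].
  apply: eq_bigl => f; rewrite inE; apply/forallP/familyP => h r.
    by have := h r; rewrite -{2}(HK f) ffunE inE.
  by have := h r; rewrite -{1}(HK f) ffunE inE.
rewrite card_family foldrE big_image /=; apply: eq_bigr => r _.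
rewrite -[X in 'C(X, _)](card_ord d) -card_draws.
by apply: eq_card => A; rewrite !inE.
Qed.

Lemma sum_missing (S : vertices) : (\sum_r #|missing S r| + #|S| = #|J| * d)%N.
Proof.
have -> : #|S| = (\sum_r \sum_(k < d) ((r, k) \in S))%N.
  rewrite -sum1_card big_mkcond /= (pair_bigA _ (fun r k => ((r, k) \in S : nat))) /=.
  by apply: eq_bigr => -[r k] _ /=; case: (_ \in S).
rewrite -big_split /= -sum_nat_const; apply: eq_bigr => r _.
rewrite -[RHS]card_ord -sum1_card -[in RHS]sum1_card big_mkcond -big_split /=.
by apply: eq_bigr => k _; rewrite inE; case: (_ \in S).
Qed.

(** Every simplex must lose one vertex; the further losses add up to the codimension minus 1, which
    reduces the classification of faces to ways of writing 1 or 2 as a sum. *)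
Lemma proper_excess (S : vertices) : proper_face S ->
  (\sum_r #|missing S r|.-1 = #|J| * d.-1 - #|S|)%N.
Proof.
move=> /andP[_ /forallP mS].
have E : (\sum_r #|missing S r| = \sum_r #|missing S r|.-1 + #|J|)%N.
  rewrite -sum1_card -big_split /=; apply: eq_bigr => r _.
  by rewrite addn1 prednK// card_gt0.
have := sum_missing S; rewrite E.
have -> : (#|J| * d = #|J| + #|J| * d.-1)%N by rewrite -{1}(prednK d_gt0) mulnS.
by lia.
Qed.

Lemma sum_le1 (e : J -> nat) : (forall r, e r <= 1)%N ->
  exists2 E : {set J}, #|E| = (\sum_r e r)%N & forall r, e r = (r \in E).
Proof.
move=> e1; pose E := finset (fun r => e r != 0%N).
have eE r : e r = (r \in E).
  by rewrite inE; have := e1 r; case: (e r) => [|[|]].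
exists E => //; rewrite -sum1_card big_mkcond /=.
by apply: eq_bigr => r _; rewrite (eE r); case: (_ \in E).
Qed.

Lemma sum_eq1 (e : J -> nat) : (\sum_r e r = 1)%N ->
  exists2 E : {set J}, #|E| = 1%N & forall r, e r = (r \in E).
Proof.
move=> e1; have := @sum_le1 e; rewrite e1; apply => r.
by rewrite -e1 (bigD1 r)//= leq_addr.
Qed.

Lemma sum_eq2 (e : J -> nat) : (\sum_r e r = 2)%N ->
  (exists r0, forall r, e r = (2 * (r == r0))%N) \/
  exists2 E : {set J}, #|E| = 2%N & forall r, e r = (r \in E).
Proof.
move=> e2; have [/forallP e1|] := boolP [forall r, e r <= 1]%N.
  by right; have := sum_le1 e1; rewrite e2.
rewrite negb_forall => /existsP[r0]; rewrite -ltnNge => e0; left; exists r0 => r.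
have := e2; rewrite (bigD1 r0)//= => E.
have [->|rr0] := eqVneq r r0; first by lia.
by move: E; rewrite (bigD1 r)//=; lia.
Qed.

Lemma sum_unique_witness (R : nmodType) (T K : finType) (P : pred T) (A : K -> pred T) (F : T -> R) :
  (forall S, P S -> exists k, A k S) -> (forall k S, A k S -> P S) ->
  (forall k k' S, A k S -> A k' S -> k = k') ->
  \sum_(S | P S) F S = \sum_k \sum_(S | A k S) F S.
Proof.
move=> PA AP Auniq; rewrite (exchange_big_dep P) /=; last by move=> k S _ /AP.
apply: eq_bigr => S /PA[k kS]; rewrite (bigD1 k)//= big1 ?addr0// => k' /andP[k'S].
by rewrite (Auniq _ _ _ kS k'S) eqxx.
Qed.

(** Numbers of omitted vertices for the face types in use: [profile_in] with one simplex in [E]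
    gives codimension 2; with two in [E], or [profile_at], which omits three vertices of [r0],
    codimension 3. *)
Definition profile_in (E : {set J}) r : nat := (1 + (r \in E))%N.
Definition profile_at (r0 : J) r : nat := (1 + 2 * (r == r0))%N.

Lemma proper_profile (p : J -> nat) S : (forall r, 0 < p r)%N -> (exists r, p r = 1%N) ->
  has_profile p S -> proper_face S.
Proof.
move=> p0 [r r1] /forallP pS; apply/andP; split.
  apply/negP => /eqP S0; have := pS r; rewrite r1 S0.
  rewrite (_ : missing _ _ = [set: 'I_d]%SET) ?cardsT ?card_ord; first by move/eqP=> d1; move: d_gt1; rewrite d1.
  by apply/setP => k; rewrite !inE.
by apply/forallP => s; rewrite -card_gt0 (eqP (pS s)).
Qed.

Lemma profile_excess (p : J -> nat) S : has_profile p S ->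
  (\sum_r #|missing S r|.-1 = \sum_r (p r).-1)%N.
Proof. by move=> /forallP pS; apply: eq_bigr => r _; rewrite (eqP (pS r)). Qed.

Let n := (#|J| * d.-1)%N.

Lemma proper_face_le (S : vertices) : proper_face S -> (0 < #|S| <= n)%N.
Proof.
move=> pS; have /andP[S0 _] := pS; have [m [q [q_inj qS cS]]] := face_enum S0.
rewrite cS /=; apply: (proper_face_card d_gt1 (erefl n) q_inj).
by rewrite qS.
Qed.

Lemma codim_profile (p : J -> nat) k (S : vertices) : (forall r, 0 < p r)%N -> (exists r, p r = 1%N) ->
  (\sum_r (p r).-1 = k)%N -> has_profile p S ->
  proper_face S && (n.+1 - #|S| == k.+1)%N.
Proof.
move=> p0 p1 pk pS; have fS := proper_profile p0 p1 pS; rewrite fS /=.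
have := proper_excess fS; rewrite (profile_excess pS) pk -/n => kE.
have /andP[_ Sn] := proper_face_le fS.
by rewrite subSn// -kE.
Qed.

Lemma codim_excess k (S : vertices) : proper_face S && (n.+1 - #|S| == k.+1)%N ->
  [/\ (\sum_r #|missing S r|.-1 = k)%N & forall r, #|missing S r| = #|missing S r|.-1.+1].
Proof.
move=> /andP[fS /eqP kS]; split.
  rewrite (proper_excess fS) -/n; have /andP[_ Sn] := proper_face_le fS.
  by move: kS; rewrite subSn// => -[].
by move=> r; move: fS => /andP[_ /forallP/(_ r)]; rewrite -card_gt0; case: #|_|.
Qed.

Lemma card_profile_in (E : {set J}) :
  #|finset (has_profile (profile_in E))| = ('C(d, 2) ^ #|E| * d ^ (#|J| - #|E|))%N.
Proof.
rewrite card_profile (bigID (mem E)) /=; congr (_ * _)%N.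
  rewrite (eq_bigr (fun=> 'C(d, 2))) ?prod_nat_const// => r rE.
  by rewrite /profile_in rE.
rewrite (eq_bigr (fun=> d)) => [|r /negPf rE]; last by rewrite /profile_in rE addn0 bin1.
by rewrite prod_nat_const -(cardC E) addKn; congr (_ ^ _)%N; apply: eq_card.
Qed.

Lemma card_profile_at r0 :
  #|finset (has_profile (profile_at r0))| = ('C(d, 3) * d ^ (#|J|.-1))%N.
Proof.
rewrite card_profile (bigD1 r0)//= /profile_at eqxx; congr (_ * _)%N.
rewrite (eq_bigr (fun=> d)) => [|r /negPf rr0]; last by rewrite rr0 addn0 bin1.
rewrite prod_nat_const; congr (_ ^ _)%N.
by rewrite -(cardC1 r0); apply: eq_card => r; rewrite !inE.
Qed.

Let profile_at_pos r0 r : (0 < profile_at r0 r)%N. Proof. by []. Qed.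

Let profile_in_one (E : {set J}) : (#|E| < #|J|)%N -> exists r, profile_in E r = 1%N.
Proof.
move=> EJ; have [r rE] : exists r, r \notin E.
  apply/existsP; rewrite -negb_forall; apply/negP => /forallP H.
  move: EJ; rewrite ltnNge => /negP; apply; rewrite -cardsT.
  by apply: subset_leq_card; apply/fintype.subsetP => r _; exact: H.
by exists r; rewrite /profile_in (negPf rE).
Qed.

Let profile_in_excess (E : {set J}) : (\sum_r (profile_in E r).-1 = #|E|)%N.
Proof. by rewrite -sum1_card [RHS]big_mkcond; apply: eq_bigr => r _; rewrite /profile_in add1n /=; case: (_ \in E). Qed.

Lemma codim_profile_in (E : {set J}) (S : vertices) : (#|E| < #|J|)%N ->
  has_profile (profile_in E) S -> proper_face S && (n.+1 - #|S| == #|E|.+1)%N.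
Proof.
by move=> EJ; apply: (codim_profile _ _ (profile_in_excess E)) => //; exact: profile_in_one.
Qed.

Lemma codim_profile_at (r0 : J) (S : vertices) :
  has_profile (profile_at r0) S -> proper_face S && (n.+1 - #|S| == 3)%N.
Proof.
have at2 : (\sum_r (profile_at r0 r).-1 = 2)%N.
  by rewrite (bigD1 r0)//= /profile_at eqxx big1// => r /negPf ->.
apply: (codim_profile (profile_at_pos r0) _ at2).
have [r rr0] : exists r, r != r0.
  have : (0 < #|predC1 r0|)%N by rewrite cardC1; lia.
  by move=> /card_gt0P[r]; exists r.
by exists r; rewrite /profile_at (negPf rr0).
Qed.

Let profile_in_inj (E E' : {set J}) S :
  has_profile (profile_in E) S -> has_profile (profile_in E') S -> E = E'.
Proof.
move=> /forallP h /forallP h'; apply/setP => r; have := h r; rewrite (eqP (h' r)).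
by rewrite /profile_in eqn_add2l; case: (r \in E); case: (r \in E').
Qed.

Lemma sum_codim2 (R : nmodType) (F : vertices -> R) (c : R) :
  (forall (E : {set J}) (S : vertices), #|E| = 1%N -> has_profile (profile_in E) S -> F S = c) ->
  \sum_(S : vertices | proper_face S && (n.+1 - #|S| == 2)%N) F S =
  c *+ (#|J| * ('C(d, 2) * d ^ #|J|.-1)).
Proof.
move=> Fc.
rewrite (@sum_unique_witness _ _ {set J} _
  (fun E : {set J} => [pred S | (#|E| == 1%N) && has_profile (profile_in E) S])).
- rewrite (bigID (fun E : {set J} => #|E| == 1%N)) /= [X in _ + X]big1 ?addr0; last first.
    by move=> E /negPf E1; rewrite big_pred0// => S; rewrite E1.
  rewrite (eq_bigr (fun=> c *+ ('C(d, 2) * d ^ #|J|.-1))); last first.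
    move=> E /eqP E1; rewrite (eq_bigr (fun=> c)); last by move=> S /andP[_]; exact: Fc.
    rewrite (eq_bigl (fun S => S \in finset (has_profile (profile_in E)))).
      by rewrite sumr_const card_profile_in E1 expn1 subn1.
    by move=> S; rewrite inE E1 eqxx.
  rewrite sumr_const -mulrnA mulnC; congr (c *+ (_ * _)).
  by rewrite -[RHS]bin1 -card_draws; apply: eq_card => E; rewrite !inE.
- move=> S /codim_excess[/sum_eq1[E E1 eE] mS]; exists E; rewrite /= E1 eqxx /=.
  by apply/forallP => r; rewrite mS eE.
- move=> E S /= /andP[/eqP E1 pS]; rewrite -[in X in _ == X]E1.
  by apply: codim_profile_in pS; rewrite E1 ltnW.
- by move=> E E' S /= /andP[_ pS] /andP[_ pS']; exact: profile_in_inj pS pS'.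
Qed.

Lemma sum_codim3 (R : nmodType) (F : vertices -> R) (a b : R) :
  (forall (r0 : J) (S : vertices), has_profile (profile_at r0) S -> F S = a) ->
  (forall (E : {set J}) (S : vertices), #|E| = 2%N -> has_profile (profile_in E) S -> F S = b) ->
  \sum_(S : vertices | proper_face S && (n.+1 - #|S| == 3)%N) F S =
  a *+ (#|J| * ('C(d, 3) * d ^ #|J|.-1)) +
  b *+ ('C(#|J|, 2) * ('C(d, 2) ^ 2 * d ^ (#|J| - 2))).
Proof.
move=> Fa Fb; pose A (k : J + {set J}) : pred vertices := match k with
  | inl r0 => has_profile (profile_at r0)
  | inr E => [pred S | (#|E| == 2%N) && has_profile (profile_in E) S] end.
rewrite (@sum_unique_witness _ _ (J + {set J})%type _ A).
- rewrite big_sumType /=; congr (_ + _).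
    rewrite (eq_bigr (fun=> a *+ ('C(d, 3) * d ^ #|J|.-1))).
      by rewrite sumr_const -mulrnA mulnC.
    move=> r0 _; rewrite (eq_bigr (fun=> a)); last by move=> S; exact: Fa.
    rewrite (eq_bigl (fun S => S \in finset (has_profile (profile_at r0)))).
      by rewrite sumr_const card_profile_at.
    by move=> S; rewrite inE.
  rewrite (bigID (fun E : {set J} => #|E| == 2%N)) /= [X in _ + X]big1 ?addr0; last first.
    by move=> E /negPf E1; rewrite big_pred0// => S; rewrite E1.
  rewrite (eq_bigr (fun=> b *+ ('C(d, 2) ^ 2 * d ^ (#|J| - 2)))); last first.
    move=> E /eqP E1; rewrite (eq_bigr (fun=> b)); last by move=> S /andP[_]; exact: Fb.
    rewrite (eq_bigl (fun S => S \in finset (has_profile (profile_in E)))).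
      by rewrite sumr_const card_profile_in E1.
    by move=> S; rewrite inE E1 eqxx.
  rewrite sumr_const -mulrnA mulnC; congr (b *+ (_ * _)).
  by rewrite -card_draws; apply: eq_card => E; rewrite !inE.
- move=> S /codim_excess[/sum_eq2[[r0 e0]|[E E1 eE]] mS].
    by exists (inl r0); apply/forallP => r; rewrite mS e0.
  exists (inr E); rewrite /= E1 eqxx /=.
  by apply/forallP => r; rewrite mS eE.
- move=> [r0|E] S /=; first exact: codim_profile_at.
  move=> /andP[/eqP E1 pS]; rewrite -[in X in _ == X]E1.
  by apply: codim_profile_in pS; rewrite E1.
- have mixed r0 E S : has_profile (profile_at r0) S -> has_profile (profile_in E) S -> False.
    move=> /forallP/(_ r0) /eqP h /forallP/(_ r0); rewrite h /profile_at /profile_in eqxx.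
    by case: (_ \in E).
  move=> [r0|E] [r0'|E'] S /=.
  + move=> /forallP/(_ r0) /eqP h /forallP/(_ r0); rewrite h /profile_at eqxx.
    by have [->|] := eqVneq r0 r0'.
  + by move=> h /andP[_ h']; case: (mixed _ _ _ h h').
  + by move=> /andP[_ h'] h; case: (mixed _ _ _ h h').
  + by move=> /andP[_ pS] /andP[_ pS']; rewrite (profile_in_inj pS pS').
Qed.

End counting.

Lemma enum_inj_codom (d k : nat) (A : {set 'I_d}) : #|A| = k ->
  exists2 j : 'I_k -> 'I_d, injective j & A = finset (fun i => i \in codom j).
Proof.
move=> <-; exists enum_val; first exact: enum_val_inj.
apply/setP => i; rewrite inE; apply/idP/codomP => [iA|[l ->]]; last exact: enum_valP.
by exists (enum_rank_in iA i); rewrite enum_rankK_in.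
Qed.

(** * Cell volumes by face type *)

Section profile_cells.
Variables (R : realType) (d n : nat) (J : finType).
Variable v : J * 'I_d -> 'rV[R]_n.
Hypothesis d_gt1 : (1 < d)%N.
Hypothesis J_gt2 : (2 < #|J|)%N.
Hypothesis nE : n = (#|J| * d.-1)%N.
Hypothesis gram : forall i j, dotv (v i) (v j) = (i == j)%:R - (i.1 == j.1)%:R / d%:R.

Let d_gt0 : (0 < d)%N. Proof. exact: ltnW. Qed.

Let rho : R := #|J|%:R - #|J|%:R / d%:R.

(** Since 1 - 1/d >= 1/2 and #|J| > 2. The bound makes the cosine [a] positive, as the isosceles
    formula requires. *)
Let rho_gt1 : 1 < rho.
Proof.
have J2 : 2 < #|J|%:R :> R by rewrite ltr_nat.
have : d%:R^-1 <= 2^-1 :> R by rewrite lef_pV2 ?posrE ?ltr0n// ler_nat.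
by rewrite /rho => h; nra.
Qed.

Lemma face_of_codim (k : nat) (S : {set J * 'I_d}) :
  proper_face S && (n.+1 - #|S| == k)%N ->
  exists m (q : 'I_m.+1 -> J * 'I_d), [/\ injective q, face q = S & n = (m + k)%N].
Proof.
move=> /andP[pS /eqP kS]; have /andP[S0 Sn] := proper_face_le d_gt1 pS.
have [m [q [q_inj qS cS]]] := face_enum (proj1 (andP pS)).
by exists m, q; split=> //; move: kS Sn; rewrite cS -nE subSS => <- Sn; rewrite subnKC// ltnW.
Qed.

Lemma missing_singletons (S : {set J * 'I_d}) :
  exists g : J -> 'I_d, forall r, #|missing S r| = 1%N -> missing S r = finset.set1 (g r).
Proof.
suff /boolp.choice[g gP] : forall r, exists k, #|missing S r| = 1%N -> missing S r = finset.set1 k.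
  by exists g.
move=> r.
have [/eqP/cards1P[k kE]|S1] := eqVneq #|missing S r| 1%N; first by exists k.
(* Where more than one vertex is omitted the value of [g] is arbitrary. *)
by exists (Ordinal d_gt0) => /eqP; rewrite (negPf S1).
Qed.

Lemma face_weight_in (E : {set J}) : face_weight R d (profile_in E) =
  2 ^+ #|E| / d%:R ^+ #|J| *
  (#|E|%:R * ((d%:R - 2) * (d%:R / 2)) + (#|J| - #|E|)%:R * ((d%:R - 1) * d%:R)).
Proof.
have cE : #|[pred r | r \notin E]| = (#|J| - #|E|)%N.
  by rewrite -(cardC E) addKn; apply: eq_card.
rewrite /face_weight; congr (_ * _).
  rewrite big_split /= prodr_const cardE -cardE -exprVn; congr (_ * _).
  rewrite (bigID (mem E)) /= [X in _ * X]big1 ?mulr1; last first.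
    by move=> r /negPf rE; rewrite /profile_in rE.
  by rewrite -prodr_const; apply: eq_bigr => r rE; rewrite /profile_in rE.
rewrite (bigID (mem E)) /=; congr (_ + _).
  rewrite mulr_natl -sumr_const; apply: eq_bigr => r rE.
  by rewrite /profile_in rE.
rewrite mulr_natl -cE -sumr_const; apply: eq_bigr => r /negPf rE.
by rewrite /profile_in rE addn0 divr1.
Qed.

Lemma face_weight_at (r0 : J) : face_weight R d (profile_at r0) =
  3 / d%:R ^+ #|J| *
  ((d%:R - 3) * (d%:R / 3) + #|J|.-1%:R * ((d%:R - 1) * d%:R)).
Proof.
rewrite /face_weight; congr (_ * _).
  rewrite big_split /= prodr_const -exprVn; congr (_ * _).
  rewrite (bigD1 r0)//= big1 ?mulr1; first by rewrite /profile_at eqxx.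
  by move=> r /negPf rr0; rewrite /profile_at rr0.
rewrite (bigD1 r0)//=; congr (_ + _); first by rewrite /profile_at eqxx.
rewrite mulr_natl -(cardC1 r0) -sumr_const; apply: eq_big => r; first by rewrite !inE.
by move=> /negPf rr0; rewrite /profile_at rr0 addn0 divr1.
Qed.

Let a := 1 - rho^-1.
Let b := 1 - 2 / rho.

Lemma leb_cell_in1 (E : {set J}) (S : {set J * 'I_d}) : #|E| = 1%N ->
  has_profile (profile_in E) S ->
  fine (leb R n (cell v S 1)) =
  Num.sqrt (face_weight R d (profile_in E)) / (n - 2)`!%:R * (acos a / 2).
Proof.
move=> E1 SE; have := codim_profile_in d_gt1 J_gt2 _ SE; rewrite E1 -nE => /(_ (ltnW J_gt2)) kS.
have /andP[pS _] := kS.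
have [m [q [q_inj qS nm]]] := face_of_codim kS.
have SEr r : #|missing S r| = profile_in E r by move/forallP: SE => /(_ r)/eqP.
have /eqP/cards1P[r0 Er0] := E1.
have [|j j_inj jE] := @enum_inj_codom d 2 (missing S r0).
  by rewrite SEr /profile_in Er0 inE eqxx.
have [g gE] := missing_singletons S.
have nm' : (n - 2 = m)%N by rewrite [in LHS]nm addnK.
rewrite -(funext SEr) nm' -qS (leb_cell_codim2 d_gt1 gram erefl rho_gt1 nm q_inj _ j_inj (g := g) (r0 := r0))//.
- by rewrite qS.
- by rewrite qS.
- by move=> r rr0; rewrite qS gE// SEr /profile_in Er0 inE (negPf rr0).
Qed.

Lemma leb_cell_at (r0 : J) (S : {set J * 'I_d}) : has_profile (profile_at r0) S ->
  fine (leb R n (cell v S 1)) =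
  Num.sqrt (face_weight R d (profile_at r0)) / (n - 3)`!%:R *
  (4 / 3 * atan (Num.sqrt (tan (acos a / 2 + acos a / 4) * tan (acos a / 2 - acos a / 4) *
      tan (acos a / 4) ^+ 2))).
Proof.
move=> SE; have := codim_profile_at d_gt1 J_gt2 SE; rewrite -nE => kS.
have /andP[pS _] := kS.
have [m [q [q_inj qS nm]]] := face_of_codim kS.
have SEr r : #|missing S r| = profile_at r0 r by move/forallP: SE => /(_ r)/eqP.
have [|j j_inj jE] := @enum_inj_codom d 3 (missing S r0).
  by rewrite SEr /profile_at eqxx.
have [g gE] := missing_singletons S.
have nm' : (n - 3 = m)%N by rewrite [in LHS]nm addnK.
rewrite -(funext SEr) nm' -qS (leb_cell_codim3_one d_gt1 gram erefl rho_gt1 nm q_inj _ j_inj (g := g) (r0 := r0))//.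
- by rewrite qS.
- by rewrite qS.
- by move=> r rr0; rewrite qS gE// SEr /profile_at (negPf rr0).
Qed.

Lemma leb_cell_in2 (E : {set J}) (S : {set J * 'I_d}) : #|E| = 2%N ->
  has_profile (profile_in E) S ->
  fine (leb R n (cell v S 1)) =
  Num.sqrt (face_weight R d (profile_in E)) / (n - 3)`!%:R *
  (8 / 3 * atan (Num.sqrt (tan (acos a / 2 + acos b / 4) * tan (acos a / 2 - acos b / 4) *
      tan (acos b / 4) ^+ 2))).
Proof.
move=> E2 SE; have := codim_profile_in d_gt1 J_gt2 _ SE; rewrite E2 -nE => /(_ J_gt2) kS.
have /andP[pS _] := kS.
have [m [q [q_inj qS nm]]] := face_of_codim kS.
have SEr r : #|missing S r| = profile_in E r by move/forallP: SE => /(_ r)/eqP.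
have /eqP/cards2P[r1 [r2 [r12 Er]]] := E2.
have /eqP/cards2P[j0 [j1 [j01 jE]]] : #|missing S r1| = 2%N.
  by rewrite SEr /profile_in Er !inE eqxx.
have /eqP/cards2P[k0 [k1 [k01 kE]]] : #|missing S r2| = 2%N.
  by rewrite SEr /profile_in Er !inE eqxx orbT.
have [g gE] := missing_singletons S.
have nm' : (n - 3 = m)%N by rewrite [in LHS]nm addnK.
rewrite -(funext SEr) nm' -qS
  (leb_cell_codim3_two d_gt1 gram erefl rho_gt1 q_inj _ r12 j01 k01 _ _ _ nm (g := g))//.
- by rewrite qS.
- by rewrite qS.
- by rewrite qS.
- by move=> r rr1 rr2; rewrite qS gE// SEr /profile_in Er !inE (negPf rr1) (negPf rr2).
Qed.

End profile_cells.

(** * The coefficients of the Steiner polynomial *)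

Lemma steiner_coefficients (R : realType) (d n : nat) (J : finType)
    (v : J * 'I_d -> 'rV[R]_n) : (1 < d)%N -> (0 < #|J|)%N -> n = (#|J| * d.-1)%N ->
  (forall i j, dotv (v i) (v j) = (i == j)%:R - (i.1 == j.1)%:R / d%:R) ->
  exists a : nat -> R,
    (forall eps, 0 <= eps ->
       leb R n (parallel_body (conv_hull v) eps) = (\sum_(k < n.+1) a k * eps ^+ k)%:E) /\
    forall k, a k.+1 = \sum_(S | proper_face S && ((#|J| * d.-1).+1 - #|S| == k.+1)%N)
      fine (leb R n (cell v S 1)).
Proof.
move=> d1 J0 nE gram.
pose codim (S : {set J * 'I_d}) := (n.+1 - #|S|)%N.
(* The volume of the polytope goes into coefficient 0; a cell goes into the coefficient of its
   codimension. *)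
exists (fun k => (fine (leb R n (cell v [set: J * 'I_d]%SET 1))) *+ (k == 0%N) +
  \sum_(S | proper_face S && (codim S == k)) fine (leb R n (cell v S 1))).
split=> [eps eps0|k]; last by rewrite mulr0n add0r; apply: eq_bigl => S; rewrite /codim [in LHS]nE.
rewrite (steiner_formula d1 J0 nE gram eps0); congr _%:E.
under [RHS]eq_bigr do rewrite mulrDl.
rewrite [RHS]big_split /=; congr (_ + _).
  rewrite big_ord_recl mulr1n expr0 mulr1 big1 ?addr0// => k _.
  by rewrite mulr0n mul0r.
under [RHS]eq_bigr do rewrite mulr_suml.
rewrite (exchange_big_dep (@proper_face d J)) /=; last by move=> k S _ /andP[].
apply: eq_bigr => S pS; have Sn : (codim S < n.+1)%N.
  by rewrite /codim ltnS; have /andP[] := proper_face_le d1 pS; lia.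
rewrite (big_pred1 (Ordinal Sn))// => k.
by rewrite pS /= eq_sym -val_eqE.
Qed.

Lemma natr_bin2 (R : numFieldType) n : 'C(n, 2)%:R = n%:R * (n%:R - 1) / 2 :> R.
Proof.
elim: n => [|n IH]; first by rewrite !mul0r.
by rewrite binS natrD IH bin1 -natr1; field.
Qed.

Lemma natr_bin3 (R : numFieldType) n :
  'C(n, 3)%:R = n%:R * (n%:R - 1) * (n%:R - 2) / 6 :> R.
Proof.
elim: n => [|n IH]; first by rewrite !mul0r.
by rewrite binS natrD IH natr_bin2 -natr1; field.
Qed.

Lemma powR_half_nat (R : realType) (x : R) (n : nat) : 0 <= x ->
  x `^ (n%:R / 2) = Num.sqrt (x ^+ n).
Proof. by move=> x0; rewrite powRrM powR_mulrn// powR12_sqrt// exprn_ge0. Qed.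

Theorem theorem2 (R : realType) (d : nat) (hd : (2 <= d)%N)
  (v : 'I_d.+1 -> 'I_d -> 'rV[R]_((d ^ 2).-1))
  (hv : forall (r s : 'I_d.+1) (j k : 'I_d),
      dotv (v r j) (v s k) =
        if r == s then (if j == k then 1 - d%:R^-1 else - d%:R^-1) else 0) :
  let P := conv_hull (fun rj : 'I_d.+1 * 'I_d => v rj.1 rj.2) in
  let alpha := acos (1 - d%:R / (d%:R ^+ 2 - 1)) : R in
  let beta := acos (1 - 2 * d%:R / (d%:R ^+ 2 - 1)) : R in
  exists a : nat -> R,
    (forall eps : R, 0 <= eps ->
       vol (parallel_body P eps) = (\sum_(k < (d ^ 2).-1.+1) a k * eps ^+ k)%:E) /\
    a 2%N = Num.sqrt (2 * d%:R ^+ 2 - d%:R - 2) * (d%:R ^+ 2 - 1)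
              * d%:R `^ (d%:R / 2 + 1) / (4 * ((d ^ 2 - 3)`!)%:R) * alpha /\
    a 3%N = 2 * Num.sqrt (3 * d%:R ^+ 2 - 2 * d%:R - 3) * (d%:R ^+ 2 - 1)
              * (d%:R - 2) * d%:R `^ (d%:R / 2 + 1) / (9 * ((d ^ 2 - 4)`!)%:R)
              * atan (Num.sqrt (tan (3 * alpha / 4) * tan (alpha / 4) ^+ 3))
            + 2 * Num.sqrt (d%:R ^+ 2 - d%:R - 1) * (d%:R ^+ 2 - 1)
              * (d%:R - 1) * d%:R `^ (d%:R / 2 + 2) / (3 * ((d ^ 2 - 4)`!)%:R)
              * atan (Num.sqrt (tan (alpha / 2 + beta / 4) * tan (alpha / 2 - beta / 4)
                                * tan (beta / 4) ^+ 2)).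
Proof.
move=> P alpha beta; pose v' (rj : 'I_d.+1 * 'I_d) := v rj.1 rj.2.
have gram i j : dotv (v' i) (v' j) = (i == j)%:R - (i.1 == j.1)%:R / d%:R.
  case: i j => r j [s k]; rewrite /v' hv /= xpair_eqE.
  by case: (r == s); case: (j == k) => /=; rewrite ?mul1r ?mul0r ?sub0r ?subr0 ?oppr0.
have cJ : #|'I_d.+1| = d.+1 by rewrite card_ord.
have J2 : (2 < #|'I_d.+1|)%N by rewrite cJ.
have nE : (d ^ 2).-1 = (#|'I_d.+1| * d.-1)%N by rewrite cJ; lia.
have [a [aE aS]] := steiner_coefficients hd (ltnW (ltnW J2)) nE gram.
exists a; split=> [eps eps0|]; first by rewrite volE aE.
set D : R := d%:R.
have D2 : 2 <= D by rewrite ler_nat.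
have D0 : 0 < D by lra.
have D1 : 0 < D ^+ 2 - 1 by nra.
set rho : R := #|'I_d.+1|%:R - #|'I_d.+1|%:R / d%:R.
have rhoE : rho = (D ^+ 2 - 1) / D.
  by rewrite /rho cJ -[d.+1%:R]natr1 -/D; field; rewrite gt_eqF.
have alphaE : acos (1 - rho^-1) = alpha by rewrite /alpha rhoE invf_div.
have betaE : acos (1 - 2 / rho) = beta by rewrite /beta rhoE invf_div mulrA.
(* [s] stands for d^(d/2): the face volumes carry 1/s and the face counts carry s^2, which leaves
   the single s of the statement. *)
pose s := Num.sqrt (D ^+ d).
have s0 : 0 < s by rewrite sqrtr_gt0 exprn_gt0.
have s2 : D ^+ d = s ^+ 2 by rewrite sqr_sqrtr// exprn_ge0// ltW.
have sD : D ^+ d.-1 = s ^+ 2 / D.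
  by rewrite -s2 -{2}(prednK (ltnW hd)) exprSr mulfK// gt_eqF.
have sqrtw x : 0 <= x -> Num.sqrt (x / D ^+ d) = Num.sqrt x / s.
  by move=> x0; rewrite sqrtrM// sqrtrV// exprn_ge0// ltW.
have pow k : D `^ (D / 2 + k%:R) = s * D ^+ k.
  have half : D `^ (D / 2) = s by apply: powR_half_nat; exact: ltW.
  rewrite powRD; last by rewrite (gt_eqF D0) implybT.
  by rewrite half powR_mulrn// ltW.
have fact3 : ((d ^ 2).-1 - 2 = d ^ 2 - 3)%N by lia.
have fact4 : ((d ^ 2).-1 - 3 = d ^ 2 - 4)%N by lia.
have weight1 (E : {set 'I_d.+1}) : #|E| = 1%N ->
    Num.sqrt (face_weight R d (profile_in E)) = Num.sqrt (2 * D ^+ 2 - D - 2) / s.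
  move=> E1; rewrite face_weight_in E1 cJ subn1 /= -/D [D ^+ d.+1]exprS -sqrtw; last by nra.
  by congr Num.sqrt; field; rewrite expf_neq0 !gt_eqF.
have weight2 (E : {set 'I_d.+1}) : #|E| = 2%N ->
    Num.sqrt (face_weight R d (profile_in E)) = 2 * Num.sqrt (D ^+ 2 - D - 1) / s.
  move=> E2; rewrite face_weight_in E2 cJ -/D [D ^+ d.+1]exprS subSS natrB ?(ltnW hd)// -/D.
  have -> : 2 * Num.sqrt (D ^+ 2 - D - 1) = Num.sqrt (2 ^+ 2 * (D ^+ 2 - D - 1)).
    by rewrite sqrtrM ?sqrtr_sqr ?ger0_norm// exprn_ge0.
  rewrite -sqrtw; last by nra.
  by congr Num.sqrt; field; rewrite expf_neq0 !gt_eqF.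
have weight3 (r : 'I_d.+1) :
    Num.sqrt (face_weight R d (profile_at r)) = Num.sqrt (3 * D ^+ 2 - 2 * D - 3) / s.
  rewrite face_weight_at cJ /= -/D [D ^+ d.+1]exprS -sqrtw; last by nra.
  by congr Num.sqrt; field; rewrite expf_neq0 !gt_eqF.
have bin2D : 'C(d, 2)%:R = D * (D - 1) / 2 by exact: natr_bin2.
(* For d = 2 this vanishes, in accordance with the factor d - 2: a segment has no three vertices to
   omit. *)
have bin3D : 'C(d, 3)%:R = D * (D - 1) * (D - 2) / 6 by exact: natr_bin3.
have bin2J : 'C(d.+1, 2)%:R = (D + 1) * D / 2 :> R by rewrite natr_bin2 -natr1 addrK.
have fact_neq0 k : (k`!)%:R != 0 :> R by rewrite pnatr_eq0 -lt0n fact_gt0.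
have cell2 (E : {set 'I_d.+1}) (S : {set 'I_d.+1 * 'I_d}) : #|E| = 1%N ->
    has_profile (profile_in E) S -> fine (leb R _ (cell v' S 1)) =
    Num.sqrt (2 * D ^+ 2 - D - 2) / s / (d ^ 2 - 3)`!%:R * (alpha / 2).
  move=> E1 SE; rewrite (leb_cell_in1 hd J2 nE gram E1 SE) weight1// fact3.
  by rewrite -alphaE.
have cell3 (r : 'I_d.+1) (S : {set 'I_d.+1 * 'I_d}) :
    has_profile (profile_at r) S -> fine (leb R _ (cell v' S 1)) =
    Num.sqrt (3 * D ^+ 2 - 2 * D - 3) / s / (d ^ 2 - 4)`!%:R *
    (4 / 3 * atan (Num.sqrt (tan (3 * alpha / 4) * tan (alpha / 4) ^+ 3))).
  move=> SE; rewrite (leb_cell_at hd J2 nE gram SE) weight3// fact4 -alphaE.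
  set A := acos _; have -> : A / 2 + A / 4 = 3 * A / 4 by lra.
  have -> : A / 2 - A / 4 = A / 4 by lra.
  by rewrite (exprS (tan (A / 4)) 2) mulrA.
have cell22 (E : {set 'I_d.+1}) (S : {set 'I_d.+1 * 'I_d}) : #|E| = 2%N ->
    has_profile (profile_in E) S -> fine (leb R _ (cell v' S 1)) =
    2 * Num.sqrt (D ^+ 2 - D - 1) / s / (d ^ 2 - 4)`!%:R *
    (8 / 3 * atan (Num.sqrt (tan (alpha / 2 + beta / 4) * tan (alpha / 2 - beta / 4)
                                * tan (beta / 4) ^+ 2))).
  move=> E2 SE; rewrite (leb_cell_in2 hd J2 nE gram E2 SE) weight2// fact4.
  by rewrite -alphaE -betaE.
have count2 : (d.+1 * ('C(d, 2) * d ^ d))%:R = (D + 1) * (D * (D - 1) / 2 * s ^+ 2).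
  by rewrite !natrM natrX -natr1 bin2D -/D s2.
have count3 : (d.+1 * ('C(d, 3) * d ^ d))%:R =
    (D + 1) * (D * (D - 1) * (D - 2) / 6 * s ^+ 2).
  by rewrite !natrM natrX -natr1 bin3D -/D s2.
have count22 : ('C(d.+1, 2) * ('C(d, 2) ^ 2 * d ^ d.-1))%:R =
    (D + 1) * D / 2 * ((D * (D - 1) / 2) ^+ 2 * (s ^+ 2 / D)).
  by rewrite !natrM !natrX bin2D bin2J -/D sD.
(* The last algebra is done on variables, with x, y, u for d, s and the factorial, so that [field]
   meets neither factorials nor symbolic exponents. *)
have coef2 N (x y u t X : R) : y != 0 -> u != 0 ->
    N%:R = (x + 1) * (x * (x - 1) / 2 * y ^+ 2) ->
    (X / y / u * (t / 2)) *+ N = X * (x ^+ 2 - 1) * (y * x ^+ 1) / (4 * u) * t.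
  by move=> y0 u0 NE; rewrite -mulr_natr NE; field; rewrite y0 u0.
have coef3 N N' (x y u t t' X X' : R) : x != 0 -> y != 0 -> u != 0 ->
    N%:R = (x + 1) * (x * (x - 1) * (x - 2) / 6 * y ^+ 2) ->
    N'%:R = (x + 1) * x / 2 * ((x * (x - 1) / 2) ^+ 2 * (y ^+ 2 / x)) ->
    (X / y / u * (4 / 3 * t)) *+ N + (2 * X' / y / u * (8 / 3 * t')) *+ N' =
    2 * X * (x ^+ 2 - 1) * (x - 2) * (y * x ^+ 1) / (9 * u) * t +
    2 * X' * (x ^+ 2 - 1) * (x - 1) * (y * x ^+ 2) / (3 * u) * t'.
  move=> x0 y0 u0 NE NE'; rewrite -[X in X + _ = _]mulr_natr -[X in _ + X = _]mulr_natr NE NE'.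
  by field; rewrite x0 y0 u0.
split.
  rewrite aS (sum_codim2 hd J2 cell2) cJ (pow 1%N).
  exact: coef2 (lt0r_neq0 s0) (fact_neq0 _) count2.
rewrite aS (sum_codim3 hd J2 cell3 cell22) cJ subSS subn1 (pow 1%N) (pow 2%N).
exact: coef3 (lt0r_neq0 D0) (lt0r_neq0 s0) (fact_neq0 _) count3 count22.
Qed.
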